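(* Let $H$ be a coquasi-Hopf algebra with bijective antipode, $A$ a right $H$-comodule algebra and $B=A^{coH}$ its subalgebra of coinvariants. Then the following statements are equivalent: (1) the extension $B\subseteq A$ is $H$-cleft; (2) the Weak Structure Theorem holds (that is, the counit $\varepsilon_M:M^{coH}\otimes_B A\to M$, $m\otimes_B a\mapsto ma$, is bijective for every $M\in\mathcal{M}_A^H$) and the extension $B\subseteq A$ has the normal basis property; (3) the extension $B\subseteq A$ is $H$-Galois and has the normal basis property. In this case, the categories $\mathcal{M}_B$ and $\mathcal{M}_A^H$ are equivalent (the Strong Structure Theorem holds, i.e. the induction functor $(-)\otimes_B A$ and the coinvariants functor $(-)^{coH}$ are inverse equivalences).
   Context: Everything is over a field $k$; $\otimes=\otimes_k$. Sweedler notation: $\Delta(h)=h_1\otimes h_2$ (summation suppressed); for a right comodule, $\rho(m)=m_0\otimes m_1$, iterated as $m_0\otimes m_1\otimes m_2$, etc. A coquasi-bialgebra is a coassociative counital coalgebra $(H,\Delta,\varepsilon)$ with coalgebra morphisms $H\otimes H\to H$, $h\otimes g\mapsto hg$, and $k\to H$, $1\mapsto 1_H$, and a convolution invertible $\omega\in(H\otimes H\otimes H)^*$ such that for all $h,g,x,y\in H$: $h_1(g_1x_1)\omega(h_2,g_2,x_2)=\omega(h_1,g_1,x_1)(h_2g_2)x_2$; $1_Hh=h1_H=h$; $\omega(h_1,g_1,x_1y_1)\omega(h_2g_2,x_2,y_2)=\omega(g_1,x_1,y_1)\omega(h_1,g_2x_2,y_2)\omega(h_2,g_3,x_3)$; $\omega(h,1_H,g)=\varepsilon(h)\varepsilon(g)$.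 A coquasi-Hopf algebra is a coquasi-bialgebra with a coalgebra antihomomorphism $S:H\to H$ (antipode) and $\alpha,\beta\in H^*$ such that $S(h_1)\alpha(h_2)h_3=\alpha(h)1_H$, $h_1\beta(h_2)S(h_3)=\beta(h)1_H$, $\omega(h_1\beta(h_2),S(h_3),\alpha(h_4)h_5)=\omega^{-1}(S(h_1),\alpha(h_2)h_3\beta(h_4),S(h_5))=\varepsilon(h)$. The triple $(S,\alpha,\beta)$ is fixed and normalized by $\alpha(1_H)=\beta(1_H)=1$. A right $H$-comodule algebra is a right $H$-comodule $A$ with a multiplication and an element $1_A$ such that $\rho(ab)=a_0b_0\otimes a_1b_1$, $\rho(1_A)=1_A\otimes 1_H$, $1_Aa=a=a1_A$, $(ab)c=a_0(b_0c_0)\omega(a_1,b_1,c_1)$. $B=A^{coH}=\{a\in A:\rho(a)=a\otimes 1_H\}$ is an associative unital algebra, and $A$ is a $B$-bimodule by multiplication. $\mathcal{M}_A^H$ (right relative Hopf modules): right $H$-comodules $M$ with a right action $M\otimes A\to M$ satisfying $\rho(ma)=m_0a_0\otimes m_1a_1$, $m1_A=m$, $(ma)b=m_0(a_0b_0)\omega(m_1,a_1,b_1)$; morphisms are the $H$-colinear maps respecting the action. $M^{coH}=\{m:\rho(m)=m\otimes1_H\}$ is a right $B$-module. For $N\in\mathcal{M}_B$ (right $B$-modules), $N\otimes_BA\in\mathcal{M}_A^H$ by $\rho(n\otimes_Ba)=n\otimes_Ba_0\otimes a_1$, $(n\otimes_Ba)b=n\otimes_Bab$. The functor $(-)\otimes_BA$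 is left adjoint to $(-)^{coH}$. $B\subseteq A$ is ($H$-)Galois if the map $can:A\otimes_BA\to A\otimes H$, $can(a\otimes_Bb)=a_0b_0\otimes b_4\,\omega^{-1}(a_1,b_1\beta(b_2),S(b_3))$, is bijective. $B\subseteq A$ is ($H$-)cleft if there are an $H$-colinear map $\gamma:H\to A$ ($H$ a comodule via $\Delta$) and a linear map $\delta:H\to A$ with, for all $h\in H$: $\rho(\delta(h))=\delta(h_2)\otimes S(h_1)$, $\delta(h_1)\gamma(h_2)=\alpha(h)1_A$, $\gamma(h_1)\beta(h_2)\delta(h_3)=\varepsilon(h)1_A$. $B\subseteq A$ has the normal basis property if there is an isomorphism $A\simeq B\otimes H$ of left $B$-modules and right $H$-comodules, where $B$ acts on the first factor and $H$ coacts on the second factor via $\Delta$. *)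

(* Defs.v *)
From HB Require Import structures.
From mathcomp Require Import all_boot all_algebra.
From mathcomp Require Import boolp classical_sets.
From mathcomp.multinomials Require Import freeg.

Set Implicit Arguments.
Unset Strict Implicit.
Unset Printing Implicit Defensive.

Import GRing.Theory.

Local Open Scope ring_scope.
Local Open Scope quotient_scope.

Section Span.
Variables (k : fieldType) (V : lmodType k) (S : set V).

Inductive in_span : V -> Prop :=
  | in_span0 : in_span 0
  | in_spanD c u v : S u -> in_span v -> in_span (c *: u + v).

Definition span : {pred V} := [pred x | `[< in_span x >]].

Lemma spanP x : reflect (in_span x) (x \in span).
Proof. exact: asboolP. Qed.

Lemma span_submod_closed : submod_closed span.
Proof.
split; first by apply/spanP; exact: in_span0.
move=> a u v /spanP Hu /spanP Hv; apply/spanP.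
elim: Hu => [|c x y Sx _ IH]; first by rewrite scaler0 add0r.
by rewrite scalerDr scalerA -addrA; apply: in_spanD.
Qed.

HB.instance Definition _ :=
  GRing.isSubmodClosed.Build k V span span_submod_closed.

Lemma mem_span x : S x -> x \in span.
Proof.
move=> Sx; apply/spanP; rewrite -[x]scale1r -[_ *: x]addr0.
by apply: in_spanD => //; exact: in_span0.
Qed.

(* The quotient of V by the subspace generated by S. *)
Definition quot_span : Type := {ideal_quot span}.

HB.instance Definition _ := Choice.on quot_span.
HB.instance Definition _ := GRing.Zmodule.on quot_span.

Definition quot_pi : V -> quot_span := \pi_({ideal_quot span}).
Definition quot_repr : quot_span -> V := repr.

Lemma quot_reprK x : quot_pi (quot_repr x) = x.
Proof. exact: reprK. Qed.

Lemma quot_piD : {morph quot_pi : x y / x + y}.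
Proof. by move=> x y; exact: (@Quotient.pi_add _ span). Qed.

Lemma quot_piE x y : (quot_pi x = quot_pi y) <-> (x - y \in span).
Proof. by rewrite Quotient.idealrBE; split=> [/eqP//|/eqP]. Qed.

Definition quot_scale (a : k) (x : quot_span) := quot_pi (a *: quot_repr x).

Lemma quot_piZ a x : quot_pi (a *: x) = quot_scale a (quot_pi x).
Proof.
apply/quot_piE; rewrite -scalerBr; apply: rpredZ.
by apply/quot_piE; rewrite quot_reprK.
Qed.

Fact quot_scaleA a b x : quot_scale a (quot_scale b x) = quot_scale (a * b) x.
Proof. by rewrite -[x]quot_reprK -!quot_piZ scalerA. Qed.
Fact quot_scale1 : left_id 1 quot_scale.
Proof. by move=> x; rewrite -[x]quot_reprK -!quot_piZ scale1r. Qed.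
Fact quot_scaleDr : right_distributive quot_scale +%R.
Proof.
move=> a x y; rewrite -[x]quot_reprK -[y]quot_reprK -quot_piD -!quot_piZ.
by rewrite scalerDr quot_piD.
Qed.
Fact quot_scaleDl x : {morph quot_scale^~ x : a b / a + b}.
Proof.
by move=> a b; rewrite -[x]quot_reprK -!quot_piZ scalerDl quot_piD.
Qed.

HB.instance Definition _ := GRing.Zmodule_isLmodule.Build k quot_span
  quot_scaleA quot_scale1 quot_scaleDr quot_scaleDl.

Fact quot_pi_linear : linear quot_pi.
Proof. by move=> a x y; rewrite quot_piD quot_piZ. Qed.

HB.instance Definition _ := GRing.isLinear.Build k V quot_span *:%R quot_pi
  quot_pi_linear.

Lemma quot_lift (W : lmodType k) (f : {linear V -> W}) :
  (forall x, S x -> f x = 0) ->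
  linear (fun x => f (quot_repr x)) /\
  (forall v, f (quot_repr (quot_pi v)) = f v).
Proof.
move=> fS.
have fspan x : x \in span -> f x = 0.
  move=> /spanP; elim=> [|c u v Su _ IH]; first exact: linear0.
  by rewrite linearP fS // IH scaler0 addr0.
have fE v : f (quot_repr (quot_pi v)) = f v.
  apply/eqP; rewrite -subr_eq0 -linearB; apply/eqP/fspan.
  by apply/quot_piE; rewrite quot_reprK.
split=> // a x y; rewrite -{1}[x]quot_reprK -{1}[y]quot_reprK.
by rewrite -quot_pi_linear fE linearP.
Qed.

End Span.

Section Tensor.
Variables (k : fieldType) (U V : lmodType k).

Local Notation gen u v := (<< (u, v) >> : {freeg (U * V) / k}).

Definition tens_rel : set {freeg (U * V) / k} := fun x =>
  [\/ exists a u u' v, x = gen (a *: u + u') v - (a *: gen u v + gen u' v)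
    | exists a u v v', x = gen u (a *: v + v') - (a *: gen u v + gen u v')].

Definition tens : Type := quot_span tens_rel.
HB.instance Definition _ := GRing.Lmodule.on tens.

Definition tpair (u : U) (v : V) : tens := quot_pi tens_rel (gen u v).

End Tensor.

Notation "U ⊗ V" := (tens U V) (at level 40, left associativity) : type_scope.
Notation "''Lin' ( U , V )" := {linear U%type -> V%type}
  (at level 8, format "''Lin' ( U ,  V )") : type_scope.
Notation "''Dual' ( U )" := {scalar U%type}
  (at level 8, format "''Dual' ( U )") : type_scope.
Notation "u ⊗ v" := (tpair u v) (at level 40, left associativity) : ring_scope.

(* A record, so that unification does not unfold linearity. *)
Record lin (k : fieldType) (U V : lmodType k) (f : U -> V) : Prop :=
  Lin { linE : linear f }.

Definition bil (k : fieldType) (U V W : lmodType k) (f : U -> V -> W) : Prop :=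
  (forall v, lin (fun u => f u v)) /\ (forall u, lin (f u)).

Section LinTheory.
Variables (k : fieldType) (U V : lmodType k) (f : U -> V).
Hypothesis fL : lin f.

Lemma linD : {morph f : x y / x + y}.
Proof. by move=> x y; rewrite -[x in LHS]scale1r (linE fL) scale1r. Qed.

Lemma lin0 : f 0 = 0.
Proof. by apply: (addrI (f 0)); rewrite -linD !addr0. Qed.

Lemma linZ a x : f (a *: x) = a *: f x.
Proof. by rewrite -[a *: x]addr0 (linE fL) lin0 addr0. Qed.

Lemma lin_sum I (r : seq I) (F : I -> U) :
  f (\sum_(i <- r) F i) = \sum_(i <- r) f (F i).
Proof. by elim/big_rec2: _ => [|i y x _ <-]; [exact: lin0 | exact: linD]. Qed.

End LinTheory.

Section TensorTheory.
Variables (k : fieldType) (U V : lmodType k).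

Lemma tpair_bil : bil (@tpair k U V).
Proof.
split=> [v|u]; [split=> a u u'|split=> a v v'] => /=; apply/eqP; rewrite -subr_eq0 /tpair; apply/eqP.
  rewrite -linearP -linearB -(linear0 (quot_pi (@tens_rel k U V))).
  apply/quot_piE; rewrite subr0; apply: mem_span; left.
  by exists a, u, u', v.
rewrite -linearP -linearB -(linear0 (quot_pi (@tens_rel k U V))).
apply/quot_piE; rewrite subr0; apply: mem_span; right.
by exists a, u, v, v'.
Qed.

Lemma tens_repr (t : U ⊗ V) :
  exists s : seq (U * V), t = \sum_(p <- s) p.1 ⊗ p.2.
Proof.
rewrite -[t]quot_reprK -[quot_repr t]freeg_sumE linear_sum.
set D := quot_repr t; move: (dom D) => d.
exists [seq (coeff z D *: z.1, z.2) | z <- d].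
rewrite big_map; apply: eq_bigr => -[u v] _ /=.
have -> : << coeff (u, v) D *g (u, v) >> = coeff (u, v) D *: << (u, v) >>.
  by apply/eqP/freeg_eqP => z; rewrite coeffZ !coeffU mul1r.
by rewrite linearZ; exact/esym/(linZ (tpair_bil.1 v)).
Qed.

End TensorTheory.

(* Sum over a chosen representation t = \sum_i u_i ⊗ v_i; for bilinear f the
   value does not depend on the representation (tsumE). *)
HB.lock Definition tsum (k : fieldType) (U V : lmodType k) (W : nmodType)
    (t : U ⊗ V) (f : U -> V -> W) : W :=
  \sum_(p <- projT1 (cid (tens_repr t))) f p.1 p.2.
Canonical tsum_unlockable := Unlockable tsum.unlock.
Arguments tsum {k U V W} t f.

(* Sweedler sums. An iterated sum over chosen representations of coproducts is
   the usual Sweedler expression as soon as the summand is multilinear, which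
   is the case in every definition below. *)
Notation "\tsum_ ( u ⊗ v <- t ) F" := (tsum t (fun u v => F))
  (at level 41, u name, v name, t at level 39, F at level 41,
   right associativity, format "\tsum_ ( u  ⊗  v  <-  t )  F") : ring_scope.

Definition mklin (k : fieldType) (U V : lmodType k) (f : U -> V) (fL : lin f) :
  {linear U -> V} :=
  HB.pack_for {linear U -> V} f (GRing.isLinear.Build k U V *:%R f (linE fL)).

Section TsumTheory.
Variables (k : fieldType) (U V : lmodType k).

Lemma tsum_repr (t : U ⊗ V) :
  t = \sum_(p <- projT1 (cid (tens_repr t))) p.1 ⊗ p.2.
Proof. by case: cid. Qed.

Lemma tens_lift (W : lmodType k) (f : U -> V -> W) : bil f ->
  exists2 g : U ⊗ V -> W, lin g & forall u v, g (u ⊗ v) = f u v.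
Proof.
case=> fl fr; pose h := fglift (fun p : U * V => f p.1 p.2).
have hU a u v : h << a *g (u, v) >> = a *: f u v by exact: liftU.
have hD x y : h (x + y) = h x + h y.
  have hB y' z : h (y' - z) = h y' - h z by exact: lift_is_additive.
  have h0 : h 0 = 0 by have := hB 0 0; rewrite !subrr.
  have hN z : h (- z) = - h z by have := hB 0 z; rewrite !sub0r h0 sub0r.
  by rewrite -[y in LHS]opprK hB hN opprK.
have hsum I (r : seq I) F : h (\sum_(i <- r) F i) = \sum_(i <- r) h (F i).
  elim/big_rec2: _ => [|i y x _ <-]; last exact: hD.
  by apply: (addrI (h 0)); rewrite -hD !addr0.
have hZ a x : h (a *: x) = a *: h x.
  rewrite -[x in LHS]freeg_sumE -[x in RHS]freeg_sumE scaler_sumr !hsum.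
  rewrite scaler_sumr; apply: eq_bigr => -[u v] _; rewrite hU scalerA -hU.
  congr h; apply/eqP/freeg_eqP => z.
  by rewrite coeffZ !coeffU mulrA.
have hL : lin h by split=> a x y; rewrite hD hZ.
have hS x : tens_rel x -> mklin hL x = 0.
  have linB y z : h (y - z) = h y - h z by rewrite hD -[- z]scaleN1r hZ scaleN1r.
  have h1 u v : h << (u, v) >> = f u v by rewrite hU scale1r.
  case=> -[a [u [u' [v ->]]]]; rewrite /= linB hD hZ !h1; apply/eqP.
    by rewrite subr_eq0 (linE (fl v) a).
  by rewrite subr_eq0 (linE (fr u) a).
have [/Lin gL gE] := quot_lift hS.
exists (fun x => h (quot_repr x)) => // u v.
by rewrite -[RHS]scale1r -hU; exact: gE.
Qed.

Lemma lin_tsum (W W' : lmodType k) (g : W -> W') (t : U ⊗ V) (F : U -> V -> W) :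
  lin g -> g (tsum t F) = tsum t (fun u v => g (F u v)).
Proof. by move=> gL; rewrite ?tsum.unlock lin_sum. Qed.

Lemma tsum_id (t : U ⊗ V) : \tsum_(u ⊗ v <- t) (u ⊗ v) = t.
Proof. by rewrite tsum.unlock [RHS]tsum_repr. Qed.

Lemma tsumE (W : lmodType k) (f : U -> V -> W) (s : seq (U * V)) : bil f ->
  tsum (\sum_(p <- s) p.1 ⊗ p.2) f = \sum_(p <- s) f p.1 p.2.
Proof.
move=> /tens_lift[g gL gE]; rewrite ?tsum.unlock.
under eq_bigr do rewrite -gE.
rewrite -lin_sum // -tsum_repr lin_sum //.
by apply: eq_bigr => p _; rewrite gE.
Qed.

Lemma tsum_pair (W : lmodType k) (f : U -> V -> W) u v : bil f ->
  tsum (u ⊗ v) f = f u v.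
Proof. by move=> fB; have := tsumE [:: (u, v)] fB; rewrite !big_seq1. Qed.

Lemma tsum_linear (W : lmodType k) (f : U -> V -> W) : bil f ->
  lin (fun t => tsum t f).
Proof.
move=> /tens_lift[g gL gE].
have E t : tsum t f = g t.
  rewrite -[t in RHS]tsum_id (lin_tsum _ _ gL) ?tsum.unlock.
  by apply: eq_bigr => p _; rewrite gE.
by split=> a x y; rewrite !E (linE gL).
Qed.

Lemma tens_ext (W : lmodType k) (f g : U ⊗ V -> W) : lin f -> lin g ->
  (forall u v, f (u ⊗ v) = g (u ⊗ v)) -> forall t, f t = g t.
Proof.
move=> fL gL E t; rewrite -[t]tsum_id !lin_tsum // ?tsum.unlock.
by apply: eq_bigr => p _; rewrite E.
Qed.

Lemma eq_tsum (W : nmodType) (f g : U -> V -> W) (t : U ⊗ V) :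
  (forall u v, f u v = g u v) -> tsum t f = tsum t g.
Proof. by move=> E; rewrite tsum.unlock; apply: eq_bigr => p _; rewrite E. Qed.

End TsumTheory.

Section LinClosure.
Variables (k : fieldType) (X U V W : lmodType k).

Lemma lin_id : lin (fun x : X => x). Proof. by split. Qed.

Lemma lin_app (g : {linear U -> W}) (f : X -> U) :
  lin f -> lin (fun x => g (f x)).
Proof. by move=> fL; split=> a x y; rewrite (linE fL) linearP. Qed.

Lemma lin_scal (g : {scalar U}) (f : X -> U) :
  lin f -> @lin k X k^o (fun x => g (f x)).
Proof. by move=> fL; split=> a x y; rewrite (linE fL) linearP. Qed.

Lemma lin_tpairl (f : X -> U) (v : V) : lin f -> lin (fun x => f x ⊗ v).
Proof. by move=> fL; split=> a x y; rewrite (linE fL); exact: (linE ((tpair_bil U V).1 _)). Qed.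

Lemma lin_tpairr (f : X -> V) (u : U) : lin f -> lin (fun x => u ⊗ f x).
Proof. by move=> fL; split=> a x y; rewrite (linE fL); exact: (linE ((tpair_bil U V).2 _)). Qed.

Lemma lin_scalel (s : X -> k) (w : W) :
  @lin k X k^o s -> lin (fun x => s x *: w).
Proof.
by move=> sL; split=> a x y; rewrite (linE sL a x y) scalerDl scalerA.
Qed.

Lemma lin_scaler (c : k) (f : X -> W) : lin f -> lin (fun x => c *: f x).
Proof. by move=> fL; split=> a x y; rewrite (linE fL) scalerDr !scalerA mulrC. Qed.

Lemma lin_mull (s : X -> k) (c : k) :
  @lin k X k^o s -> @lin k X k^o (fun x => s x * c).
Proof. by move=> sL; split=> a x y; rewrite (linE sL a x y) mulrDl -mulrA. Qed.

Lemma lin_mulr (s : X -> k) (c : k) :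
  @lin k X k^o s -> @lin k X k^o (fun x => c * s x).
Proof. by move=> sL; split=> a x y; rewrite (linE sL a x y) mulrDr mulrCA. Qed.

Lemma lin_tsuml (f : X -> U ⊗ V) (F : U -> V -> W) :
  lin f -> bil F -> lin (fun x => tsum (f x) F).
Proof. by move=> fL FB; split=> a x y; rewrite (linE fL); exact: (linE (tsum_linear FB)). Qed.

Lemma lin_tsumr (t : U ⊗ V) (F : X -> U -> V -> W) :
  (forall u v, lin (fun x => F x u v)) -> lin (fun x => tsum t (F x)).
Proof.
move=> FL; split=> a x y; rewrite ?tsum.unlock scaler_sumr -big_split.
by apply: eq_bigr => p _; rewrite (linE (FL _ _)).
Qed.

End LinClosure.

Lemma lin_tsuml_scal (k : fieldType) (X U V : lmodType k) (f : X -> U ⊗ V)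
    (F : U -> V -> k) :
  lin f -> @bil k U V k^o F -> @lin k X k^o (fun x => tsum (f x) F).
Proof. exact: (@lin_tsuml k X U V k^o). Qed.

Lemma lin_tsumr_scal (k : fieldType) (X U V : lmodType k) (t : U ⊗ V)
    (F : X -> U -> V -> k) :
  (forall u v, @lin k X k^o (fun x => F x u v)) ->
  @lin k X k^o (fun x => tsum t (F x)).
Proof. exact: (@lin_tsumr k X U V k^o). Qed.

Ltac lin := cbn beta;
  lazymatch goal with
  | |- forall _, _ => intro; lin
  | |- bil _ => first [assumption | split; lin]
  | |- _ =>
  match goal with
  | H : ?T |- _ => let s := type of T in constr_eq s Prop; solve [simple apply H]
  | |- lin (fun x => x) => exact (@lin_id _ _)
  | |- lin (fun x => tpair (@?f x) ?v) => refine (@lin_tpairl _ _ _ _ f v _); lin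
  | |- lin (fun x => tpair ?u (@?f x)) => refine (@lin_tpairr _ _ _ _ f u _); lin
  | |- lin (fun x => tsum (@?f x) ?F) =>
      first [refine (@lin_tsuml _ _ _ _ _ f F _ _)
            |refine (@lin_tsuml_scal _ _ _ _ f F _ _)]; lin
  | |- lin (fun x => tsum ?t (@?F x)) =>
      first [refine (@lin_tsumr _ _ _ _ _ t F _)
            |refine (@lin_tsumr_scal _ _ _ _ t F _)]; lin
  | |- lin (fun x => (@?s x) *: ?w) => refine (@lin_scalel _ _ _ s w _); lin
  | |- lin (fun x => ?c *: (@?f x)) => refine (@lin_scaler _ _ _ c f _); lin
  | |- lin (fun x => (@?s x) * ?c) => refine (@lin_mull _ _ s c _); lin
  | |- lin (fun x => ?c * (@?s x)) => refine (@lin_mulr _ _ s c _); lin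
  | |- lin (fun x => ?g (@?f x)) =>
      first [refine (@lin_app _ _ _ _ _ f _)
            |refine (@lin_scal _ _ _ _ f _)]; lin
  | |- lin (fun _ => _) => fail 1
  | |- lin ?f => change (lin (fun x => f x)); lin
  end end.

Lemma tsum_bil_pair (k : fieldType) (U V U' V' W : lmodType k) (t : U ⊗ V)
    (F : U -> V -> U' ⊗ V') (f : U' -> V' -> W) : bil f ->
  tsum (tsum t F) f = tsum t (fun u v => tsum (F u v) f).
Proof. by move=> fB; exact: (lin_tsum t F (tsum_linear fB)). Qed.

Section Coalgebra.
Variable k : fieldType.

Record coalgebra := Coalgebra {
  coalg_sort :> lmodType k;
  comul : 'Lin(coalg_sort, coalg_sort ⊗ coalg_sort);
  counit : 'Dual(coalg_sort);
  comulA : forall h,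
    \tsum_(h1 ⊗ h2 <- comul h)
      \tsum_(h11 ⊗ h12 <- comul h1) (h11 ⊗ (h12 ⊗ h2)) =
    \tsum_(h1 ⊗ h2 <- comul h) (h1 ⊗ comul h2);
  counitl : forall h, \tsum_(h1 ⊗ h2 <- comul h) (counit h1 *: h2) = h;
  counitr : forall h, \tsum_(h1 ⊗ h2 <- comul h) (counit h2 *: h1) = h }.

End Coalgebra.

Arguments comul {k c}.
Arguments counit {k c}.

Section Sweedler.
Variables (k : fieldType) (C : coalgebra k) (W : nmodType).

Definition sw2 (h : C) (F : C -> C -> W) : W :=
  \tsum_(h1 ⊗ h2 <- comul h) F h1 h2.

Definition sw3 (h : C) (F : C -> C -> C -> W) : W :=
  sw2 h (fun h1 t => sw2 t (F h1)).

Definition sw4 (h : C) (F : C -> C -> C -> C -> W) : W :=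
  sw2 h (fun h1 t => sw3 t (F h1)).

Definition sw5 (h : C) (F : C -> C -> C -> C -> C -> W) : W :=
  sw2 h (fun h1 t => sw4 t (F h1)).

End Sweedler.

Notation "\sw_ ( h1 , h2 <- h ) F" := (sw2 h (fun h1 h2 => F))
  (at level 41, h1 name, h2 name, h at level 39, F at level 41,
   right associativity, format "\sw_ ( h1 ,  h2  <-  h )  F") : ring_scope.
Notation "\sw_ ( h1 , h2 , h3 <- h ) F" := (sw3 h (fun h1 h2 h3 => F))
  (at level 41, h1 name, h2 name, h3 name, h at level 39, F at level 41,
   right associativity,
   format "\sw_ ( h1 ,  h2 ,  h3  <-  h )  F") : ring_scope.
Notation "\sw_ ( h1 , h2 , h3 , h4 <- h ) F" :=
  (sw4 h (fun h1 h2 h3 h4 => F))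
  (at level 41, h1 name, h2 name, h3 name, h4 name, h at level 39,
   F at level 41, right associativity,
   format "\sw_ ( h1 ,  h2 ,  h3 ,  h4  <-  h )  F") : ring_scope.
Notation "\sw_ ( h1 , h2 , h3 , h4 , h5 <- h ) F" :=
  (sw5 h (fun h1 h2 h3 h4 h5 => F))
  (at level 41, h1 name, h2 name, h3 name, h4 name, h5 name, h at level 39,
   F at level 41, right associativity,
   format "\sw_ ( h1 ,  h2 ,  h3 ,  h4 ,  h5  <-  h )  F") : ring_scope.

Reserved Notation "h *H g" (at level 40, left associativity).

Section CoquasiBialgebra.
Variable k : fieldType.

(* omegaV is the (unique) convolution inverse of omega. *)
Record coquasi_bialgebra := CoquasiBialgebra {
  cqb_coalg :> coalgebra k;
  hmul : 'Lin(cqb_coalg ⊗ cqb_coalg, cqb_coalg)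
    where "h *H g" := (hmul (h ⊗ g));
  hone : cqb_coalg;
  omega : 'Dual(cqb_coalg ⊗ cqb_coalg ⊗ cqb_coalg);
  omegaV : 'Dual(cqb_coalg ⊗ cqb_coalg ⊗ cqb_coalg);
  comulM : forall h g, comul (h *H g) =
    \sw_(h1, h2 <- h) \sw_(g1, g2 <- g) ((h1 *H g1) ⊗ (h2 *H g2));
  counitM : forall h g, counit (h *H g) = counit h * counit g;
  comul1 : comul hone = hone ⊗ hone;
  counit1 : counit hone = 1;
  omegaK : forall h g x,
    \sw_(h1, h2 <- h) \sw_(g1, g2 <- g) \sw_(x1, x2 <- x)
      omega (h1 ⊗ g1 ⊗ x1) * omegaV (h2 ⊗ g2 ⊗ x2) =
    counit h * counit g * counit x;
  omegaVK : forall h g x,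
    \sw_(h1, h2 <- h) \sw_(g1, g2 <- g) \sw_(x1, x2 <- x)
      omegaV (h1 ⊗ g1 ⊗ x1) * omega (h2 ⊗ g2 ⊗ x2) =
    counit h * counit g * counit x;
  hmulA : forall h g x,
    \sw_(h1, h2 <- h) \sw_(g1, g2 <- g) \sw_(x1, x2 <- x)
      omega (h2 ⊗ g2 ⊗ x2) *: (h1 *H (g1 *H x1)) =
    \sw_(h1, h2 <- h) \sw_(g1, g2 <- g) \sw_(x1, x2 <- x)
      omega (h1 ⊗ g1 ⊗ x1) *: ((h2 *H g2) *H x2);
  hmul1l : forall h, hone *H h = h;
  hmul1r : forall h, h *H hone = h;
  omega_cocycle : forall h g x y,
    \sw_(h1, h2 <- h) \sw_(g1, g2 <- g) \sw_(x1, x2 <- x) \sw_(y1, y2 <- y)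
      omega (h1 ⊗ g1 ⊗ (x1 *H y1)) * omega ((h2 *H g2) ⊗ x2 ⊗ y2) =
    \sw_(h1, h2 <- h) \sw_(g1, g2, g3 <- g) \sw_(x1, x2, x3 <- x)
      \sw_(y1, y2 <- y)
        omega (g1 ⊗ x1 ⊗ y1) * omega (h1 ⊗ (g2 *H x2) ⊗ y2) *
        omega (h2 ⊗ g3 ⊗ x3);
  omega1 : forall h g, omega (h ⊗ hone ⊗ g) = counit h * counit g }.

End CoquasiBialgebra.

Arguments hone {k c}.
Arguments omega {k c}.
Arguments omegaV {k c}.
Notation "h *H g" := (hmul _ (h ⊗ g)) : ring_scope.

Section CoquasiHopf.
Variable k : fieldType.

Record coquasi_hopf := CoquasiHopf {
  cqh_cqb :> coquasi_bialgebra k;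
  antipode : 'Lin(cqh_cqb, cqh_cqb);
  qalpha : 'Dual(cqh_cqb);
  qbeta : 'Dual(cqh_cqb);
  comul_antipode : forall h, comul (antipode h) =
    \sw_(h1, h2 <- h) (antipode h2 ⊗ antipode h1);
  counit_antipode : forall h, counit (antipode h) = counit h;
  antipode_alpha : forall h,
    \sw_(h1, h2, h3 <- h) qalpha h2 *: (antipode h1 *H h3) =
    qalpha h *: hone;
  antipode_beta : forall h,
    \sw_(h1, h2, h3 <- h) qbeta h2 *: (h1 *H antipode h3) =
    qbeta h *: hone;
  omega_antipode : forall h,
    \sw_(h1, h2, h3, h4, h5 <- h)
      omega ((qbeta h2 *: h1) ⊗ antipode h3 ⊗ (qalpha h4 *: h5)) = counit h;
  omegaV_antipode : forall h,
    \sw_(h1, h2, h3, h4, h5 <- h)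
      omegaV (antipode h1 ⊗ (qalpha h2 *: (qbeta h4 *: h3)) ⊗ antipode h5) =
    counit h;
  qalpha1 : qalpha hone = 1;
  qbeta1 : qbeta hone = 1 }.

End CoquasiHopf.

Arguments antipode {k c}.
Arguments qalpha {k c}.
Arguments qbeta {k c}.

Section Comodule.
Variables (k : fieldType) (C : coalgebra k).

Record comodule := Comodule {
  com_sort :> lmodType k;
  coact : 'Lin(com_sort, com_sort ⊗ C);
  coactA : forall m,
    \tsum_(m0 ⊗ m1 <- coact m)
      \tsum_(m00 ⊗ m01 <- coact m0) (m00 ⊗ (m01 ⊗ m1)) =
    \tsum_(m0 ⊗ m1 <- coact m) (m0 ⊗ comul m1);
  coact_counit : forall m, \tsum_(m0 ⊗ m1 <- coact m) (counit m1 *: m0) = m }.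

Definition colinear (M M' : comodule) (f : M -> M') : Prop :=
  forall m, coact _ (f m) = \tsum_(m0 ⊗ m1 <- coact _ m) (f m0 ⊗ m1).

(* C as a comodule over itself. *)
Definition com_reg : comodule := Comodule (@comulA k C) (@counitr k C).

End Comodule.

Arguments coact {k C c}.

Notation "\rho_ ( m0 , m1 <- m ) F" := (\tsum_(m0 ⊗ m1 <- coact m) F)
  (at level 41, m0 name, m1 name, m at level 39, F at level 41,
   right associativity, format "\rho_ ( m0 ,  m1  <-  m )  F") : ring_scope.

Reserved Notation "a *A b" (at level 40, left associativity).
Reserved Notation "m *M a" (at level 40, left associativity).

Section ComoduleAlgebra.
Variables (k : fieldType) (H : coquasi_bialgebra k).

Record comodule_algebra := ComoduleAlgebra {
  ca_com :> comodule H;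
  camul : 'Lin(ca_com ⊗ ca_com, ca_com)
    where "a *A b" := (camul (a ⊗ b));
  caone : ca_com;
  coact_camul : forall a b, coact (a *A b) =
    \rho_(a0, a1 <- a) \rho_(b0, b1 <- b) ((a0 *A b0) ⊗ (a1 *H b1));
  coact_caone : coact caone = caone ⊗ hone;
  camul1l : forall a, caone *A a = a;
  camul1r : forall a, a *A caone = a;
  camulA : forall a b c, (a *A b) *A c =
    \rho_(a0, a1 <- a) \rho_(b0, b1 <- b) \rho_(c0, c1 <- c)
      omega (a1 ⊗ b1 ⊗ c1) *: (a0 *A (b0 *A c0)) }.

End ComoduleAlgebra.

Arguments caone {k H c0}.
Notation "a *A b" := (camul _ (a ⊗ b)) : ring_scope.

Section RelHopfModule.
Variables (k : fieldType) (H : coquasi_bialgebra k) (A : comodule_algebra H).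

Record hopf_module := HopfModule {
  hm_com :> comodule H;
  hact : 'Lin(hm_com ⊗ A, hm_com)
    where "m *M a" := (hact (m ⊗ a));
  coact_hact : forall m a, coact (m *M a) =
    \rho_(m0, m1 <- m) \rho_(a0, a1 <- a) ((m0 *M a0) ⊗ (m1 *H a1));
  hact1 : forall m, m *M caone = m;
  hactA : forall m a b, (m *M a) *M b =
    \rho_(m0, m1 <- m) \rho_(a0, a1 <- a) \rho_(b0, b1 <- b)
      omega (m1 ⊗ a1 ⊗ b1) *: (m0 *M (a0 *A b0)) }.

End RelHopfModule.

Notation "m *M a" := (hact _ (m ⊗ a)) : ring_scope.

Section RelHopfModuleHom.
Variables (k : fieldType) (H : coquasi_bialgebra k) (A : comodule_algebra H).

Record hopf_hom (M M' : hopf_module A) := HopfHom {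
  hhom_fun :> 'Lin(M, M');
  hhom_colinear : colinear hhom_fun;
  hhom_act : forall m a, hhom_fun (m *M a) = hhom_fun m *M a }.

End RelHopfModuleHom.

(* The zero algebra, which algType excludes, is allowed: A^{coH} = 0 if A = 0.
   A module over the k-algebra B is a k-vector space with a k-bilinear unital
   action; this is no restriction, since k maps to the center of B. *)
Section Modules.
Variable k : fieldType.

Record assoc_algebra := AssocAlgebra {
  alg_sort :> lmodType k;
  alg_mul : 'Lin(alg_sort ⊗ alg_sort, alg_sort);
  alg_one : alg_sort;
  alg_mulA : forall a b c,
    alg_mul (a ⊗ alg_mul (b ⊗ c)) = alg_mul (alg_mul (a ⊗ b) ⊗ c);
  alg_mul1l : forall a, alg_mul (alg_one ⊗ a) = a;
  alg_mul1r : forall a, alg_mul (a ⊗ alg_one) = a }.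

Variable B : assoc_algebra.

Record rmodule := RModule {
  rm_sort :> lmodType k;
  ract : 'Lin(rm_sort ⊗ B, rm_sort);
  ract1 : forall n, ract (n ⊗ alg_one B) = n;
  ractA : forall n b c,
    ract (n ⊗ alg_mul B (b ⊗ c)) = ract (ract (n ⊗ b) ⊗ c) }.

Record lmodule := LModule {
  lm_sort :> lmodType k;
  lact : 'Lin(B ⊗ lm_sort, lm_sort);
  lact1 : forall l, lact (alg_one B ⊗ l) = l;
  lactA : forall b c l,
    lact (alg_mul B (b ⊗ c) ⊗ l) = lact (b ⊗ lact (c ⊗ l)) }.

Record rmod_hom (N N' : rmodule) := RModHom {
  rhom_fun :> 'Lin(N, N');
  rhom_act : forall n b, rhom_fun (ract N (n ⊗ b)) = ract N' (rhom_fun n ⊗ b) }.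

Definition left_linear (L L' : lmodule) (f : L -> L') : Prop :=
  forall b l, f (lact L (b ⊗ l)) = lact L' (b ⊗ f l).

End Modules.


Section BalancedTensor.
Variables (k : fieldType) (B : assoc_algebra k) (N : rmodule B) (L : lmodule B).

Definition btens_rel : set (N ⊗ L)%type := fun t =>
  exists n b l, t = (ract N (n ⊗ b)) ⊗ l - n ⊗ lact L (b ⊗ l).

Definition btens : Type := quot_span btens_rel.
HB.instance Definition _ := GRing.Lmodule.on btens.

Definition btens_pi : 'Lin(N ⊗ L, btens) := quot_pi btens_rel.

Definition bpair (n : N) (l : L) : btens := btens_pi (n ⊗ l).

End BalancedTensor.

(* For f bilinear and balanced, the value does not depend on the chosen
   representative (bsum_pair). *)
HB.lock Definition bsum (k : fieldType) (B : assoc_algebra k) (N : rmodule B)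
    (L : lmodule B) (W : nmodType) (t : btens N L) (f : N -> L -> W) : W :=
  tsum (quot_repr t) f.
Canonical bsum_unlockable := Unlockable bsum.unlock.
Arguments bsum {k B N L W} t f.

Notation "\bsum_ ( n ⊗ l <- t ) F" := (bsum t (fun n l => F))
  (at level 41, n name, l name, t at level 39, F at level 41,
   right associativity, format "\bsum_ ( n  ⊗  l  <-  t )  F") : ring_scope.

Section BalancedTensorTheory.
Variables (k : fieldType) (B : assoc_algebra k) (N : rmodule B) (L : lmodule B).

Definition balanced (W : Type) (f : N -> L -> W) : Prop :=
  forall n b l, f (ract N (n ⊗ b)) l = f n (lact L (b ⊗ l)).

Lemma bpair_bil : bil (@bpair k B N L).
Proof. by rewrite /bpair; lin. Qed.

Lemma bpair_balanced : balanced (@bpair k B N L).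
Proof.
move=> n b l; rewrite /bpair; apply/quot_piE/mem_span.
by exists n, b, l.
Qed.

Lemma bsum_spec (W : lmodType k) (f : N -> L -> W) : bil f -> balanced f ->
  lin (fun t : btens N L => bsum t f) /\ (forall n l, bsum (bpair n l) f = f n l).
Proof.
move=> fB fb.
have fS x : btens_rel x -> mklin (tsum_linear fB) x = 0.
  case=> n [b [l ->]] /=.
  have fL := tsum_linear fB.
  rewrite (linD fL) -[- (n ⊗ _)]scaleN1r (linZ fL) scaleN1r.
  by rewrite !tsum_pair // fb subrr.
have [/Lin gL gE] := quot_lift fS; rewrite bsum.unlock.
split; first exact: gL.
by move=> n l; rewrite -(tsum_pair n l fB); exact: gE.
Qed.

Lemma bsum_linear (W : lmodType k) (f : N -> L -> W) : bil f -> balanced f ->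
  lin (fun t : btens N L => bsum t f).
Proof. by move=> fB fb; have [] := bsum_spec fB fb. Qed.

Lemma bsum_pair (W : lmodType k) (f : N -> L -> W) n l : bil f -> balanced f ->
  bsum (bpair n l) f = f n l.
Proof. by move=> fB fb; have [_ ->] := bsum_spec fB fb. Qed.

Lemma btens_ext (W : lmodType k) (f g : btens N L -> W) : lin f -> lin g ->
  (forall n l, f (bpair n l) = g (bpair n l)) -> forall t, f t = g t.
Proof.
move=> fL gL E t; rewrite -[t]quot_reprK.
apply: (tens_ext (f := fun x => f (btens_pi N L x))
                 (g := fun x => g (btens_pi N L x))) => [||u v].
- by split=> a x y; rewrite linearP (linE fL).
- by split=> a x y; rewrite linearP (linE gL).
exact: E.
Qed.

End BalancedTensorTheory.

Ltac slin := rewrite ?/sw5 ?/sw4 ?/sw3 ?/sw2 ?/bpair; lin.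

Section SweedlerTheory.
Variable k : fieldType.

Lemma tsum_exchange (U V U' V' : lmodType k) (W : nmodType)
    (t : U ⊗ V) (s : U' ⊗ V') (F : U -> V -> U' -> V' -> W) :
  \tsum_(u ⊗ v <- t) \tsum_(u' ⊗ v' <- s) F u v u' v' =
  \tsum_(u' ⊗ v' <- s) \tsum_(u ⊗ v <- t) F u v u' v'.
Proof. by rewrite tsum.unlock exchange_big. Qed.

Definition tril (U V W X : lmodType k) (F : U -> V -> W -> X) : Prop :=
  [/\ forall v w, lin (fun u => F u v w), forall u w, lin (fun v => F u v w)
    & forall u v, lin (F u v)].

Lemma rho_assoc (C : coalgebra k) (M : comodule C) (W : lmodType k)
    (F : M -> C -> C -> W) (m : M) : tril F ->
  \rho_(m0, m2 <- m) \rho_(m00, m1 <- m0) F m00 m1 m2 =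
  \rho_(m0, m1 <- m) \sw_(h1, h2 <- m1) F m0 h1 h2.
Proof.
case=> F1 F2 F3.
have G1 a : bil (F a) by split.
have GL : bil (fun a bc => tsum bc (F a)) by lin.
have /(congr1 (fun t => tsum t (fun a bc => tsum bc (F a)))) := coactA m.
rewrite !tsum_bil_pair //.
under eq_tsum => m0 m1.
  rewrite tsum_bil_pair //.
  under eq_tsum do rewrite tsum_pair // tsum_pair //.
  over.
move=> ->; apply: eq_tsum => m0 m1.
by rewrite tsum_pair // /sw2.
Qed.

Lemma sw_assoc (C : coalgebra k) (W : lmodType k) (F : C -> C -> C -> W) h :
  tril F ->
  \sw_(h1, h2 <- h) \sw_(h11, h12 <- h1) F h11 h12 h2 =
  \sw_(h1, h2, h3 <- h) F h1 h2 h3.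
Proof. exact: (@rho_assoc C (com_reg C)). Qed.

Lemma sw_counitl (C : coalgebra k) (W : lmodType k) (f : C -> W) h : lin f ->
  \sw_(h1, h2 <- h) counit h1 *: f h2 = f h.
Proof.
move=> fL; rewrite -[in RHS](counitl h) lin_tsum //.
by apply: eq_tsum => u v; rewrite linZ.
Qed.

Lemma rho_counit (C : coalgebra k) (M : comodule C) (W : lmodType k)
    (f : M -> W) m : lin f ->
  \rho_(m0, m1 <- m) counit m1 *: f m0 = f m.
Proof.
move=> fL; rewrite -[in RHS](coact_counit m) lin_tsum //.
by apply: eq_tsum => u v; rewrite linZ.
Qed.

Lemma sw_counitr (C : coalgebra k) (W : lmodType k) (f : C -> W) h : lin f ->
  \sw_(h1, h2 <- h) counit h2 *: f h1 = f h.
Proof. exact: (@rho_counit C (com_reg C)). Qed.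

End SweedlerTheory.

Section SweedlerScalars.
Variables (k : fieldType) (C : coalgebra k).

Lemma tsum_mulr (U V : lmodType k) (t : U ⊗ V) (c : k) (F : U -> V -> k) :
  c * tsum t F = \tsum_(u ⊗ v <- t) c * F u v.
Proof. by rewrite tsum.unlock mulr_sumr. Qed.

Lemma tsum_mull (U V : lmodType k) (t : U ⊗ V) (c : k) (F : U -> V -> k) :
  tsum t F * c = \tsum_(u ⊗ v <- t) F u v * c.
Proof. by rewrite tsum.unlock mulr_suml. Qed.

Lemma sw_counitl_scal (f : C -> k) h : @lin k C k^o f ->
  \sw_(h1, h2 <- h) counit h1 * f h2 = f h.
Proof. exact: (@sw_counitl k C k^o). Qed.

Lemma sw_counitr_scal (f : C -> k) h : @lin k C k^o f ->
  \sw_(h1, h2 <- h) counit h2 * f h1 = f h.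
Proof. exact: (@sw_counitr k C k^o). Qed.

Lemma eq_sw2 (W : nmodType) (F G : C -> C -> W) h :
  (forall h1 h2, F h1 h2 = G h1 h2) -> sw2 h F = sw2 h G.
Proof. exact: eq_tsum. Qed.

End SweedlerScalars.

Section OmegaUnit.
Variables (k : fieldType) (H : coquasi_bialgebra k).

Lemma sw2_1 (W : lmodType k) (F : H -> H -> W) : bil F ->
  sw2 hone F = F hone hone.
Proof. by move=> FB; rewrite /sw2 comul1 tsum_pair. Qed.

Local Notation e := (@hone k H).

Let ff x y :
  \sw_(x1, x2 <- x) \sw_(y1, y2 <- y)
    omega (e ⊗ x1 ⊗ y1) * omega (e ⊗ x2 ⊗ y2) =
  omega (e ⊗ x ⊗ y) :> k.
Proof.
have := omega_cocycle e e x y.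
rewrite (@sw2_1 k^o); last by slin.
rewrite (@sw2_1 k^o); last by slin.
rewrite (@sw2_1 k^o); last by slin.
rewrite {1}/sw3 (@sw2_1 k^o); last by slin.
rewrite (@sw2_1 k^o); last by slin.
rewrite !hmul1l => E.
transitivity (\sw_(x1, x2 <- x) counit x1 * omega (e ⊗ x2 ⊗ y)); last first.
  by rewrite (sw_counitl_scal (f := fun x2 => omega (e ⊗ x2 ⊗ y))) //; lin.
transitivity (\sw_(x1, x2 <- x) \sw_(y1, y2 <- y)
    omega (e ⊗ e ⊗ (x1 *H y1)) * omega (e ⊗ x2 ⊗ y2)); last first.
  apply: eq_sw2 => x1 x2.
  rewrite -(sw_counitl_scal (f := fun y2 => omega (e ⊗ x2 ⊗ y2))); last by lin.
  rewrite /sw2 tsum_mulr; apply: eq_tsum => y1 y2.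
  by rewrite omega1 counitM counit1 mul1r mulrA.
rewrite E /sw3; apply: eq_sw2 => x1 x2.
rewrite -(sw_counitr_scal (C := H)
  (f := fun x2 => \sw_(y1, y2 <- y) omega (e ⊗ x1 ⊗ y1) * omega (e ⊗ x2 ⊗ y2)));
  last by slin.
apply: eq_sw2 => x2' x3; rewrite /sw2 tsum_mulr; apply: eq_tsum => y1 y2.
by rewrite omega1 hmul1l counit1 mul1r mulrC.
Qed.

Lemma omega1l (x y : H) : omega (e ⊗ x ⊗ y) = counit x * counit y.
Proof.
pose f (x y : H) : k := omega (e ⊗ x ⊗ y).
pose g (x y : H) : k := omegaV (e ⊗ x ⊗ y).
have fg x' y' : \sw_(x1, x2 <- x') \sw_(y1, y2 <- y') f x1 y1 * g x2 y2 =
    counit x' * counit y'.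
  have := omegaK e x' y'.
  by rewrite (@sw2_1 k^o) ?counit1 ?mul1r //; slin.
have f_eps : \sw_(x1, x2 <- x) \sw_(y1, y2 <- y)
    f x1 y1 * (counit x2 * counit y2) = f x y.
  rewrite -[RHS](sw_counitr_scal (f := fun x => f x y)); last by rewrite /f; lin.
  apply: eq_sw2 => x1 x2.
  rewrite -(sw_counitr_scal (f := fun y => f x1 y)); last by rewrite /f; lin.
  rewrite /sw2 tsum_mulr; apply: eq_tsum => y1 y2.
  by rewrite mulrC -mulrA.
rewrite -/(f x y) -f_eps -fg.
transitivity (\sw_(x1, x2, x3 <- x) \sw_(y1, y2, y3 <- y)
    f x1 y1 * (f x2 y2 * g x3 y3)).
  rewrite /sw3; apply: eq_sw2 => x1 x2.
  rewrite {2}/sw2 tsum_exchange; apply: eq_tsum => y1 y2.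
  rewrite -fg {1}/sw2 tsum_mulr; apply: eq_tsum => x3 x4.
  by rewrite /sw2 tsum_mulr.
transitivity (\sw_(x1, x2 <- x) \sw_(x11, x12 <- x1) \sw_(y1, y2, y3 <- y)
    f x11 y1 * (f x12 y2 * g x2 y3)).
  by rewrite (@sw_assoc k H k^o); last by split; rewrite /f /g; slin.
apply: eq_sw2 => x1 x2.
transitivity (\sw_(x11, x12 <- x1) \sw_(y1, y2 <- y) \sw_(y11, y12 <- y1)
    f x11 y11 * (f x12 y12 * g x2 y2)).
  apply: eq_sw2 => x11 x12.
  by rewrite (@sw_assoc k H k^o); last by split; rewrite /f /g; slin.
rewrite /sw2 tsum_exchange; apply: eq_tsum => y1 y2.
rewrite /f -ff tsum_mull; apply: eq_tsum => x11 x12.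
rewrite tsum_mull; apply: eq_tsum => y11 y12.
by rewrite mulrA.
Qed.

End OmegaUnit.

Definition tlin (k : fieldType) (U V W : lmodType k) (f : U -> V -> W)
  (fB : bil f) : 'Lin(U ⊗ V, W) := mklin (tsum_linear fB).

Lemma tlinE (k : fieldType) (U V W : lmodType k) (f : U -> V -> W) (fB : bil f)
  u v : tlin fB (u ⊗ v) = f u v.
Proof. exact: tsum_pair. Qed.

Section Coinvariants.
Variables (k : fieldType) (H : coquasi_bialgebra k) (M : comodule H).

Definition coinv_pred : {pred M} := [pred m | coact m == m ⊗ hone].

Lemma coinv_predP m : reflect (coact m = m ⊗ hone) (m \in coinv_pred).
Proof. exact: eqP. Qed.

Fact coinv_submod_closed : submod_closed coinv_pred.
Proof.
have tL : lin (fun m : M => m ⊗ (hone : H)) by lin.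
split; first by apply/coinv_predP; rewrite linear0 (lin0 tL).
move=> a u v /coinv_predP Hu /coinv_predP Hv; apply/coinv_predP.
by rewrite linearP Hu Hv (linE tL).
Qed.

HB.instance Definition _ :=
  GRing.isSubmodClosed.Build k M coinv_pred coinv_submod_closed.

Record coinv := Coinv { coinv_val :> M; _ : coinv_val \in coinv_pred }.

HB.instance Definition _ := [isSub for coinv_val].
HB.instance Definition _ := [Choice of coinv by <:].
HB.instance Definition _ := [SubChoice_isSubLmodule of coinv by <:].

Lemma coinvP (m : coinv) : coact (m : M) = (m : M) ⊗ hone.
Proof. by case: m => m /= /coinv_predP. Qed.

Lemma coinv_inj (m m' : coinv) : (m : M) = m' -> m = m'.
Proof. exact: val_inj. Qed.

Lemma coinv_lin : lin coinv_val.
Proof. by split=> a x y; exact: (linearP (val : {linear coinv -> M})). Qed.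

Lemma lin_Coinv (X : lmodType k) (f : X -> M) (fP : forall x, f x \in coinv_pred) :
  lin f -> lin (fun x => Coinv (fP x)).
Proof.
move=> fL; split=> a x y; apply: coinv_inj.
by rewrite (linE coinv_lin) /= (linE fL).
Qed.

End Coinvariants.

Arguments coinv_pred {k H} M : simpl never.

Section HopfModuleTheory.
Variables (k : fieldType) (H : coquasi_bialgebra k) (A : comodule_algebra H).

Definition ca_hopf : hopf_module A :=
  HopfModule (@coact_camul k H A) (@camul1r k H A) (@camulA k H A).

Section Theory.
Variable M : hopf_module A.

Lemma coact_hactl (m : M) a : m \in coinv_pred M ->
  coact (m *M a) = \rho_(a0, a1 <- a) ((m *M a0) ⊗ a1).
Proof.
move=> /coinv_predP mP; rewrite coact_hact mP tsum_pair; last by lin.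
by apply: eq_tsum => a0 a1; rewrite hmul1l.
Qed.

Lemma coact_hactr (m : M) a : a \in coinv_pred A ->
  coact (m *M a) = \rho_(m0, m1 <- m) ((m0 *M a) ⊗ m1).
Proof.
move=> /coinv_predP aP; rewrite coact_hact; apply: eq_tsum => m0 m1.
by rewrite aP tsum_pair ?hmul1r //; lin.
Qed.

Lemma hact_coinv (m : M) a : m \in coinv_pred M -> a \in coinv_pred A ->
  m *M a \in coinv_pred M.
Proof.
move=> mP aP; apply/coinv_predP; rewrite coact_hactr //.
by move/coinv_predP: mP => ->; rewrite tsum_pair //; lin.
Qed.

Lemma hactAl (m : M) a b : m \in coinv_pred M -> (m *M a) *M b = m *M (a *A b).
Proof.
move=> /coinv_predP mP; rewrite hactA mP tsum_pair; last by lin.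
rewrite -[in RHS](coact_counit a) -[in RHS](coact_counit b).
rewrite (@lin_tsum _ _ _ _ _ (fun x => m *M (x *A _))); last by lin.
apply: eq_tsum => a0 a1.
rewrite (@lin_tsum _ _ _ _ _ (fun x => m *M (_ *A x))); last by lin.
apply: eq_tsum => b0 b1.
rewrite omega1l (@linZ _ _ _ (fun x => m *M (_ *A x))); last by lin.
by rewrite (@linZ _ _ _ (fun x => m *M (x *A _))) ?scalerA 1?mulrC //; lin.
Qed.

Lemma hactAm (m : M) a b : a \in coinv_pred A -> (m *M a) *M b = m *M (a *A b).
Proof.
move=> /coinv_predP aP; rewrite hactA.
rewrite -[in RHS](coact_counit m) -[in RHS](coact_counit b).
rewrite (@lin_tsum _ _ _ _ _ (fun x => x *M (a *A _))); last by lin.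
apply: eq_tsum => m0 m1; rewrite aP tsum_pair; last by lin.
rewrite (@lin_tsum _ _ _ _ _ (fun x => _ *M (a *A x))); last by lin.
apply: eq_tsum => b0 b1.
rewrite omega1 (@linZ _ _ _ (fun x => _ *M (a *A x))); last by lin.
by rewrite (@linZ _ _ _ (fun x => x *M (a *A _))) ?scalerA 1?mulrC //; lin.
Qed.

End Theory.

Lemma caone_coinv : (caone : A) \in coinv_pred A.
Proof. by apply/coinv_predP; exact: coact_caone. Qed.

Lemma camul_coinv (a b : A) : a \in coinv_pred A -> b \in coinv_pred A ->
  a *A b \in coinv_pred A.
Proof. exact: (@hact_coinv ca_hopf). Qed.

Definition coinv_mul (a b : coinv A) : coinv A :=
  Coinv (camul_coinv (valP a) (valP b)).

Fact coinv_mul_bil : bil coinv_mul.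
Proof.
have vL : lin (fun a : coinv A => \val a) by exact: coinv_lin.
by split=> [b|a]; apply: lin_Coinv; lin.
Qed.

Fact coinv_mulA a b c : tlin coinv_mul_bil (a ⊗ tlin coinv_mul_bil (b ⊗ c)) =
  tlin coinv_mul_bil (tlin coinv_mul_bil (a ⊗ b) ⊗ c).
Proof.
by rewrite !tlinE; apply: coinv_inj; rewrite /= (@hactAl ca_hopf) // (valP a).
Qed.

Fact coinv_mul1l a : tlin coinv_mul_bil (Coinv caone_coinv ⊗ a) = a.
Proof. by rewrite tlinE; apply: coinv_inj; exact: camul1l. Qed.

Fact coinv_mul1r a : tlin coinv_mul_bil (a ⊗ Coinv caone_coinv) = a.
Proof. by rewrite tlinE; apply: coinv_inj; exact: camul1r. Qed.

(* The algebra B = A^{coH}. *)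
Definition coinv_alg : assoc_algebra k :=
  AssocAlgebra coinv_mulA coinv_mul1l coinv_mul1r.

Section CoinvariantsModule.
Variable M : hopf_module A.

Definition coinv_act (m : coinv M) (b : coinv A) : coinv M :=
  Coinv (hact_coinv (valP m) (valP b)).

Fact coinv_act_bil : bil coinv_act.
Proof.
have vL : lin (fun a : coinv A => \val a) by exact: coinv_lin.
have wL : lin (fun m : coinv M => \val m) by exact: coinv_lin.
by split=> [b|a]; apply: lin_Coinv; lin.
Qed.

Fact coinv_act1 m : tlin coinv_act_bil (m ⊗ alg_one coinv_alg) = m.
Proof. by rewrite tlinE; apply: coinv_inj; exact: hact1. Qed.

Fact coinv_actA m b c :
  tlin coinv_act_bil (m ⊗ alg_mul coinv_alg (b ⊗ c)) =
  tlin coinv_act_bil (tlin coinv_act_bil (m ⊗ b) ⊗ c).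
Proof.
rewrite !tlinE; apply: coinv_inj => /=.
by rewrite hactAl ?(valP m) // -(tlinE coinv_mul_bil).
Qed.

Definition coinv_rmod : rmodule coinv_alg := 
  @RModule k coinv_alg (coinv M) (tlin coinv_act_bil) coinv_act1 coinv_actA.

End CoinvariantsModule.

Fact ca_lact_bil : bil (fun (b : coinv_alg) (a : A) => coinv_val b *A a).
Proof. by have vL := coinv_lin A; lin. Qed.

Fact ca_ract_bil : bil (fun (a : A) (b : coinv_alg) => a *A coinv_val b).
Proof. by have vL := coinv_lin A; lin. Qed.

Fact ca_lact1 a : tlin ca_lact_bil (alg_one coinv_alg ⊗ a) = a.
Proof. by rewrite tlinE; exact: camul1l. Qed.

Fact ca_lactA b c a : tlin ca_lact_bil (alg_mul coinv_alg (b ⊗ c) ⊗ a) =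
  tlin ca_lact_bil (b ⊗ tlin ca_lact_bil (c ⊗ a)).
Proof.
by rewrite !tlinE -(@hactAl ca_hopf) ?(valP b).
Qed.

Fact ca_ract1 a : tlin ca_ract_bil (a ⊗ alg_one coinv_alg) = a.
Proof. by rewrite tlinE; exact: camul1r. Qed.

Fact ca_ractA a b c : tlin ca_ract_bil (a ⊗ alg_mul coinv_alg (b ⊗ c)) =
  tlin ca_ract_bil (tlin ca_ract_bil (a ⊗ b) ⊗ c).
Proof.
by rewrite !tlinE (@hactAm ca_hopf) ?(valP b).
Qed.

Definition ca_left : lmodule coinv_alg := LModule ca_lact1 ca_lactA.
Definition ca_right : rmodule coinv_alg := RModule ca_ract1 ca_ractA.

End HopfModuleTheory.

Arguments coinv_alg {k H} A.
Arguments ca_left {k H} A.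
Arguments ca_right {k H} A.

Definition blin (k : fieldType) (B : assoc_algebra k) (N : rmodule B)
    (L : lmodule B) (W : lmodType k) (f : N -> L -> W) (fB : bil f)
    (fb : balanced f) : 'Lin(btens N L, W) := mklin (bsum_linear fB fb).

Lemma blinE (k : fieldType) (B : assoc_algebra k) (N : rmodule B)
    (L : lmodule B) (W : lmodType k) (f : N -> L -> W) (fB : bil f)
    (fb : balanced f) n l : blin fB fb (bpair n l) = f n l.
Proof. exact: bsum_pair. Qed.

Section Induction.
Variables (k : fieldType) (H : coquasi_bialgebra k) (A : comodule_algebra H).
Variable N : rmodule (coinv_alg A).

Local Notation T := (btens N (ca_left A)).
Local Notation "n ⊗b a" := (@bpair _ _ N (ca_left A) n a)
  (at level 40, left associativity).

Lemma bpairr_lin n : lin (fun a : A => n ⊗b a).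
Proof. exact: (bpair_bil N (ca_left A)).2. Qed.

Lemma bpairl_lin a : lin (fun n : N => n ⊗b a).
Proof. exact: (bpair_bil N (ca_left A)).1. Qed.

Lemma bpair_move n (b : coinv A) (a : A) :
  ract N (n ⊗ b) ⊗b a = n ⊗b ((b : A) *A a).
Proof. by rewrite bpair_balanced tlinE. Qed.

Definition ind_coact0 (n : N) (a : A) : T ⊗ H :=
  \rho_(a0, a1 <- a) ((n ⊗b a0) ⊗ a1).

Fact ind_coact_bil : @bil k N (ca_left A) _ ind_coact0.
Proof.
by split=> [a|n]; rewrite /ind_coact0; slin.
Qed.

Fact ind_coact_bal : @balanced k _ N (ca_left A) _ ind_coact0.
Proof.
move=> n b a; rewrite /ind_coact0 tlinE (@coact_hactl _ _ _ (ca_hopf A)) ?(valP b) //.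
rewrite tsum_bil_pair; last by slin.
apply: eq_tsum => a0 a1; rewrite tsum_pair; last by slin.
by rewrite bpair_move.
Qed.

Definition ind_coact : 'Lin(T, T ⊗ H) := blin ind_coact_bil ind_coact_bal.

Lemma ind_coactE n a : ind_coact (n ⊗b a) = ind_coact0 n a.
Proof. exact: blinE. Qed.

Fact ind_coactA t :
  \tsum_(t0 ⊗ t1 <- ind_coact t)
    \tsum_(t00 ⊗ t01 <- ind_coact t0) (t00 ⊗ (t01 ⊗ t1)) =
  \tsum_(t0 ⊗ t1 <- ind_coact t) (t0 ⊗ comul t1).
Proof.
move: t; apply: btens_ext; [lin|lin|] => n a.
rewrite ind_coactE /ind_coact0 !tsum_bil_pair; [|lin|lin].
under eq_tsum => a0 a1.
  rewrite tsum_pair; last by lin.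
  rewrite ind_coactE /ind_coact0 tsum_bil_pair; last by lin.
  under eq_tsum => a00 a01 do [rewrite tsum_pair; last by lin].
  over.
under [RHS]eq_tsum => a0 a1 do [rewrite tsum_pair; last by lin].
rewrite (@rho_assoc _ _ _ _ (fun x y z => (n ⊗b x) ⊗ (y ⊗ z))); last first.
  by split; slin.
apply: eq_tsum => a0 a1; rewrite -[in RHS](tsum_id (comul a1)).
by rewrite (@lin_tsum _ _ _ _ _ (fun z => (n ⊗b a0) ⊗ z)) //; lin.
Qed.

Fact ind_counit t : \tsum_(t0 ⊗ t1 <- ind_coact t) (counit t1 *: t0) = t.
Proof.
move: t; apply: btens_ext; [lin|lin|] => n a.
rewrite ind_coactE /ind_coact0 tsum_bil_pair; last by lin.
under eq_tsum => a0 a1 do [rewrite tsum_pair; last by lin].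
by rewrite (@rho_counit _ _ _ _ (fun x => n ⊗b x)) //; exact: bpairr_lin.
Qed.

Definition ind_comodule : comodule H :=
  @Comodule k H T ind_coact ind_coactA ind_counit.

Lemma coact_indE n a : coact ((n ⊗b a) : ind_comodule) = ind_coact0 n a.
Proof. exact: ind_coactE. Qed.

Definition ind_act0 (t : T) (b : A) : T := \bsum_(n ⊗ a <- t) (n ⊗b (a *A b)).

Fact ind_act_bal (b : A) :
  @bil k N (ca_left A) _ (fun n (a : A) => n ⊗b (a *A b)) /\
  @balanced k _ N (ca_left A) _ (fun n (a : A) => n ⊗b (a *A b)).
Proof.
split; first by slin.
by move=> n c a; rewrite bpair_move tlinE (@hactAl _ _ _ (ca_hopf A)) ?(valP c).
Qed.

Lemma ind_act0E n a b : ind_act0 (n ⊗b a) b = n ⊗b (a *A b).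
Proof. by have [bB bb] := ind_act_bal b; rewrite /ind_act0 bsum_pair. Qed.

Fact ind_act_bil : bil ind_act0.
Proof.
have L1 b : lin (ind_act0^~ b) by have [bB bb] := ind_act_bal b; exact: bsum_linear.
split=> // t; split=> c x y; move: t; apply: btens_ext; [exact: L1| |].
  by split=> d u v; rewrite !(linE (L1 _)) scalerDr scalerDr !scalerA addrACA mulrC.
move=> n a; rewrite !ind_act0E.
by rewrite (@linE _ _ _ (fun z => n ⊗b (a *A z))) //; slin.
Qed.

Definition ind_act : 'Lin(T ⊗ A, T) := tlin ind_act_bil.

Lemma ind_actE n a b : ind_act ((n ⊗b a) ⊗ b) = n ⊗b (a *A b).
Proof. by rewrite /ind_act tlinE ind_act0E. Qed.

Fact coact_ind_act (t : ind_comodule) (b : A) : coact (ind_act (t ⊗ b) : ind_comodule) =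
  \rho_(t0, t1 <- t) \rho_(b0, b1 <- b) (ind_act (t0 ⊗ b0) ⊗ (t1 *H b1)).
Proof.
move: t; apply: btens_ext; [lin|lin|] => n a.
rewrite ind_actE !coact_indE /ind_coact0 coact_camul.
rewrite tsum_bil_pair; last by slin.
rewrite tsum_bil_pair; last by slin.
apply: eq_tsum => a0 a1; rewrite tsum_pair; last by slin.
rewrite tsum_bil_pair; last by slin.
apply: eq_tsum => b0 b1; rewrite tsum_pair; last by slin.
by rewrite ind_actE.
Qed.

Fact ind_act1 t : ind_act (t ⊗ (caone : A)) = t.
Proof.
move: t; apply: btens_ext; [lin|lin|] => n a.
by rewrite ind_actE camul1r.
Qed.

Fact ind_actA (t : ind_comodule) (a b : A) : ind_act (ind_act (t ⊗ a) ⊗ b) =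
  \rho_(t0, t1 <- t) \rho_(a0, a1 <- a) \rho_(b0, b1 <- b)
    omega (t1 ⊗ a1 ⊗ b1) *: ind_act (t0 ⊗ (a0 *A b0)).
Proof.
move: t; apply: btens_ext; [lin|lin|] => n c.
rewrite !ind_actE coact_indE /ind_coact0 camulA.
rewrite tsum_bil_pair; last by slin.
rewrite (lin_tsum _ _ (bpairr_lin n)); apply: eq_tsum => c0 c1.
rewrite tsum_pair; last by slin.
rewrite (lin_tsum _ _ (bpairr_lin n)); apply: eq_tsum => a0 a1.
rewrite (lin_tsum _ _ (bpairr_lin n)); apply: eq_tsum => b0 b1.
by rewrite (linZ (bpairr_lin n)) ind_actE.
Qed.

(* N ⊗_B A with (n ⊗ a) b = n ⊗ ab and n ⊗ a |-> (n ⊗ a_0) ⊗ a_1. *)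
Definition induced : hopf_module A :=
  @HopfModule k H A ind_comodule ind_act coact_ind_act ind_act1 ind_actA.

End Induction.

Record category := Category {
  cobj :> Type;
  chom : cobj -> cobj -> Type;
  cidm : forall X, chom X X;
  ccomp : forall X Y Z, chom Y Z -> chom X Y -> chom X Z;
  ccompA : forall X Y Z T (h : chom Z T) (g : chom Y Z) (f : chom X Y),
    ccomp h (ccomp g f) = ccomp (ccomp h g) f;
  ccomp1l : forall X Y (f : chom X Y), ccomp (cidm Y) f = f;
  ccomp1r : forall X Y (f : chom X Y), ccomp f (cidm X) = f }.

Arguments chom {c}.
Arguments cidm {c}.
Arguments ccomp {c X Y Z}.

Record functor (C D : category) := Functor {
  fobj :> C -> D;
  fmap : forall X Y, chom X Y -> chom (fobj X) (fobj Y);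
  fmap1 : forall X, fmap (cidm X) = cidm (fobj X);
  fmap_comp : forall X Y Z (g : chom Y Z) (f : chom X Y),
    fmap (ccomp g f) = ccomp (fmap g) (fmap f) }.

Arguments fmap {C D} f0 {X Y}.

Section Functors.

Definition functor_id (C : category) : functor C C :=
  @Functor C C id (fun X Y f => f) (fun=> erefl) (fun _ _ _ _ _ => erefl).

Variables (C D E : category) (G : functor D E) (F : functor C D).

Fact functor_comp1 X : fmap G (fmap F (cidm X)) = cidm (G (F X)).
Proof. by rewrite !fmap1. Qed.

Fact functor_compM X Y Z (g : chom Y Z) (f : chom X Y) :
  fmap G (fmap F (ccomp g f)) = ccomp (fmap G (fmap F g)) (fmap G (fmap F f)).
Proof. by rewrite !fmap_comp. Qed.

Definition functor_comp : functor C E :=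
  @Functor C E (fun X => G (F X)) (fun X Y f => fmap G (fmap F f))
    functor_comp1 functor_compM.

End Functors.

Definition is_iso (C : category) (X Y : C) (f : chom X Y) : Prop :=
  exists g : chom Y X, ccomp g f = cidm X /\ ccomp f g = cidm Y.

Definition naturally_isomorphic (C D : category) (F G : functor C D) : Prop :=
  exists phi : forall X : C, chom (F X) (G X),
    (forall (X Y : C) (f : chom X Y),
       ccomp (phi Y) (fmap F f) = ccomp (fmap G f) (phi X)) /\
    (forall X : C, is_iso (phi X)).

Definition inverse_equivalences (C D : category) (F : functor C D)
    (G : functor D C) : Prop :=
  naturally_isomorphic (functor_comp G F) (functor_id C) /\
  naturally_isomorphic (functor_comp F G) (functor_id D).

Lemma linear_ext (k : fieldType) (U V : lmodType k) (f g : {linear U -> V}) :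
  f =1 g -> f = g.
Proof.
case: f => f [[fa] [fz]]; case: g => g [[ga] [gz]] /= /funext E.
subst g; have ? : fa = ga by exact: Prop_irrelevance.
have ? : fz = gz by exact: Prop_irrelevance.
by subst.
Qed.

Section ModuleCategory.
Variables (k : fieldType) (B : assoc_algebra k).

Lemma rmod_hom_ext (N N' : rmodule B) (f g : rmod_hom N N') : f =1 g -> f = g.
Proof.
case: f g => f fa [g ga] /= /linear_ext E.
by move: fa ga; rewrite E => fa ga; congr RModHom; exact: Prop_irrelevance.
Qed.

Fact rmod_idP (N : rmodule B) n b :
  mklin (@lin_id k N) (ract N (n ⊗ b)) = ract N (mklin (@lin_id k N) n ⊗ b).
Proof. by []. Qed.

Definition rmod_id (N : rmodule B) : rmod_hom N N := RModHom (@rmod_idP N).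

Definition lin_comp (U V W : lmodType k) (g : 'Lin(V, W)) (f : 'Lin(U, V)) :
  'Lin(U, W) := g \o f.

Fact rmod_compP (N1 N2 N3 : rmodule B) (g : rmod_hom N2 N3)
    (f : rmod_hom N1 N2) n b :
  lin_comp g f (ract N1 (n ⊗ b)) = ract N3 (lin_comp g f n ⊗ b).
Proof. by rewrite /= !rhom_act. Qed.

Definition rmod_comp (N1 N2 N3 : rmodule B) (g : rmod_hom N2 N3)
  (f : rmod_hom N1 N2) : rmod_hom N1 N3 := RModHom (rmod_compP g f).

(* The category of right B-modules. *)
Definition cat_rmod : category.
Proof.
refine (@Category (rmodule B) (@rmod_hom k B) rmod_id rmod_comp _ _ _).
- by move=> *; exact: rmod_hom_ext.
- by move=> *; exact: rmod_hom_ext.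
- by move=> *; exact: rmod_hom_ext.
Defined.

End ModuleCategory.

Section HopfCategory.
Variables (k : fieldType) (H : coquasi_bialgebra k) (A : comodule_algebra H).

Lemma hopf_hom_ext (M M' : hopf_module A) (f g : hopf_hom M M') :
  f =1 g -> f = g.
Proof.
case: f g => f fc fa [g gc ga] /= /linear_ext E.
by move: fc fa gc ga; rewrite E => *; congr HopfHom; exact: Prop_irrelevance.
Qed.

Fact hopf_id_colinear (M : hopf_module A) : colinear (mklin (@lin_id k M)).
Proof. by move=> m; rewrite tsum_id. Qed.

Definition hopf_id (M : hopf_module A) : hopf_hom M M :=
  HopfHom (@hopf_id_colinear M) (fun _ _ => erefl).

Section Comp.
Variables (M1 M2 M3 : hopf_module A) (g : hopf_hom M2 M3) (f : hopf_hom M1 M2).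

Fact hopf_comp_colinear : colinear (lin_comp g f).
Proof.
move=> m; rewrite /= hhom_colinear hhom_colinear tsum_bil_pair; last by slin.
by apply: eq_tsum => m0 m1; rewrite tsum_pair //; slin.
Qed.

Fact hopf_comp_act m a : lin_comp g f (m *M a) = lin_comp g f m *M a.
Proof. by rewrite /= !hhom_act. Qed.

Definition hopf_comp : hopf_hom M1 M3 := HopfHom hopf_comp_colinear hopf_comp_act.

End Comp.

(* The category of right relative Hopf modules. *)
Definition cat_hopf : category.
Proof.
refine (@Category (hopf_module A) (@hopf_hom k H A) hopf_id hopf_comp _ _ _).
- by move=> *; exact: hopf_hom_ext.
- by move=> *; exact: hopf_hom_ext.
- by move=> *; exact: hopf_hom_ext.
Defined.

Section InductionFunctor.
Variables (N N' : rmodule (coinv_alg A)) (f : rmod_hom N N').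

Local Notation bp' := (@bpair _ _ N' (ca_left A)).

Fact ind_map_bil : @bil k N (ca_left A) _ (fun n a => bp' (f n) a).
Proof. by slin. Qed.

Fact ind_map_bal : @balanced k _ N (ca_left A) _ (fun n a => bp' (f n) a).
Proof. by move=> n b a; rewrite rhom_act bpair_balanced. Qed.

Definition ind_map_lin : 'Lin(induced N, induced N') :=
  blin ind_map_bil ind_map_bal.

Lemma ind_map_linE n a : ind_map_lin (bpair n a) = bp' (f n) a.
Proof. exact: blinE. Qed.

Fact ind_map_colinear : colinear ind_map_lin.
Proof.
move=> t; move: t; apply: btens_ext; [lin|lin|] => n a.
rewrite ind_map_linE !coact_indE /ind_coact0 tsum_bil_pair; last by lin.
apply: eq_tsum => a0 a1; rewrite tsum_pair; last by lin.
by rewrite ind_map_linE.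
Qed.

Fact ind_map_act (t : induced N) a :
  ind_map_lin (t *M a) = ind_map_lin t *M a.
Proof.
move: t; apply: btens_ext; [lin|lin|] => n c.
by rewrite ind_map_linE !ind_actE ind_map_linE.
Qed.

Definition ind_map : hopf_hom (induced N) (induced N') :=
  HopfHom ind_map_colinear ind_map_act.

End InductionFunctor.

Lemma ind_mapE N N' (f : rmod_hom N N') n a :
  ind_map f (bpair n a) = @bpair _ _ N' (ca_left A) (f n) a.
Proof. exact: blinE. Qed.

Fact ind_map1 N : ind_map (rmod_id N) = hopf_id (induced N).
Proof.
apply: hopf_hom_ext => t; move: t; apply: btens_ext; [lin|lin|] => n a.
exact: ind_map_linE.
Qed.

Fact ind_mapM N1 N2 N3 (g : rmod_hom N2 N3) (f : rmod_hom N1 N2) :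
  ind_map (rmod_comp g f) = hopf_comp (ind_map g) (ind_map f).
Proof.
apply: hopf_hom_ext => t; move: t; apply: btens_ext; [lin|lin|] => n a.
apply: etrans (ind_mapE _ n a) (esym _).
exact: etrans (congr1 (ind_map g) (ind_mapE f n a)) (ind_mapE g _ a).
Qed.

Definition induction_functor : functor (cat_rmod (coinv_alg A)) cat_hopf :=
  @Functor (cat_rmod (coinv_alg A)) cat_hopf (@induced k H A) ind_map
    ind_map1 ind_mapM.

Section CoinvariantsFunctor.
Variables (M M' : hopf_module A) (f : hopf_hom M M').

Fact coinv_map_coinv (m : coinv M) : f (m : M) \in coinv_pred M'.
Proof.
apply/coinv_predP; rewrite hhom_colinear coinvP tsum_pair //; slin.
Qed.

Fact coinv_map_lin_subproof : lin (fun m : coinv M => Coinv (coinv_map_coinv m)).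
Proof. by apply: lin_Coinv; have vL := coinv_lin M; lin. Qed.

Definition coinv_map_lin : 'Lin(coinv M, coinv M') := mklin coinv_map_lin_subproof.

Fact coinv_map_act (m : coinv_rmod M) b :
  coinv_map_lin (ract (coinv_rmod M) (m ⊗ b)) =
  ract (coinv_rmod M') (coinv_map_lin m ⊗ b).
Proof. by apply: coinv_inj; rewrite !tlinE /= hhom_act. Qed.

Definition coinv_map : rmod_hom (coinv_rmod M) (coinv_rmod M') :=
  @RModHom k (coinv_alg A) (coinv_rmod M) (coinv_rmod M') coinv_map_lin
    coinv_map_act.

End CoinvariantsFunctor.

Fact coinv_map1 M : coinv_map (hopf_id M) = rmod_id (coinv_rmod M).
Proof. by apply: rmod_hom_ext => m; apply: coinv_inj. Qed.

Fact coinv_mapM M1 M2 M3 (g : hopf_hom M2 M3) (f : hopf_hom M1 M2) :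
  coinv_map (hopf_comp g f) = rmod_comp (coinv_map g) (coinv_map f).
Proof. by apply: rmod_hom_ext => m; apply: coinv_inj. Qed.

Definition coinvariants_functor : functor cat_hopf (cat_rmod (coinv_alg A)) :=
  @Functor cat_hopf (cat_rmod (coinv_alg A)) (@coinv_rmod k H A) coinv_map
    coinv_map1 coinv_mapM.

End HopfCategory.

Section FreeObjects.
Variable k : fieldType.

Section Cofree.
Variables (C : coalgebra k) (V : lmodType k).

Fact com_free_bil : bil (fun (v : V) (h : C) => \sw_(h1, h2 <- h) ((v ⊗ h1) ⊗ h2)).
Proof. by slin. Qed.

Fact com_freeA t :
  \tsum_(t0 ⊗ t1 <- tlin com_free_bil t)
    \tsum_(t00 ⊗ t01 <- tlin com_free_bil t0) (t00 ⊗ (t01 ⊗ t1)) =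
  \tsum_(t0 ⊗ t1 <- tlin com_free_bil t) (t0 ⊗ comul t1).
Proof.
move: t; apply: tens_ext; [lin|lin|] => v h.
rewrite tlinE /sw2 !tsum_bil_pair; [|lin|lin].
under eq_tsum => h1 h2.
  rewrite tsum_pair; last by lin.
  rewrite tlinE /sw2 tsum_bil_pair; last by lin.
  under eq_tsum => h11 h12 do [rewrite tsum_pair; last by lin].
  over.
under [RHS]eq_tsum => h1 h2 do [rewrite tsum_pair; last by lin].
rewrite -/(sw2 h _) (@sw_assoc _ _ _ (fun x y z => (v ⊗ x) ⊗ (y ⊗ z))); last first.
  by split; slin.
apply: eq_tsum => h1 h2; rewrite -[in RHS](tsum_id (comul h2)).
by rewrite (@lin_tsum _ _ _ _ _ (fun z => (v ⊗ h1) ⊗ z)) //; lin.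
Qed.

Fact com_free_counit t :
  \tsum_(t0 ⊗ t1 <- tlin com_free_bil t) (counit t1 *: t0) = t.
Proof.
move: t; apply: tens_ext; [lin|lin|] => v h.
rewrite tlinE /sw2 tsum_bil_pair; last by lin.
under eq_tsum => h1 h2 do [rewrite tsum_pair; last by lin].
by rewrite -/(sw2 h _) (@sw_counitr _ _ _ (fun x => v ⊗ x)) //; lin.
Qed.

(* V ⊗ C with v ⊗ h |-> (v ⊗ h_1) ⊗ h_2. *)
Definition com_free : comodule C := Comodule com_freeA com_free_counit.

End Cofree.

Section Free.
Variables (B : assoc_algebra k) (V : lmodType k).

Definition lmod_free_act0 (b : B) (t : B ⊗ V) : B ⊗ V :=
  \tsum_(c ⊗ v <- t) (alg_mul B (b ⊗ c) ⊗ v).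

Fact lmod_free_bil : bil lmod_free_act0.
Proof. by rewrite /lmod_free_act0; lin. Qed.

Fact lmod_free1 t : tlin lmod_free_bil (alg_one B ⊗ t) = t.
Proof.
rewrite tlinE /lmod_free_act0 -[RHS]tsum_id; apply: eq_tsum => c v.
by rewrite alg_mul1l.
Qed.

Fact lmod_freeA b c t : tlin lmod_free_bil (alg_mul B (b ⊗ c) ⊗ t) =
  tlin lmod_free_bil (b ⊗ tlin lmod_free_bil (c ⊗ t)).
Proof.
rewrite !tlinE /lmod_free_act0 tsum_bil_pair; last by lin.
by apply: eq_tsum => d v; rewrite tsum_pair ?alg_mulA //; lin.
Qed.

(* B ⊗ V with b (c ⊗ v) = bc ⊗ v. *)
Definition lmod_free : lmodule B := LModule lmod_free1 lmod_freeA.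

End Free.

End FreeObjects.

Section Main.
Variables (k : fieldType) (H : coquasi_hopf k) (A : comodule_algebra H).

Local Notation B := (coinv_alg A).

Definition cleft : Prop :=
  exists (gamma : 'Lin(H, A)) (delta : 'Lin(H, A)),
    colinear (M := com_reg H) (M' := A) gamma /\
    forall h : H,
    [/\ coact (delta h) = \sw_(h1, h2 <- h) (delta h2 ⊗ antipode h1),
        \sw_(h1, h2 <- h) (delta h1 *A gamma h2) = qalpha h *: caone
      & \sw_(h1, h2, h3 <- h) qbeta h2 *: (gamma h1 *A delta h3) =
        counit h *: caone].

Definition normal_basis : Prop :=
  exists f : 'Lin(A, B ⊗ H),
    [/\ bijective f,
        left_linear (L := ca_left A) (L' := lmod_free B H) f
      & colinear (M := A) (M' := com_free H B) f].

(* can(a ⊗_B b) *)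
Definition can0 (a b : A) : A ⊗ H :=
  \rho_(a0, a1 <- a) \rho_(b0, b' <- b) \sw_(b1, b2, b3, b4 <- b')
    omegaV (a1 ⊗ (qbeta b2 *: b1) ⊗ antipode b3) *: ((a0 *A b0) ⊗ b4).

Fact can0_bil : @bil k (ca_right A) (ca_left A) _ can0.
Proof. by rewrite /can0; slin. Qed.

Fact can0_bal : @balanced k _ (ca_right A) (ca_left A) _ can0.
Proof.
move=> a x b; rewrite !tlinE /can0.
rewrite (@coact_hactr _ _ _ (ca_hopf A)) ?(valP x) //.
rewrite tsum_bil_pair; last by slin.
apply: eq_tsum => a0 a1; rewrite tsum_pair; last by slin.
rewrite (@coact_hactl _ _ _ (ca_hopf A)) ?(valP x) //.
rewrite tsum_bil_pair; last by slin.
apply: eq_tsum => b0 b1; rewrite tsum_pair; last by slin.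
by rewrite (@hactAm _ _ _ (ca_hopf A)) ?(valP x).
Qed.

Definition can : 'Lin(btens (ca_right A) (ca_left A), A ⊗ H) :=
  blin can0_bil can0_bal.

Definition galois : Prop := bijective can.

Section Counit.
Variable M : hopf_module A.

Fact counit_bil : @bil k (coinv_rmod M) (ca_left A) _
  (fun (m : coinv M) (a : A) => (m : M) *M a).
Proof. by have vL := coinv_lin M; lin. Qed.

Fact counit_bal : @balanced k _ (coinv_rmod M) (ca_left A) _
  (fun (m : coinv M) (a : A) => (m : M) *M a).
Proof. by move=> m b a; rewrite !tlinE /= hactAl ?(valP m). Qed.

(* m ⊗ a |-> ma *)
Definition adj_counit : 'Lin(btens (coinv_rmod M) (ca_left A), M) :=
  blin counit_bil counit_bal.

End Counit.

Definition weak_structure_theorem : Prop :=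
  forall M : hopf_module A, bijective (adj_counit M).

Definition strong_structure_theorem : Prop :=
  inverse_equivalences (induction_functor A) (coinvariants_functor A).

End Main.

(* Main.v *)
(* Let pi m = m_0 β(m_1) δ(m_2). If δ has the coaction required by cleftness
   and δ(h_1) γ(h_2) = α(h) 1, then pi takes values in the coinvariants
   and, by the axiom relating ω, α and β, pi(m_0) γ(m_1) = m for every
   relative Hopf module; this inverts counit and unit of the adjunction, and
   a ⊗ h |-> a δ(h_1) ⊗ γ(h_2) inverts the Galois map. Given a normal basis,
   let γ(h) and p correspond to 1 ⊗ h and to id ⊗ ε. For such a δ, B-linearity
   of p and p(γ(h)) = ε(h) 1 force p = pi on A, which is the third axiom of
   cleftness. So it remains to find δ, as l p(r) for a suitable l ⊗ r.
   In the Galois case, l ⊗ r = can^-1(1 ⊗ h). Under the weak structure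
   theorem, decompose h ⊗ 1 in the free Hopf module H ⊗ A as sum_i t_i r_i with
   coinvariant t_i and use l = ev(t_i), where
   ev(h ⊗ c) = α(h_2) ω^-1(S(h_1), h_3, c_1) c_0. *)

(* Nothing here may be rebracketed for free: [A], [H] and the actions are associative only up to
   [omega]. Two facts keep this under control. [omega] and [omegaV] are trivial once an argument is
   the unit, so products whose first or middle factor is coinvariant associate strictly. The other
   reassociators are shifted by the pentagon until the laws of α and β collapse two of their
   arguments. The formula of [ev] is the evaluation of S(h_1) on h_3 by α(h_2), tensored with [A],
   after rebracketing S(h_1) ⊗ (h_3 ⊗ c); hence the [omegaV]. The delicate point is the coaction of
   δ. In the Galois case [can] transports the coaction of the left factor of A ⊗_B A to A ⊗ H. Under
   the weak structure theorem, the coaction of ev(t_i) involves the coproduct of the H-entry of t_i,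
   not that of h. To compare the two, the colinear map h |-> S(h_1) ⊗ h_2 from H to H ⊗ H, with
   coaction on the second factor only, is extended to free Hopf modules; the counit at the second
   module is injective, so the image of the decomposition of h ⊗ 1 is that of h_2 ⊗ 1 labelled by
   S(h_1). *)
Require Import Defs.
From HB Require Import structures.
From mathcomp Require Import all_boot all_algebra.
From mathcomp Require Import boolp ring.

Set Implicit Arguments.
Unset Strict Implicit.
Unset Printing Implicit Defensive.

Import GRing.Theory.
Local Open Scope ring_scope.

(** * Iterated coproducts *)

Section SizedLists.
Variable X : Type.

(** Recursive rather than [size l = n -> P l]: for a numeral [n] it computes to [n] quantifiers over
    elements, the form in which side conditions reach [lin]. *)
Fixpoint lall n (P : seq X -> Prop) : Prop :=
  if n is n'.+1 then forall x, lall n' (fun l => P (x :: l)) else P [::].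

Lemma lallP n P : lall n P <-> forall l, size l = n -> P l.
Proof.
elim: n P => [|n IH] P /=; first by split=> [H [|//] _ //|H]; exact: H.
split=> [H [//|x l] [sl]|H x]; first by move/IH: (H x); exact.
by apply/IH => l sl; apply: H; rewrite /= sl.
Qed.

End SizedLists.

Section IteratedCoproduct.
Variables (k : fieldType) (H : coalgebra k) (W : lmodType k).
Implicit Types (h : H) (l : seq H) (G : seq H -> W).

Fixpoint lmul n G : Prop :=
  if n is n'.+1 then lall n' (fun l => lin (fun x => G (x :: l))) /\
                     (forall x, lmul n' (fun l => G (x :: l)))
  else True.

Lemma lmul_cat n m G : lmul (n + m) G -> lall n (fun l => lmul m (fun l' => G (l ++ l'))).
Proof.
elim: n G => [|n IH] G //= [_ GR] x.
exact: (IH (fun l => G (x :: l))).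
Qed.

(* The sum of G [:: h_1; ...; h_n] over the iterated coproduct of h. *)
Fixpoint comb n h G : W :=
  if n is n'.+1 then \sw_(a, t <- h) comb n' t (fun l => G (a :: l))
  else counit h *: G [::].

Lemma eq_comb n h G G' : lall n (fun l => G l = G' l) -> comb n h G = comb n h G'.
Proof.
elim: n h G G' => [|n IH] h G G' /= E; first by rewrite E.
by apply: eq_tsum => a t; apply: IH.
Qed.

Lemma comb_linp (X : lmodType k) n (G : X -> seq H -> W) h :
  lall n (fun l => lin (fun x => G x l)) -> lin (fun x => comb n h (G x)).
Proof.
elim: n h G => [|n IH] h G /= GL; first by lin.
have GL' a t : lin (fun x => comb n t (fun l => G x (a :: l))).
  exact: (IH t (fun x l => G x (a :: l)) (GL a)).
by slin.
Qed.

Lemma comb_lin n G : lmul n G -> lin (fun h => comb n h G).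
Proof.
elim: n G => [|n IH] G /= => [_|[GL GR]]; first by lin.
have GR' x : lin (fun t => comb n t (fun l => G (x :: l))) by exact: IH (GR x).
have GL' t : lin (fun a => comb n t (fun l => G (a :: l))).
  exact: (@comb_linp _ n (fun x l => G (x :: l))).
by slin.
Qed.

Lemma comb_tsum (U V : lmodType k) (t : U ⊗ V) n h (G : U -> V -> seq H -> W) :
  tsum t (fun u v => comb n h (G u v)) = comb n h (fun l => tsum t (fun u v => G u v l)).
Proof.
elim: n h G => [|n IH] h G /=; first by rewrite tsum.unlock scaler_sumr.
by rewrite /sw2 tsum_exchange; apply: eq_tsum => a s; rewrite IH.
Qed.

Lemma comb_scale c n h G : c *: comb n h G = comb n h (fun l => c *: G l).
Proof.
elim: n h G => [|n IH] h G /=; first by rewrite !scalerA mulrC.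
by rewrite (@lin_tsum _ _ _ _ _ (fun x => c *: x)); [apply: eq_tsum|lin].
Qed.

Lemma comb1 h G : lmul 1 G -> comb 1 h G = G [:: h].
Proof. by case=> /= GL _; rewrite (@sw_counitr _ _ _ (fun x => G [:: x])). Qed.

Lemma lmul_comb n m h G : lmul (n + m) G ->
  lmul n (fun l => comb m h (fun l' => G (l ++ l'))).
Proof.
elim: n G => [|n IH] G //= [GL GR]; split=> [|x].
  apply/lallP => l sl; apply: comb_linp; apply/lallP => l' sl'.
  by move/lallP: GL; apply; rewrite size_cat sl sl'.
exact: (IH (fun l => G (x :: l)) (GR x)).
Qed.

(** Coassociativity, one component at a time; the case [n1 = 0] is the counit law. A count of zero
    thus accounts for an application of [counit]. *)
Lemma comb_add n1 n2 h G : lmul (n1 + n2) G ->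
  \sw_(a, b <- h) comb n1 a (fun l1 => comb n2 b (fun l2 => G (l1 ++ l2))) =
  comb (n1 + n2) h G.
Proof.
elim: n1 h G => [|n IH] h G GM /=.
  by rewrite (@sw_counitl _ _ _ (fun b => comb n2 b _)) //; exact: comb_lin.
have [GL GR] := GM.
have L1 x b := lmul_comb b (GR x).
rewrite sw_assoc; first by apply: eq_tsum => a t; exact: (IH t (fun l => G (a :: l)) (GR a)).
split=> [v w|u w|u v].
- apply: comb_linp; apply/lallP => l sl; apply: comb_linp; apply/lallP => l' sl'.
  by move/lallP: GL; apply; rewrite size_cat sl sl'.
- by apply: comb_lin.
apply: comb_linp; apply/lallP => l sl; apply: comb_lin.
by move: (lmul_cat (GR u)) => /lallP; apply.
Qed.

(* The i-th entry of b is replaced by ns_i of its coproduct components. *)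
Fixpoint mcomb (ns : seq nat) (b : seq H) G : W :=
  if (ns, b) is (n :: ns', h :: b')
  then comb n h (fun l => mcomb ns' b' (fun l' => G (l ++ l'))) else G [::].

Lemma eq_mcomb ns b G G' : size ns = size b ->
  lall (sumn ns) (fun l => G l = G' l) -> mcomb ns b G = mcomb ns b G'.
Proof.
elim: ns b G G' => [|n ns IH] [|h b] G G' //= [sb] E.
apply: eq_comb; apply/lallP => l sl; apply: IH => //; apply/lallP => l' sl'.
by move/lallP: E; apply; rewrite size_cat sl sl'.
Qed.

Lemma mcomb_tsum (U V : lmodType k) (t : U ⊗ V) ns b (G : U -> V -> seq H -> W) :
  tsum t (fun u v => mcomb ns b (G u v)) =
  mcomb ns b (fun l => tsum t (fun u v => G u v l)).
Proof.
elim: ns b G => [|n ns IH] [|h b] G //=.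
by rewrite comb_tsum; apply: eq_comb; apply/lallP => l sl; rewrite IH.
Qed.

Lemma mcomb_scale c ns b G : c *: mcomb ns b G = mcomb ns b (fun l => c *: G l).
Proof.
elim: ns b G => [|n ns IH] [|h b] G //=.
by rewrite comb_scale; apply: eq_comb; apply/lallP => l sl; rewrite IH.
Qed.

Lemma mcomb_linp (X : lmodType k) ns b (G : X -> seq H -> W) : size ns = size b ->
  lall (sumn ns) (fun l => lin (fun x => G x l)) -> lin (fun x => mcomb ns b (G x)).
Proof.
elim: ns b G => [|n ns IH] [|h b] G //= [sb] /lallP GL.
apply: comb_linp; apply/lallP => l sl; apply: IH => //; apply/lallP => l' sl'.
by apply: GL; rewrite size_cat sl sl'.
Qed.

Lemma mcomb_lmul n ns b G : size ns = size b -> lmul (n + sumn ns) G ->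
  lmul n (fun l => mcomb ns b (fun l' => G (l ++ l'))).
Proof.
move=> sb; elim: n G => [|n IH] G //= [GL GR]; split=> [|x].
  2: exact: (IH (fun l => G (x :: l)) (GR x)).
apply/lallP => l sl; apply: mcomb_linp => //; apply/lallP => l' sl'.
by move/lallP: GL; apply; rewrite size_cat sl sl'.
Qed.

Fixpoint lsplit (i : nat) (b : seq H) (K : seq H -> W) : W :=
  match b, i with
  | [::], _ => K [::]
  | h :: b', 0%N => \sw_(h1, h2 <- h) K [:: h1, h2 & b']
  | h :: b', i'.+1 => lsplit i' b' (fun r => K (h :: r))
  end.

Fixpoint lkill (i : nat) (b : seq H) (K : seq H -> W) : W :=
  match b, i with
  | [::], _ => K [::]
  | h :: b', 0%N => counit h *: K b'
  | h :: b', i'.+1 => lkill i' b' (fun r => K (h :: r))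
  end.

(** Counts travel backwards: [ns] says how many components each entry present after a coproduct at
    place [i] finally yields, the result says it for the entries before. An entry killed by the
    counit yields none, whence [insert0]. *)
Fixpoint addat i (ns : seq nat) : seq nat :=
  match i, ns with
  | 0%N, n1 :: n2 :: ns' => (n1 + n2)%N :: ns'
  | i'.+1, n :: ns' => n :: addat i' ns'
  | _, _ => ns
  end.

Fixpoint insert0 i (ns : seq nat) : seq nat :=
  match i, ns with
  | i'.+1, n :: ns' => n :: insert0 i' ns'
  | _, _ => 0%N :: ns
  end.

Lemma size_addat i ns : (i.+1 < size ns)%N -> size (addat i ns) = (size ns).-1.
Proof. by elim: i ns => [|i IH] [|n [|n' ns]] //= lt; rewrite (IH (_ :: _)). Qed.

Lemma sumn_addat i ns : sumn (addat i ns) = sumn ns.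
Proof.
elim: i ns => [|i IH] [|n ns] //=; last by rewrite IH.
by case: ns => [|n' ns] //=; rewrite addnA.
Qed.

Lemma size_insert0 i ns : (i <= size ns)%N -> size (insert0 i ns) = (size ns).+1.
Proof. by elim: i ns => [|i IH] [|n ns] //= lt; rewrite IH. Qed.

Lemma sumn_insert0 i ns : sumn (insert0 i ns) = sumn ns.
Proof. by elim: i ns => [|i IH] [|n ns] //=; rewrite IH. Qed.

Lemma lsplit_comb i b n h (K : seq H -> seq H -> W) :
  lsplit i b (fun r => comb n h (K r)) = comb n h (fun l => lsplit i b (fun r => K r l)).
Proof.
elim: b i K => [|h' b IH] [|i] K //=; first exact: comb_tsum.
Qed.

Lemma lkill_comb i b n h (K : seq H -> seq H -> W) :
  lkill i b (fun r => comb n h (K r)) = comb n h (fun l => lkill i b (fun r => K r l)).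
Proof.
elim: b i K => [|h' b IH] [|i] K //=; first exact: comb_scale.
Qed.

Lemma lsplit_mcomb i b ns G : (i < size b)%N -> size ns = (size b).+1 ->
  lmul (sumn ns) G ->
  lsplit i b (fun r => mcomb ns r G) = mcomb (addat i ns) b G.
Proof.
elim: b i ns G => [|h b IH] [|i] [|n1 ns] G //=.
  case: ns => [|n2 ns] //= _ [sb] GM.
  rewrite -comb_add; last by apply: mcomb_lmul => //; rewrite -addnA.
  apply: eq_tsum => a c; apply: eq_comb; apply/lallP => l1 _.
  apply: eq_comb; apply/lallP => l2 _; apply: eq_mcomb => //; apply/lallP => l' _.
  by rewrite catA.
move=> lt [sb] GM; rewrite lsplit_comb; apply: eq_comb; apply/lallP => l sl.
by apply: IH => //; move/lallP: (lmul_cat GM); exact.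
Qed.

Lemma lkill_mcomb i b ns G : (i < size b)%N -> size ns = (size b).-1 ->
  lkill i b (fun r => mcomb ns r G) = mcomb (insert0 i ns) b G.
Proof.
elim: b i ns G => [|h b IH] [|i] ns G //= lt sb.
case: ns sb => [|n ns] /= sb; first by case: b lt sb {IH}.
rewrite lkill_comb; apply: eq_comb; apply/lallP => l sl.
by apply: IH => //; rewrite -sb.
Qed.

Lemma mcomb_ones b G : lmul (size b) G -> mcomb (nseq (size b) 1%N) b G = G b.
Proof.
elim: b G => [|h b IH] G // GM.
change (comb 1 h (fun l => mcomb (nseq (size b) 1%N) b (fun l' => G (l ++ l'))) =
  G (h :: b)).
have E : sumn (nseq (size b) 1%N) = size b by rewrite sumn_nseq mul1n.
rewrite comb1; first by apply: IH; case: GM => _; exact.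
apply: mcomb_lmul; first by rewrite size_nseq.
by rewrite E.
Qed.

End IteratedCoproduct.

(* A nested Sweedler sum is run on a state, which lists comodule elements, each
   followed by coalgebra elements, and ends with a list of coalgebra elements.
   An operation coacts on the comodule element of a segment, or applies comul
   or counit to its i-th coalgebra element. For a multilinear summand the value
   only depends on how many components replace each original element, so two
   sums are compared by computing these numbers (eq_sweval). *)
Inductive sweedler_op := Coact | Comul of nat | Counit of nat.

(** * Normal forms of nested Sweedler sums *)

Section Towers.
Variables (k : fieldType) (H : coalgebra k).

Fixpoint tower (T : seq (comodule H)) : Type :=
  if T is M :: T' then (M * seq H * tower T')%type else seq H.

Fixpoint tsized (T : seq (comodule H)) : seq nat -> tower T -> bool :=
  match T with
  | [::] => fun sz s => size s == head 0%N sz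
  | M :: T' => fun sz s => (size s.1.2 == head 0%N sz) && tsized (behead sz) s.2
  end.

Fixpoint tall (T : seq (comodule H)) : seq nat -> (tower T -> Prop) -> Prop :=
  match T with
  | [::] => fun sz P => lall (head 0%N sz) P
  | M :: T' => fun sz P => forall y,
      lall (head 0%N sz) (fun l => tall (behead sz) (fun s => P (y, l, s)))
  end.

Lemma tallP T sz (P : tower T -> Prop) :
  tall sz P <-> forall s, tsized sz s -> P s.
Proof.
elim: T sz P => [|M T IH] sz P /=.
  by rewrite lallP; split=> HP s /eqP; exact: HP.
split=> [HP [[y l] s] /andP[/eqP sl ss]|HP y].
  by have /lallP/(_ _ sl)/IH := HP y; exact.
by apply/lallP => l sl; apply/IH => s ss; apply: HP; rewrite /= sl eqxx.
Qed.

Variable W : lmodType k.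

Fixpoint tmul (T : seq (comodule H)) : seq nat -> (tower T -> W) -> Prop :=
  match T with
  | [::] => fun sz F => lmul (head 0%N sz) F
  | M :: T' => fun sz F =>
      [/\ lall (head 0%N sz) (fun l => tall (behead sz) (fun s => lin (fun y => F (y, l, s)))),
          forall y, tall (behead sz) (fun s => lmul (head 0%N sz) (fun l => F (y, l, s)))
        & forall y, lall (head 0%N sz) (fun l => tmul (behead sz) (fun s => F (y, l, s)))]
  end.

Fixpoint step (T : seq (comodule H)) (j : nat) (o : sweedler_op) : tower T -> (tower T -> W) -> W :=
  match T with
  | [::] => fun s K =>
      match o with
      | Coact => K s
      | Comul i => lsplit i s K
      | Counit i => lkill i s K
      end
  | M :: T' => fun s K =>
      if j is j'.+1 then step j' o s.2 (fun s' => K (s.1, s')) else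
      match o with
      | Coact => \rho_(x0, x1 <- s.1.1) K (x0, x1 :: s.1.2, s.2)
      | Comul i => lsplit i s.1.2 (fun b => K (s.1.1, b, s.2))
      | Counit i => lkill i s.1.2 (fun b => K (s.1.1, b, s.2))
      end
  end.

Fixpoint sweval (T : seq (comodule H)) (ops : seq (nat * sweedler_op)) (s : tower T) (F : tower T -> W) : W :=
  if ops is o :: ops' then step o.1 o.2 s (fun s' => sweval ops' s' F) else F s.

Definition op_valid (o : sweedler_op) (n : nat) : bool :=
  match o with Coact => true | Comul i => (i < n)%N | Counit i => (i < n)%N end.

Definition op_size (o : sweedler_op) (n : nat) : nat :=
  match o with Coact | Comul _ => n.+1 | Counit _ => n.-1 end.

Fixpoint step_valid (T : seq (comodule H)) (j : nat) (o : sweedler_op) (sz : seq nat) : bool :=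
  match T, j with
  | [::], _ => (if o is Coact then false else true) && op_valid o (head 0%N sz)
  | M :: T', 0%N => op_valid o (head 0%N sz)
  | M :: T', j'.+1 => step_valid T' j' o (behead sz)
  end.

Fixpoint step_size (T : seq (comodule H)) (j : nat) (o : sweedler_op) (sz : seq nat) : seq nat :=
  match T, j with
  | [::], _ | _ :: _, 0%N => op_size o (head 0%N sz) :: behead sz
  | M :: T', j'.+1 => head 0%N sz :: step_size T' j' o (behead sz)
  end.

Definition counts := (nat * seq nat)%type.

(** A coaction puts its coalgebra component at the head of the tail, so before it this head count
    belongs to the comodule element. *)
Definition op_counts (o : sweedler_op) (c : counts) : counts :=
  match o with
  | Coact => (c.1 + head 0%N c.2, behead c.2)%N
  | Comul i => (c.1, addat i c.2)
  | Counit i => (c.1, insert0 i c.2)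
  end.

Fixpoint step_counts (T : seq (comodule H)) (j : nat) (o : sweedler_op) (c : seq counts) :
    seq counts :=
  match T, j with
  | [::], _ | _ :: _, 0%N => op_counts o (head (0, [::])%N c) :: behead c
  | M :: T', j'.+1 => head (0, [::])%N c :: step_counts T' j' o (behead c)
  end.

Fixpoint ones (T : seq (comodule H)) (sz : seq nat) : seq counts :=
  (0, nseq (head 0 sz) 1)%N :: if T is M :: T' then ones T' (behead sz) else [::].

(** The count starts at the innermost summand, where each entry stands for itself, and goes back
    through the operations. *)
Fixpoint tower_counts (T : seq (comodule H)) (ops : seq (nat * sweedler_op)) (sz : seq nat) :
    seq counts :=
  if ops is o :: ops'
  then step_counts T o.1 o.2 (tower_counts T ops' (step_size T o.1 o.2 sz))
  else ones T sz.

Fixpoint ops_valid (T : seq (comodule H)) (ops : seq (nat * sweedler_op)) (sz : seq nat) : bool :=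
  if ops is o :: ops'
  then step_valid T o.1 o.2 sz && ops_valid T ops' (step_size T o.1 o.2 sz) else true.

(* The canonical form: the j-th element is replaced by its first component
   and c_j.1 further components, and the i-th entry of its tail by c_j.2 i
   components. *)
Fixpoint canon (T : seq (comodule H)) : seq counts -> tower T -> (tower T -> W) -> W :=
  match T with
  | [::] => fun c s F => mcomb (head (0, [::])%N c).2 s F
  | M :: T' => fun c s F =>
      \rho_(x0, x1 <- s.1.1) comb (head (0, [::])%N c).1 x1 (fun l =>
        mcomb (head (0, [::])%N c).2 s.1.2 (fun l' =>
          canon (behead c) s.2 (fun s' => F (x0, l ++ l', s'))))
  end.

Fixpoint out_size (T : seq (comodule H)) (c : seq counts) : seq nat :=
  match T with
  | [::] => [:: sumn (head (0, [::])%N c).2]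
  | M :: T' => ((head (0, [::])%N c).1 + sumn (head (0, [::])%N c).2)%N :: out_size T' (behead c)
  end.

Fixpoint in_size (T : seq (comodule H)) (c : seq counts) : seq nat :=
  size (head (0, [::])%N c).2 :: if T is M :: T' then in_size T' (behead c) else [::].

Lemma eq_canon T c (s : tower T) F F' : tsized (in_size T c) s ->
  tall (out_size T c) (fun s => F s = F' s) -> canon c s F = canon c s F'.
Proof.
elim: T c s F F' => [|M T IH] c s F F' /=.
  by move=> /eqP ss E; apply: eq_mcomb; rewrite ?ss.
case/andP=> /eqP sl ss E; apply: eq_tsum => x0 x1.
apply: eq_comb; apply/lallP => l sl1; apply: eq_mcomb; first by rewrite sl.
apply/lallP => l' sl'; apply: IH => //.
by have /lallP/(_ (l ++ l')) := E x0; apply; rewrite size_cat sl1 sl'.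
Qed.

Lemma canon_linp (X : lmodType k) T c (s : tower T) (F : X -> tower T -> W) :
  tsized (in_size T c) s ->
  tall (out_size T c) (fun s' => lin (fun x => F x s')) -> lin (fun x => canon c s (F x)).
Proof.
elim: T c s F => [|M T IH] c s F /=.
  by move=> /eqP ss E; apply: mcomb_linp; rewrite ?ss.
case/andP=> /eqP sl ss E; apply: lin_tsumr => x0 x1.
apply: comb_linp; apply/lallP => l sl1; apply: mcomb_linp; first by rewrite sl.
apply/lallP => l' sl'; apply: IH => //.
by have /lallP/(_ (l ++ l')) := E x0; apply; rewrite size_cat sl1 sl'.
Qed.

Lemma canon_lmul n T c (s : tower T) (F : seq H -> tower T -> W) :
  tsized (in_size T c) s ->
  tall (out_size T c) (fun s' => lmul n (fun l => F l s')) ->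
  lmul n (fun l => canon c s (F l)).
Proof.
move=> ss; elim: n F => [|n IH] F //= E; split=> [|x].
  apply/lallP => l sl; apply: canon_linp => //; apply/tallP => s' ss'.
  by move/tallP: E => /(_ _ ss')[/lallP/(_ _ sl)].
apply: IH; apply/tallP => s' ss'; by move/tallP: E => /(_ _ ss')[].
Qed.

Lemma lsplit_form i (b : seq H) : (i < size b)%N ->
  exists (t : H ⊗ H) (f : H -> H -> seq H),
    (forall u v, size (f u v) = (size b).+1) /\
    forall K : seq H -> W, lsplit i b K = tsum t (fun u v => K (f u v)).
Proof.
elim: b i => [|h b IH] [|i] //= lt.
  by exists (comul h), (fun u v => [:: u, v & b]).
have [t [f [fs E]]] := IH i lt; exists t, (fun u v => h :: f u v).
by split=> [u v|K]; rewrite ?E //= fs.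
Qed.

Lemma lkill_form i (b : seq H) : (i < size b)%N ->
  exists a (b' : seq H), size b' = (size b).-1 /\ forall K : seq H -> W, lkill i b K = a *: K b'.
Proof.
elim: b i => [|h b IH] [|i] //= lt; first by exists (counit h), b.
have [a [b' [sb E]]] := IH i lt; exists a, (h :: b').
by split=> [|K]; rewrite ?E //= sb; case: (b) lt.
Qed.

(** An operation is a sum over some tensor or the multiplication by a scalar. Both commute with any
    other sum, which is all that is needed when the operation concerns a later segment. *)
Lemma step_form T j o (s : tower T) sz : step_valid T j o sz -> tsized sz s ->
  (exists (U V : lmodType k) (t : U ⊗ V) (f : U -> V -> tower T),
     (forall u v, tsized (step_size T j o sz) (f u v)) /\
     (forall K, step j o s K = tsum t (fun u v => K (f u v)))) \/
  (exists a s', tsized (step_size T j o sz) s' /\ forall K, step j o s K = a *: K s').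
Proof.
elim: T j s sz => [|M T IH] j s sz.
  case: o => [|i|i] //= lt /eqP ss; rewrite -ss in lt *.
    by left; have [t [f [fs E]]] := lsplit_form lt; exists H, H, t, f; split=> // u v; rewrite /= fs.
  by right; have [a [b [fs E]]] := lkill_form lt; exists a, b; rewrite /= fs.
case: s => [[x b] s]; case: j => [|j] /= v /andP[/eqP sb ss].
  rewrite -sb in v *; case: o v {IH} => [|i|i] /= v.
  - by left; exists M, H, (coact x), (fun x0 x1 => (x0, x1 :: b, s)); split=> // u w; rewrite /= eqxx.
  - left; have [t [f [fs E]]] := lsplit_form v.
    by exists H, H, t, (fun u v => (x, f u v, s)); split=> // u w; rewrite /= fs eqxx.
  right; have [a [b' [fs E]]] := lkill_form v; exists a, (x, b', s).
  by rewrite /= fs eqxx.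
case: (IH _ _ _ v ss) => [[U [V [t [f [fs E]]]]]|[a [s' [fs E]]]]; [left|right].
  exists U, V, t, (fun u v => (x, b, f u v)); split=> [u w|K]; last exact: E.
  by rewrite /= sb eqxx fs.
by exists a, (x, b, s'); split=> [|K]; [rewrite /= sb eqxx fs|exact: E].
Qed.

Lemma eq_step T j o (s : tower T) sz K K' : step_valid T j o sz -> tsized sz s ->
  (forall s', tsized (step_size T j o sz) s' -> K s' = K' s') ->
  step j o s K = step j o s K'.
Proof.
move=> v ss E; case: (step_form v ss) => [[U [V [t [f [fs EK]]]]]|[a [s' [fs EK]]]].
  by rewrite !EK; apply: eq_tsum => *; exact: E.
by rewrite !EK E.
Qed.

Definition sum_op (X : Type) (Phi : (X -> W) -> W) : Prop :=
  (exists (U V : lmodType k) (t : U ⊗ V) (f : U -> V -> X),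
     forall K, Phi K = tsum t (fun u v => K (f u v))) \/
  (exists a x, forall K, Phi K = a *: K x).

Lemma sum_op_segment (X : Type) (Phi : (X -> W) -> W) (M : comodule H) (m : M) n ns b
    (K : X -> M -> seq H -> seq H -> W) : sum_op Phi ->
  Phi (fun x => \rho_(m0, m1 <- m) comb n m1 (fun l => mcomb ns b (fun l' => K x m0 l l'))) =
  \rho_(m0, m1 <- m) comb n m1 (fun l => mcomb ns b (fun l' => Phi (fun x => K x m0 l l'))).
Proof.
case=> [[U [V [t [f E]]]]|[a [x E]]]; rewrite E.
  rewrite tsum_exchange; apply: eq_tsum => m0 m1; rewrite comb_tsum; congr comb.
  by apply: funext => l; rewrite mcomb_tsum; congr mcomb; apply: funext => l'; rewrite E.
rewrite (@lin_tsum _ _ _ _ _ (fun x => a *: x)); last by lin.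
apply: eq_tsum => m0 m1; rewrite comb_scale; congr comb.
by apply: funext => l; rewrite mcomb_scale; congr mcomb; apply: funext => l'; rewrite E.
Qed.

Lemma op_counts_sum o c :
  ((op_counts o c).1 + sumn (op_counts o c).2 = c.1 + sumn c.2)%N.
Proof.
case: c o => n ns [|i|i] /=; [|by rewrite sumn_addat|by rewrite sumn_insert0].
by case: ns => [|n' ns] /=; rewrite ?addn0 ?addnA.
Qed.

Lemma head_step (M : comodule H) T o (x : M) (b : seq H) (s : tower T) c :
  let c' := step_counts (M :: T) 0 o c in
  op_valid o (size b) -> size (head (0, [::])%N c').2 = size b ->
  size (head (0, [::])%N c).2 = op_size o (size b) ->
  tsized (in_size T (behead c)) s ->
  forall F, @tmul (M :: T) (out_size (M :: T) c') F ->
  @step (M :: T) 0 o (x, b, s) (fun s' => canon c s' F) = @canon (M :: T) c' (x, b, s) F.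
Proof.
rewrite /=; move: (head _ c) (behead c) => [n ns] {}c v sb' sb ss F.
rewrite op_counts_sum /= => -[FH FL _].
pose G x0 l := canon c s (fun s' => F (x0, l, s')).
have GM x0 : lmul (n + sumn ns) (G x0) by apply: canon_lmul.
have GH : lall (n + sumn ns) (fun l => lin (fun x0 => G x0 l)).
  by apply/lallP => l sl; apply: canon_linp => //; move/lallP: FH; exact.
case: o v sb sb' FH FL => [|i|i] /= v sb sb' _ _.
- case: ns sb sb' GM GH => [|n' ns] //= [sb] _ GM GH.
  transitivity (\rho_(x0, x1 <- x) \rho_(x00, x01 <- x0)
     comb n x01 (fun l => comb n' x1 (fun l1 => mcomb ns b (fun l2 => G x00 (l ++ (l1 ++ l2)))))).
    by [].
  have GT : tril (fun x00 x01 x1 => comb n x01 (fun l => comb n' x1 (fun l1 =>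
      mcomb ns b (fun l2 => G x00 (l ++ (l1 ++ l2)))))).
    have GM1 x0 : lmul (n + n') (fun l => mcomb ns b (fun l' => G x0 (l ++ l'))).
      by apply: mcomb_lmul; rewrite -?addnA.
    have GM2 x0 l : (fun l1 => mcomb ns b (fun l2 => G x0 (l ++ (l1 ++ l2)))) =
                  (fun l1 => mcomb ns b (fun l2 => G x0 ((l ++ l1) ++ l2))).
      by apply: funext => l1; congr mcomb; apply: funext => l2; rewrite catA.
    split=> [v1 w1|u1 w1|u1 v1].
    - apply: comb_linp; apply/lallP => l sl; apply: comb_linp; apply/lallP => l1 sl1.
      apply: mcomb_linp => //; apply/lallP => l2 sl2.
      by move/lallP: GH; apply; rewrite !size_cat sl sl1 sl2.
    - apply: comb_lin; have := lmul_comb w1 (GM1 u1).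
      by congr lmul; apply: funext => l; rewrite GM2.
    apply: comb_linp; apply/lallP => l sl; apply: comb_lin; rewrite GM2.
    by have /lallP/(_ _ sl) := lmul_cat (GM1 u1).
  (* Coassociativity replaces the second coaction by a coproduct of [x1], whose two halves
     [comb_add] merges. *)
  rewrite (rho_assoc _ GT); apply: eq_tsum => x0 x1.
  rewrite -comb_add; last first.
    by apply: (@mcomb_lmul _ _ _ _ _ _ (G x0)) => //; rewrite -addnA; exact: GM.
  apply: eq_tsum => h1 h2; congr comb; apply: funext => l1; congr comb; apply: funext => l2.
  by congr mcomb; apply: funext => l'; rewrite catA.
- have sF : sum_op (lsplit i b (W := W)).
    by have [t [f [_ E]]] := lsplit_form v; left; exists H, H, t, f.
  transitivity (\rho_(x0, x1 <- x) comb n x1 (fun l => lsplit i b (fun b' =>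
      mcomb ns b' (fun l' => G x0 (l ++ l'))))).
    have [t [f [_ E]]] := lsplit_form v; rewrite E tsum_exchange.
    apply: eq_tsum => x0 x1; rewrite comb_tsum; congr comb.
    by apply: funext => l; rewrite E.
  apply: eq_tsum => x0 x1; apply: eq_comb; apply/lallP => l sl; apply: lsplit_mcomb => //.
  by have /lallP/(_ _ sl) := lmul_cat (GM x0).
transitivity (\rho_(x0, x1 <- x) comb n x1 (fun l => lkill i b (fun b' =>
    mcomb ns b' (fun l' => G x0 (l ++ l'))))).
  have [a [b' [_ E]]] := lkill_form v; rewrite E.
  rewrite (@lin_tsum _ _ _ _ _ (fun x => a *: x)); last by lin.
  apply: eq_tsum => x0 x1; rewrite comb_scale; congr comb.
  by apply: funext => l; rewrite E.
by apply: eq_tsum => x0 x1; congr comb; apply: funext => l; exact: lkill_mcomb.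
Qed.

Lemma step_canon T j o (s : tower T) c :
  step_valid T j o (in_size T (step_counts T j o c)) ->
  in_size T c = step_size T j o (in_size T (step_counts T j o c)) ->
  tsized (in_size T (step_counts T j o c)) s ->
  forall F, tmul (out_size T (step_counts T j o c)) F ->
  step j o s (fun s' => canon c s' F) = canon (step_counts T j o c) s F.
Proof.
elim: T j s c => [|M T IH] j s c.
  rewrite /=; move: (head _ c) => [n ns].
  case: o => [|i|i] //= v [sn] /eqP ss F; rewrite -ss in v sn.
    by rewrite sumn_addat; exact: lsplit_mcomb.
  by rewrite sumn_insert0 => FM; apply: lkill_mcomb => //; rewrite sn.
case: s => [[x b] s]; case: j => [|j].
  move=> /= v [sn] /andP[/eqP sb ss] F FM; rewrite -sb in v sn.
  by apply: head_step.
rewrite /=; move: (head _ c) (behead c) => [n ns] {}c v [E] /andP[/eqP sb ss] F [FH FL FM].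
have sF : sum_op (@step T j o s).
  by case: (step_form v ss) => [[U [V [t [f [_ EK]]]]]|[a [s' [_ EK]]]];
    [left; exists U, V, t, f|right; exists a, s'].
rewrite [LHS](sum_op_segment _ _ _ _
  (fun s1 x0 l l1 => canon c s1 (fun s2 => F (x0, l ++ l1, s2))) sF) /=.
apply: eq_tsum => x0 x1; apply: eq_comb; apply/lallP => l sl.
apply: eq_mcomb; first by rewrite sb.
apply/lallP => l' sl'; apply: IH => //.
by move/lallP: (FM x0); apply; rewrite size_cat sl sl'.
Qed.

Lemma in_size_step T j o sz c : step_valid T j o sz ->
  in_size T c = step_size T j o sz -> size sz = (size T).+1 ->
  in_size T (step_counts T j o c) = sz.
Proof.
have opP n ns m : op_valid o m -> size ns = op_size o m -> size (op_counts o (n, ns)).2 = m.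
  case: o => [|i|i] /= v E.
  - by case: ns E => [|n' ns] //= [].
  - by rewrite size_addat E.
  by rewrite size_insert0 E; case: m v {E}.
elim: T j sz c => [|M T IH] j [|m sz] c //=; move: (head _ c) (behead c) => [n ns] {}c.
  by case: sz => // /andP[_ v] [E] _; rewrite (opP n ns m).
case: j => [|j] /= v [E1 E2] [sT]; first by rewrite (opP n ns m) // E2.
by rewrite (IH j sz) // E1.
Qed.

Lemma size_step_size T j o sz : size sz = (size T).+1 ->
  size (step_size T j o sz) = (size T).+1.
Proof.
elim: T j sz => [|M T IH] j [|m sz] //=.
by case: j => [|j] /= [sT]; rewrite ?sT // IH.
Qed.

Lemma in_size_counts T ops sz : size sz = (size T).+1 -> ops_valid T ops sz ->
  in_size T (tower_counts T ops sz) = sz.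
Proof.
elim: ops sz => [|[j o] ops IH] sz /= sT.
  move=> _; elim: T sz sT => [|M T IH] [|m sz] //=; rewrite size_nseq; first by case: sz.
  by case=> sT; rewrite IH.
case/andP=> v vs; apply: in_size_step => //.
by apply: IH => //; exact: size_step_size.
Qed.

Lemma canon_ones T sz (s : tower T) F : tsized sz s -> tmul sz F -> canon (ones T sz) s F = F s.
Proof.
elim: T sz s F => [|M T IH] sz s F /=.
  by move=> /eqP <-; exact: mcomb_ones.
case: s => [[x b] s] /= /andP[/eqP sb ss] [FH FL FM].
transitivity (\rho_(x0, x1 <- x) counit x1 *: F (x0, b, s)).
  apply: eq_tsum => x0 x1; congr (_ *: _); rewrite -sb.
  have <- : mcomb (nseq (size b) 1%N) b (fun l' => F (x0, l', s)) = F (x0, b, s).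
    by apply: mcomb_ones; rewrite sb; move/tallP: (FL x0) => /(_ _ ss).
  apply: eq_mcomb; first by rewrite size_nseq.
  rewrite sumn_nseq mul1n; apply/lallP => l sl; apply: IH => //.
  by move/lallP: (FM x0); apply; rewrite -sb.
apply: (@rho_counit _ _ _ _ (fun x0 => F (x0, b, s))).
by move/lallP: FH => /(_ _ sb)/tallP; exact.
Qed.

Lemma sweval_canon T ops sz (s : tower T) : size sz = (size T).+1 ->
  ops_valid T ops sz -> tsized sz s ->
  forall F, tmul (out_size T (tower_counts T ops sz)) F ->
  sweval ops s F = canon (tower_counts T ops sz) s F.
Proof.
have outE c j o : step_valid T j o (in_size T (step_counts T j o c)) ->
    out_size T (step_counts T j o c) = out_size T c.
  elim: T j c {s ops sz} => [|M T IH] j c /=; move: (head _ c) (behead c) => [n ns] {}c.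
    by case: o => [//|i|i] _ /=; rewrite ?sumn_addat ?sumn_insert0.
  by case: j => [|j] v; [rewrite /= op_counts_sum|rewrite /= IH].
move=> sT; elim: ops sz s sT => [|[j o] ops IH] sz s sT /=.
  have -> : out_size T (ones T sz) = sz.
    elim: T sz {s outE} sT => [|M T IH] [|m sz] //=; rewrite sumn_nseq mul1n.
      by case: sz.
    by case=> sT; rewrite add0n IH.
  by move=> _ ss F FM; rewrite canon_ones.
case/andP=> v vs ss F FM; have sT' := size_step_size j o sT.
have E := in_size_counts sT' vs; have E' := in_size_step v E sT.
rewrite -step_canon ?E' //.
apply: (eq_step v ss) => s' ss'; apply: IH => //.
by rewrite -(@outE _ j o) ?E'.
Qed.

Lemma eq_lmul n (G G' : seq H -> W) : lall n (fun l => G l = G' l) -> lmul n G -> lmul n G'.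
Proof.
elim: n G G' => [|n IH] G G' //= E [GL GR]; split=> [|x]; last exact: IH (E x) (GR x).
apply/lallP => l sl; move/lallP: GL => /(_ _ sl); congr lin; apply: funext => x.
by move/lallP: (E x); apply.
Qed.

Lemma eq_tmul T sz (F F' : tower T -> W) :
  tall sz (fun s => F s = F' s) -> tmul sz F -> tmul sz F'.
Proof.
elim: T sz F F' => [|M T IH] sz F F' /= E; first exact: eq_lmul.
have {}E y l s : size l = head 0%N sz -> tsized (behead sz) s -> F (y, l, s) = F' (y, l, s).
  by move=> sl ss; have /lallP/(_ _ sl)/tallP/(_ _ ss) := E y.
case=> F1 F2 F3; split=> [|y|y].
- apply/lallP => l sl; apply/tallP => s ss; move/lallP: F1 => /(_ _ sl)/tallP/(_ _ ss).
  by congr lin; apply: funext => y; rewrite E.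
- apply/tallP => s ss; have /tallP/(_ _ ss) := F2 y.
  by apply: eq_lmul; apply/lallP => l sl; rewrite E.
apply/lallP => l sl; have /lallP/(_ _ sl) := F3 y.
by apply: IH; apply/tallP => s ss; rewrite E.
Qed.

(** The two equations are the goals of the reification, which instantiates [ops1], [ops2], [F1] and
    [F2]. The boolean conjunction is then decided by computation; multilinearity and the pointwise
    comparison of the summands remain. *)
Lemma eq_sweval T sz (s : tower T) ops1 ops2 F1 F2 W1 W2 :
  W1 = sweval ops1 s F1 -> W2 = sweval ops2 s F2 ->
  [&& size sz == (size T).+1, ops_valid T ops1 sz, ops_valid T ops2 sz, tsized sz s &
      tower_counts T ops1 sz == tower_counts T ops2 sz] ->
  tmul (out_size T (tower_counts T ops1 sz)) F1 ->
  tall (out_size T (tower_counts T ops1 sz)) (fun s => F1 s = F2 s) -> W1 = W2.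
Proof.
move=> -> -> /and5P[/eqP sT v1 v2 ss /eqP E] FM F12.
rewrite !(@sweval_canon _ _ sz) // -?E; last exact: eq_tmul FM.
by apply: eq_canon; rewrite ?in_size_counts.
Qed.

End Towers.

(** * A tactic for Sweedler sums *)

(** Moves a scalar out of any place of a summand, the summand being seen as a linear function of
    that place. *)
Lemma lin_scal1 (k : fieldType) (W : lmodType k) (g : k^o -> W) (c : k) :
  lin g -> g c = c *: g 1.
Proof. by move=> gL; rewrite -(linZ gL) /GRing.scale /= mulr1. Qed.

Lemma tsum_eq_pair (k : fieldType) (U V : lmodType k) (W : nmodType) (t t' : U ⊗ V)
  (F : U -> V -> W) : t = t' -> tsum t F = tsum t' F.
Proof. by move=> ->. Qed.

Lemma tsum_scale (k : fieldType) (U V W : lmodType k) c (t : U ⊗ V) (F : U -> V -> W) :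
  bil F -> tsum (c *: t) F = c *: tsum t F.
Proof. by move=> /tsum_linear FL; rewrite (linZ FL). Qed.

Ltac sw_subst t x u :=
  let f := eval pattern x in t in
  lazymatch f with ?g _ => let r := eval cbv beta in (g u) in r end.

Ltac sw_abs_list t l p i :=
  lazymatch l with
  | ?x :: ?l' =>
    let ty := type of x in
    let t' := sw_subst t x constr:(nth (0%R : ty) p i) in
    sw_abs_list t' l' p constr:(S i)
  | _ => t
  end.

Ltac sw_abs t s p :=
  lazymatch s with
  | (?x, ?l, ?s') =>
    let t1 := sw_subst t x constr:(fst (fst p)) in
    let t2 := sw_abs_list t1 l constr:(snd (fst p)) O in
    sw_abs t2 s' constr:(snd p)
  | ?l => sw_abs_list t l p O
  end.

Ltac sw_find_list x l i :=
  lazymatch l with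
  | x :: _ => i
  | _ :: ?l' => sw_find_list x l' constr:(S i)
  end.

(* Returns the position of x in s as a pair (segment, index). *)
Ltac sw_find_tail x s j :=
  match s with
  | (_, ?l, _) => let i := sw_find_list x l O in constr:((j, i))
  | (_, _, ?s') => sw_find_tail x s' constr:(S j)
  | ?l => let i := sw_find_list x l O in constr:((j, i))
  end.

Ltac sw_find_head x s j :=
  lazymatch s with
  | (x, _, _) => j
  | (_, _, ?s') => sw_find_head x s' constr:(S j)
  end.

Ltac sw_unfold := cbv beta delta [sw5 sw4 sw3 sw2 bpair].

(** The list [o] of operations is unknown; each call fixes its head and leaves an unknown tail. *)
Ltac sw_op o op :=
  let T := type of o in
  let o' := open_constr:(_ : T) in
  unify o (cons op o'); cbn [sweval step fst snd lsplit lkill].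

Ltac sw_pull_sum W leaf :=
  match leaf with
  | context C [tsum ?t ?B] =>
    let ty := type of (tsum t B) in
    let ty := eval cbn in ty in
    lazymatch ty with
    | GRing.Field.sort ?k =>
      let g := constr:(fun z : (k^o : Type) => ltac:(let r := context C [z] in exact r)) in
      refine (etrans (@lin_tsum k _ _ k^o W g t B _) _)
    | _ =>
      let g := constr:(fun z : ty => ltac:(let r := context C [z] in exact r)) in
      refine (etrans (lin_tsum (W' := W) (g := g) t B _) _)
    end
  end.

Ltac sw_pull_counit W leaf o s :=
  match leaf with
  | context C [?f ?x] =>
    is_var x;
    lazymatch f with
    | _ (@counit ?k _) =>
      let g := constr:(fun z : (k^o : Type) => ltac:(let r := context C [z] in exact r)) in
      refine (etrans (@lin_scal1 k W g (f x) _) _); [lin | cbn beta];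
      lazymatch sw_find_tail x s O with (?j, ?i) => sw_op o constr:((j, Counit i)) end;
      refine (congr1 (fun w => f x *: w) _)
    end
  end.

(** Equations in the context are rules too. Hence the proofs restate the colinearity of [gamma]
    through [comul], as in [gammaE], before calling [sweedler]. *)
Ltac sw_rewrite_coproduct :=
  first
  [ refine (etrans (tsum_eq_pair _ (comulM _ _)) _)
  | refine (etrans (tsum_eq_pair _ (comul1 _)) _)
  | refine (etrans (tsum_eq_pair _ (comul_antipode _)) _)
  | refine (etrans (tsum_eq_pair _ (coact_camul _ _)) _)
  | refine (etrans (tsum_eq_pair _ (coact_caone _)) _)
  | refine (etrans (tsum_eq_pair _ (coact_hact _ _)) _)
  | refine (etrans (tsum_eq_pair _ (coinvP _)) _)
  | match goal with
    | E : forall h, @eq _ _ _ |- _ => refine (etrans (tsum_eq_pair _ (E _)) _)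
    | E : forall g h, @eq _ _ _ |- _ => refine (etrans (tsum_eq_pair _ (E _ _)) _)
    | E : colinear _ |- _ => refine (etrans (tsum_eq_pair _ (E _)) _)
    end ];
  sw_unfold.

Ltac sw_simp_one := rewrite ?counit1 ?omega1 ?omega1l ?hmul1l ?hmul1r.

(* The tests on the leaf avoid the cost of failing rewrites. *)
Ltac sw_simp leaf :=
  first
  [ match leaf with
    | context [?f ?x] =>
      lazymatch f with _ (@counit _ _) => idtac end;
      tryif is_var x then fail else rewrite ?counitM ?counit_antipode ?counit1
    end
  | lazymatch leaf with context [@hone] => sw_simp_one end ].

(** Throughout, the right side is [sweval] with unknown operations on the current state. Outer sums
    are consumed first. In the summand, inner sums are pulled out by linearity, units and counits of
    products are simplified, and factors [counit x] become operations. Only then is the list closed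
    and the summand abstracted over the state. *)
Ltac sw_reify :=
  lazymatch goal with
  | |- tsum ?t _ = @sweval _ _ ?W _ ?o ?s _ =>
    lazymatch t with
    | tsum _ _ => refine (etrans (@tsum_bil_pair _ _ _ _ _ W _ _ _ _) _); [lin | cbn beta; sw_reify]
    | tpair _ _ => refine (etrans (@tsum_pair _ _ _ W _ _ _ _) _); [lin | cbn beta; sw_reify]
    | GRing.scale _ _ =>
      refine (etrans (@tsum_scale _ _ _ W _ _ _ _) _); [lin | cbn beta; sw_reify]
    | _ ?x =>
      tryif is_var x then
        lazymatch t with
        | context [@comul] => lazymatch sw_find_tail x s O with
                     | (?j, ?i) => sw_op o constr:((j, Comul i)) end; sw_unfold
        | context [@coact] => let j := sw_find_head x s O in sw_op o constr:((j, Coact))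
        end;
        refine (eq_tsum _ _); intros ? ?; cbn beta; sw_reify
      else (sw_rewrite_coproduct; sw_reify)
    end
  | |- ?leaf = @sweval _ _ ?W _ ?o ?s ?F =>
    tryif (sw_pull_sum W leaf; [lin | cbn beta]) then sw_reify else
    tryif (progress (sw_simp leaf)) then sw_reify else
    tryif (sw_pull_counit W leaf o s) then sw_reify else
    (unify o (@nil (nat * sweedler_op)); cbn [sweval];
      lazymatch type of F with
      | ?ty -> _ =>
        let ty := eval cbn [tower] in ty in
        let f := constr:(fun z : ty => ltac:(let t := sw_abs leaf s z in exact t)) in
        unify F f; reflexivity
      end)
  end.

Ltac sw_linear :=
  intros;
  lazymatch goal with
  | |- _ /\ _ => split; sw_linear
  | |- and3 _ _ _ => split; sw_linear
  | |- True => exact I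
  | _ => lin
  end.

Ltac sweedler_core T sz s :=
  sw_unfold;
  lazymatch goal with
  | |- @eq ?ty _ _ =>
    let ty' := eval cbn in ty in
    lazymatch ty' with
    | GRing.Field.sort ?k => eapply (@eq_sweval _ _ k^o T sz s)
    | _ => eapply (@eq_sweval _ _ _ T sz s)
    end
  end;
  [ sw_reify
  | sw_reify
  | reflexivity
  | lazymatch goal with |- tmul ?x _ => let v := eval lazy in x in change x with v end;
    cbn [lall tall tmul lmul head behead fst snd nth]; sw_linear
  | lazymatch goal with |- tall ?x _ => let v := eval lazy in x in change x with v end;
    cbn [lall tall head behead fst snd nth]; intros; rewrite ?mulr1 ?mul1r ?scale1r;
    try reflexivity ].

Ltac sw_sort x :=
  let ty := type of x in
  lazymatch ty with
  | GRing.Lmodule.sort ?M => M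
  | _ => let ty' := eval cbn in ty in lazymatch ty' with GRing.Lmodule.sort ?M => M end
  end.

(* In the argument (m, (n, [:: h; g])) of sweedler, m and n are elements of
   comodules, h and g of the coalgebra; tt stands for an empty list. *)
Ltac sw_coalgebra e :=
  lazymatch e with
  | (?x, _) => lazymatch sw_sort x with com_sort ?M =>
                 let ty := type of M in lazymatch ty with @comodule _ ?C => C end end
  | ?x :: _ => lazymatch sw_sort x with coalg_sort ?C => C end
  end.

Ltac sw_comodules C e :=
  lazymatch e with
  | (?x, ?e') => lazymatch sw_sort x with com_sort ?M =>
                   let T := sw_comodules C e' in constr:(M :: T) end
  | _ => constr:(@nil (comodule C))
  end.

Ltac sw_state C e :=
  lazymatch e with
  | (?x, ?e') => let s := sw_state C e' in constr:((x, @nil (coalg_sort C), s))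
  | tt => constr:(@nil (coalg_sort C))
  | ?l => l
  end.

Ltac sw_sizes e :=
  lazymatch e with
  | (_, ?e') => let t := sw_sizes e' in constr:(O :: t)
  | tt => constr:([:: O])
  | ?l => let n := eval cbn [size] in (size l) in constr:([:: n])
  end.

Ltac sweedler e :=
  let C := sw_coalgebra e in
  let T := sw_comodules C e in
  let s := sw_state C e in
  let sz := sw_sizes e in
  sweedler_core T sz s.

(** * Coquasi-bialgebras *)

Section CoquasiBialgebraTheory.
Variables (k : fieldType) (H : coquasi_bialgebra k).
Implicit Types h g x y : H.

Lemma omegaV1 h g : omegaV (h ⊗ hone ⊗ g) = counit h * counit g.
Proof.
transitivity (\sw_(h1, h2 <- h) \sw_(e1, e2 <- hone) \sw_(g1, g2 <- g)
  omega (h1 ⊗ e1 ⊗ g1) * omegaV (h2 ⊗ e2 ⊗ g2)); first by sweedler [:: h; g].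
by rewrite omegaK counit1 mulr1.
Qed.

Lemma omegaV1l h g : omegaV (hone ⊗ h ⊗ g) = counit h * counit g.
Proof.
transitivity (\sw_(e1, e2 <- hone) \sw_(h1, h2 <- h) \sw_(g1, g2 <- g)
  omega (e1 ⊗ h1 ⊗ g1) * omegaV (e2 ⊗ h2 ⊗ g2)); first by sweedler [:: h; g].
by rewrite omegaK counit1 mul1r.
Qed.

(** The pentagon at h, g, 1, 1: its other factors have the unit in the middle. *)
Lemma omega1r_idem h g :
  \sw_(h1, h2 <- h) \sw_(g1, g2 <- g) omega (h1 ⊗ g1 ⊗ hone) * omega (h2 ⊗ g2 ⊗ hone) =
  omega (h ⊗ g ⊗ hone).
Proof.
transitivity (\sw_(h1, h2 <- h) \sw_(g1, g2, g3 <- g) \sw_(x1, x2, x3 <- hone)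
      \sw_(y1, y2 <- hone)
        omega (g1 ⊗ x1 ⊗ y1) * omega (h1 ⊗ (g2 *H x2) ⊗ y2) * omega (h2 ⊗ g3 ⊗ x3)).
  by sweedler [:: h; g].
by rewrite -omega_cocycle; sweedler [:: h; g].
Qed.

(** An idempotent of the convolution monoid that has an inverse is the unit. *)
Lemma omega1r h g : omega (h ⊗ g ⊗ hone) = counit h * counit g.
Proof.
have E h' g' : \sw_(h1, h2 <- h') \sw_(g1, g2 <- g')
    omega (h1 ⊗ g1 ⊗ hone) * omegaV (h2 ⊗ g2 ⊗ hone) = counit h' * counit g'.
  rewrite -[RHS]mulr1 -(counit1 H) -omegaK; by sweedler [:: h'; g'].
transitivity (\sw_(h1, h2 <- h) \sw_(g1, g2 <- g) omega (h1 ⊗ g1 ⊗ hone) *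
  \sw_(h3, h4 <- h2) \sw_(g3, g4 <- g2) omega (h3 ⊗ g3 ⊗ hone) * omegaV (h4 ⊗ g4 ⊗ hone)).
  under eq_sw2 => h1 h2 do under eq_sw2 => g1 g2 do rewrite E.
  by sweedler [:: h; g].
rewrite -E; transitivity (\sw_(h1, h2 <- h) \sw_(g1, g2 <- g)
   (\sw_(h3, h4 <- h1) \sw_(g3, g4 <- g1) omega (h3 ⊗ g3 ⊗ hone) * omega (h4 ⊗ g4 ⊗ hone))
     * omegaV (h2 ⊗ g2 ⊗ hone)); first by sweedler [:: h; g]; rewrite mulrA.
by under eq_sw2 => h1 h2 do under eq_sw2 => g1 g2 do rewrite omega1r_idem.
Qed.

Lemma omegaV1r h g : omegaV (h ⊗ g ⊗ hone) = counit h * counit g.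
Proof.
rewrite -[RHS]mulr1 -(counit1 H) -omegaK.
transitivity (\sw_(h1, h2 <- h) \sw_(g1, g2 <- g)
  (counit h1 * counit g1) * omegaV (h2 ⊗ g2 ⊗ hone)); first by sweedler [:: h; g].
under eq_sw2 => h1 h2 do under eq_sw2 => g1 g2 do rewrite -omega1r.
by sweedler [:: h; g].
Qed.

(** * The pentagon in the convolution monoid of four-linear forms *)

Record form4 := Form4 {
  form4_fun :> H -> H -> H -> H -> k;
  form4_lin : [/\ forall g x y, @lin k H k^o (fun h => form4_fun h g x y),
    forall h x y, @lin k H k^o (fun g => form4_fun h g x y),
    forall h g y, @lin k H k^o (fun x => form4_fun h g x y) &
    forall h g x, @lin k H k^o (fun y => form4_fun h g x y)] }.

Lemma form4_ext (f f' : form4) : (forall h g x y, f h g x y = f' h g x y) -> f = f'.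
Proof.
case: f f' => f fL [f' fL'] /= E.
have E' : f = f' by do 4 apply: funext => ?; exact: E.
by subst f'; congr Form4; exact: Prop_irrelevance.
Qed.

(** With this product the pentagon is an equation in a monoid and can be solved for a group of
    factors by cancelling. *)
Program Definition conv4 (f f' : form4) : form4 := @Form4 (fun h g x y =>
  \sw_(h1, h2 <- h) \sw_(g1, g2 <- g) \sw_(x1, x2 <- x) \sw_(y1, y2 <- y)
    f h1 g1 x1 y1 * f' h2 g2 x2 y2) _.
Next Obligation. by case: (form4_lin f) (form4_lin f') => ? ? ? ? [? ? ? ?]; split; slin. Qed.

Program Definition one4 : form4 := @Form4 (fun h g x y => counit h * counit g * counit x * counit y) _.
Next Obligation. by split; slin. Qed.

Lemma conv4A : associative conv4.
Proof.
move=> f f' f''; apply: form4_ext => h g x y /=.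
case: (form4_lin f) (form4_lin f') (form4_lin f'') => ? ? ? ? [? ? ? ?] [? ? ? ?].
by sweedler [:: h; g; x; y]; rewrite mulrA.
Qed.

Lemma conv4_1l : left_id one4 conv4.
Proof.
move=> f; apply: form4_ext => h g x y /=; case: (form4_lin f) => ? ? ? ?.
by sweedler [:: h; g; x; y].
Qed.

Lemma conv4_1r : right_id one4 conv4.
Proof.
move=> f; apply: form4_ext => h g x y /=; case: (form4_lin f) => ? ? ? ?.
by sweedler [:: h; g; x; y].
Qed.

Local Notation w := omega.
Local Notation v := omegaV.
Local Infix "**" := conv4 (at level 40, left associativity).

(* The five factors of the pentagon, with u one of omega, omegaV. *)
Section Pullbacks.
Variable u : 'Dual(H ⊗ H ⊗ H).

Program Definition form_a : form4 := @Form4 (fun h g x y => u (h ⊗ g ⊗ (x *H y))) _.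
Next Obligation. by split; slin. Qed.
Program Definition form_b : form4 := @Form4 (fun h g x y => u ((h *H g) ⊗ x ⊗ y)) _.
Next Obligation. by split; slin. Qed.
Program Definition form_c : form4 := @Form4 (fun h g x y => counit h * u (g ⊗ x ⊗ y)) _.
Next Obligation. by split; slin. Qed.
Program Definition form_d : form4 := @Form4 (fun h g x y => u (h ⊗ (g *H x) ⊗ y)) _.
Next Obligation. by split; slin. Qed.
Program Definition form_e : form4 := @Form4 (fun h g x y => counit y * u (h ⊗ g ⊗ x)) _.
Next Obligation. by split; slin. Qed.

End Pullbacks.

Lemma pentagon4 : form_a w ** form_b w = form_c w ** (form_d w ** form_e w).
Proof.
apply: form4_ext => h g x y /=; rewrite omega_cocycle.
by sweedler [:: h; g; x; y]; rewrite !mulrA.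
Qed.

(** Each of the five forms is a pullback along a coalgebra morphism to H ⊗ H ⊗ H, so convolution
    inverses pull back as well. *)
Lemma form_aK : form_a v ** form_a w = one4.
Proof.
apply: form4_ext => h g x y /=; rewrite -!mulrA -counitM mulrA -omegaVK.
by sweedler [:: h; g; x; y].
Qed.

Lemma form_bK : form_b w ** form_b v = one4.
Proof.
apply: form4_ext => h g x y /=; rewrite -counitM -omegaK.
by sweedler [:: h; g; x; y].
Qed.

Lemma form_cK : form_c v ** form_c w = one4.
Proof.
apply: form4_ext => h g x y /=; rewrite -!mulrA [counit g * _]mulrA -omegaVK.
by sweedler [:: h; g; x; y].
Qed.

Lemma form_dK : form_d v ** form_d w = one4.
Proof.
apply: form4_ext => h g x y /=; rewrite -[counit h * _ * _]mulrA -counitM -omegaVK.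
by sweedler [:: h; g; x; y].
Qed.

Lemma form_dVK : form_d w ** form_d v = one4.
Proof.
apply: form4_ext => h g x y /=; rewrite -[counit h * _ * _]mulrA -counitM -omegaK.
by sweedler [:: h; g; x; y].
Qed.

Lemma form_eK : form_e w ** form_e v = one4.
Proof.
apply: form4_ext => h g x y /=; rewrite -omegaK mulrC.
by sweedler [:: h; g; x; y].
Qed.

(** This solved form serves to recover the product of [A] from [can] ([omega_galois]), the next one
    to invert [can] on the right ([omega_cleft]), and [pentagon_ac] to treat [ev]
    ([omegaV_eval]). *)
Lemma pentagon_be : form_b w ** form_e v = form_a v ** (form_c w ** form_d w).
Proof.
rewrite -[form_b w]conv4_1l -form_aK -(conv4A (form_a v)) pentagon4.
by rewrite -!conv4A form_eK conv4_1r.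
Qed.

Lemma pentagon_eb : form_e w ** form_b v = form_d v ** (form_c v ** form_a w).
Proof.
rewrite -[form_a w]conv4_1r -form_bK (conv4A (form_a w)) pentagon4.
by rewrite -!conv4A (conv4A (form_c v)) form_cK conv4_1l (conv4A (form_d v)) form_dK conv4_1l.
Qed.

Lemma pentagon_ac : form_a v ** form_c w = form_b w ** (form_e v ** form_d v).
Proof. by rewrite conv4A pentagon_be -!conv4A form_dVK conv4_1r. Qed.

Lemma omega_be h g x y :
  \sw_(h1, h2 <- h) \sw_(g1, g2 <- g) \sw_(x1, x2 <- x)
    omega ((h1 *H g1) ⊗ x1 ⊗ y) * omegaV (h2 ⊗ g2 ⊗ x2) =
  \sw_(h1, h2 <- h) \sw_(g1, g2, g3 <- g) \sw_(x1, x2, x3 <- x) \sw_(y1, y2, y3 <- y)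
    omegaV (h1 ⊗ g1 ⊗ (x1 *H y1)) * omega (g2 ⊗ x2 ⊗ y2) * omega (h2 ⊗ (g3 *H x3) ⊗ y3).
Proof.
transitivity (conv4 (form_b w) (form_e v) h g x y); first by rewrite /=; sweedler [:: h; g; x; y].
by rewrite pentagon_be /=; sweedler [:: h; g; x; y]; rewrite !mulrA.
Qed.

Lemma omega_eb h g x y :
  \sw_(h1, h2 <- h) \sw_(g1, g2 <- g) \sw_(x1, x2 <- x)
    omega (h1 ⊗ g1 ⊗ x1) * omegaV ((h2 *H g2) ⊗ x2 ⊗ y) =
  \sw_(h1, h2 <- h) \sw_(g1, g2, g3 <- g) \sw_(x1, x2, x3 <- x) \sw_(y1, y2, y3 <- y)
    omegaV (h1 ⊗ (g1 *H x1) ⊗ y1) * omegaV (g2 ⊗ x2 ⊗ y2) * omega (h2 ⊗ g3 ⊗ (x3 *H y3)).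
Proof.
transitivity (conv4 (form_e w) (form_b v) h g x y); first by rewrite /=; sweedler [:: h; g; x; y].
by rewrite pentagon_eb /=; sweedler [:: h; g; x; y]; rewrite !mulrA.
Qed.

Lemma omega_ac h g x y :
  \sw_(g1, g2 <- g) \sw_(x1, x2 <- x) \sw_(y1, y2 <- y)
    omegaV (h ⊗ g1 ⊗ (x1 *H y1)) * omega (g2 ⊗ x2 ⊗ y2) =
  \sw_(h1, h2, h3 <- h) \sw_(g1, g2, g3 <- g) \sw_(x1, x2, x3 <- x) \sw_(y1, y2 <- y)
    omega ((h1 *H g1) ⊗ x1 ⊗ y1) * omegaV (h2 ⊗ g2 ⊗ x2) * omegaV (h3 ⊗ (g3 *H x3) ⊗ y2).
Proof.
transitivity (conv4 (form_a v) (form_c w) h g x y); first by rewrite /=; sweedler [:: h; g; x; y].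
by rewrite pentagon_ac /=; sweedler [:: h; g; x; y]; rewrite !mulrA.
Qed.

(** Convolving the associativity law of H with [omegaV] on both sides cancels [omega] and leaves one
    [omegaV] on either side. *)
Lemma hmulAV h g x :
  \sw_(h1, h2 <- h) \sw_(g1, g2 <- g) \sw_(x1, x2 <- x)
      omegaV (h1 ⊗ g1 ⊗ x1) *: (h2 *H (g2 *H x2)) =
  \sw_(h1, h2 <- h) \sw_(g1, g2 <- g) \sw_(x1, x2 <- x)
      omegaV (h2 ⊗ g2 ⊗ x2) *: ((h1 *H g1) *H x1).
Proof.
pose T h g x := \sw_(h1, h2 <- h) \sw_(g1, g2 <- g) \sw_(x1, x2 <- x)
  omega (h2 ⊗ g2 ⊗ x2) *: (h1 *H (g1 *H x1)).
pose T' h g x := \sw_(h1, h2 <- h) \sw_(g1, g2 <- g) \sw_(x1, x2 <- x)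
  omega (h1 ⊗ g1 ⊗ x1) *: ((h2 *H g2) *H x2).
transitivity (\sw_(h1, h2, h3 <- h) \sw_(g1, g2, g3 <- g) \sw_(x1, x2, x3 <- x)
  (omegaV (h1 ⊗ g1 ⊗ x1) * omegaV (h3 ⊗ g3 ⊗ x3)) *: T h2 g2 x2).
  transitivity (\sw_(h1, h2, h3 <- h) \sw_(g1, g2, g3 <- g) \sw_(x1, x2, x3 <- x)
    (\sw_(h4, h5 <- h3) \sw_(g4, g5 <- g3) \sw_(x4, x5 <- x3)
       omega (h4 ⊗ g4 ⊗ x4) * omegaV (h5 ⊗ g5 ⊗ x5)) *:
    (omegaV (h1 ⊗ g1 ⊗ x1) *: (h2 *H (g2 *H x2)))).
    transitivity (\sw_(h1, h2, h3 <- h) \sw_(g1, g2, g3 <- g) \sw_(x1, x2, x3 <- x)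
      (counit h3 * counit g3 * counit x3) *:
      (omegaV (h1 ⊗ g1 ⊗ x1) *: (h2 *H (g2 *H x2)))); first by sweedler [:: h; g; x].
    by do 6 (apply: eq_tsum => ? ?); rewrite omegaK.
  rewrite /T; sweedler [:: h; g; x].
  by rewrite !scalerA; congr (_ *: _); rewrite mulrC mulrA mulrAC.
transitivity (\sw_(h1, h2, h3 <- h) \sw_(g1, g2, g3 <- g) \sw_(x1, x2, x3 <- x)
  (omegaV (h1 ⊗ g1 ⊗ x1) * omegaV (h3 ⊗ g3 ⊗ x3)) *: T' h2 g2 x2).
  by do 6 (apply: eq_tsum => ? ?); congr (_ *: _); exact: hmulA.
transitivity (\sw_(h1, h2, h3 <- h) \sw_(g1, g2, g3 <- g) \sw_(x1, x2, x3 <- x)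
  (\sw_(h4, h5 <- h1) \sw_(g4, g5 <- g1) \sw_(x4, x5 <- x1)
       omegaV (h4 ⊗ g4 ⊗ x4) * omega (h5 ⊗ g5 ⊗ x5)) *:
    (omegaV (h3 ⊗ g3 ⊗ x3) *: ((h2 *H g2) *H x2))).
  rewrite /T'; sweedler [:: h; g; x].
  by rewrite !scalerA; congr (_ *: _); rewrite mulrAC.
transitivity (\sw_(h1, h2, h3 <- h) \sw_(g1, g2, g3 <- g) \sw_(x1, x2, x3 <- x)
  (counit h1 * counit g1 * counit x1) *:
    (omegaV (h3 ⊗ g3 ⊗ x3) *: ((h2 *H g2) *H x2))).
  by do 6 (apply: eq_tsum => ? ?); rewrite omegaVK.
by sweedler [:: h; g; x].
Qed.

End CoquasiBialgebraTheory.

(** * Coquasi-Hopf algebras *)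

Ltac sw_simp_one ::= rewrite ?counit1 ?omega1 ?omega1l ?omega1r ?omegaV1
  ?omegaV1l ?omegaV1r ?hmul1l ?hmul1r ?qalpha1 ?qbeta1.

Section TensorScale.
Variables (k : fieldType) (U V : lmodType k).

Lemma tpairZl c (u : U) (v : V) : (c *: u) ⊗ v = c *: (u ⊗ v).
Proof. exact: (linZ ((tpair_bil U V).1 v)). Qed.

Lemma tpairZr (u : U) c (v : V) : u ⊗ (c *: v) = c *: (u ⊗ v).
Proof. exact: (linZ ((tpair_bil U V).2 u)). Qed.

End TensorScale.

Lemma dualZ (k : fieldType) (U : lmodType k) (f : 'Dual(U)) c u : f (c *: u) = c * f u.
Proof. exact: linearZ. Qed.

Lemma linfZ (k : fieldType) (U V : lmodType k) (f : 'Lin(U, V)) c u : f (c *: u) = c *: f u.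
Proof. exact: linearZ. Qed.

Ltac pull_scalars :=
  repeat match goal with
  | |- context [tpair (?c *: ?u) ?v] => rewrite (tpairZl c u v)
  | |- context [tpair ?u (?c *: ?v)] => rewrite (tpairZr u c v)
  | |- context [?f (?c *: ?u)] =>
    lazymatch f with
    | _ ?F => first [rewrite (linfZ F c u) | rewrite (dualZ F c u)]
    end
  end; rewrite ?scalerA.

Section CoquasiHopfTheory.
Variables (k : fieldType) (H : coquasi_hopf k).
Implicit Types h x y : H.

(** The antipode law in a linear context [L], for use inside an argument of [omega] or [omegaV]. *)
Lemma sw_alpha (W : lmodType k) (L : H -> W) h : lin L ->
  \sw_(h1, h2, h3 <- h) qalpha h2 *: L (antipode h1 *H h3) = qalpha h *: L hone.
Proof.
move=> LL; suff E (L' : 'Lin(H, W)) : \sw_(h1, h2, h3 <- h)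
  qalpha h2 *: L' (antipode h1 *H h3) = qalpha h *: L' hone by exact: (E (mklin LL)).
by rewrite -linearZ -antipode_alpha; sweedler [:: h]; rewrite linfZ.
Qed.

Lemma sw_beta (W : lmodType k) (L : H -> W) h : lin L ->
  \sw_(h1, h2, h3 <- h) qbeta h2 *: L (h1 *H antipode h3) = qbeta h *: L hone.
Proof.
move=> LL; suff E (L' : 'Lin(H, W)) : \sw_(h1, h2, h3 <- h)
  qbeta h2 *: L' (h1 *H antipode h3) = qbeta h *: L' hone by exact: (E (mklin LL)).
by rewrite -linearZ -antipode_beta; sweedler [:: h]; rewrite linfZ.
Qed.

Lemma sw_alpha_scal (L : H -> k) h : @lin k H k^o L ->
  \sw_(h1, h2, h3 <- h) qalpha h2 * L (antipode h1 *H h3) = qalpha h * L hone.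
Proof. exact: (@sw_alpha k^o). Qed.

Lemma sw_beta_scal (L : H -> k) h : @lin k H k^o L ->
  \sw_(h1, h2, h3 <- h) qbeta h2 * L (h1 *H antipode h3) = qbeta h * L hone.
Proof. exact: (@sw_beta k^o). Qed.

Lemma omega_antipode_scal h :
  \sw_(h1, h2, h3, h4, h5 <- h) (qbeta h2 * qalpha h4) * omega (h1 ⊗ antipode h3 ⊗ h5) =
  counit h.
Proof.
rewrite -omega_antipode; sweedler [:: h].
by pull_scalars; ring.
Qed.

Lemma omegaV_antipode_scal h :
  \sw_(h1, h2, h3, h4, h5 <- h)
    (qalpha h2 * qbeta h4) * omegaV (antipode h1 ⊗ h3 ⊗ antipode h5) = counit h.
Proof.
rewrite -omegaV_antipode; sweedler [:: h].
by pull_scalars; ring.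
Qed.

(** The pentagon makes the products S(c) q and p S(c) arguments of [omegaV] and [omega]. The laws of
    α and β turn them into 1, and the factor left over is the axiom on ω(y_1, S(y_3), y_5). *)
Lemma omega_galois x y :
  \sw_(p, b, c, a, q <- y) (qbeta b * qalpha a) *
    (\sw_(x1, x2 <- x) \sw_(p1, p2 <- p) \sw_(z1, z2 <- antipode c)
      omega ((x1 *H p1) ⊗ z1 ⊗ q) * omegaV (x2 ⊗ p2 ⊗ z2)) =
  counit x * counit y.
Proof.
transitivity (\sw_(p, b, c, a, q <- y) (qbeta b * qalpha a) *
  (\sw_(x1, x2 <- x) \sw_(g1, g2, g3 <- p) \sw_(z1, z2, z3 <- antipode c)
   \sw_(q1, q2, q3 <- q) omegaV (x1 ⊗ g1 ⊗ (z1 *H q1)) * omega (g2 ⊗ z2 ⊗ q2) *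
       omega (x2 ⊗ (g3 *H z3) ⊗ q3))).
  by do 4 (apply: eq_tsum => ? ?); rewrite omega_be.
transitivity (\sw_(p, b, c, a, q <- y) \sw_(x1, x2 <- x) \sw_(p1, p2 <- p)
  \sw_(q1, q2 <- q) \sw_(b1, b2, b3 <- b) qbeta b2 * (\sw_(a1, a2, a3 <- a) qalpha a2 *
  (omegaV (x1 ⊗ p1 ⊗ (antipode a1 *H a3)) * omega (p2 ⊗ antipode c ⊗ q1) *
   omega (x2 ⊗ (b1 *H antipode b3) ⊗ q2)))).
  by sweedler [:: y; x]; ring.
transitivity (\sw_(p, b, c, a, q <- y) \sw_(x1, x2 <- x) \sw_(p1, p2 <- p)
  \sw_(q1, q2 <- q) qbeta b * (qalpha a *
  (omegaV (x1 ⊗ p1 ⊗ hone) * omega (p2 ⊗ antipode c ⊗ q1) * omega (x2 ⊗ hone ⊗ q2)))).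
  do 7 (apply: eq_tsum => ? ?).
  rewrite (@sw_beta_scal (fun z => \sw_(a1, a2, a3 <- _) qalpha a2 *
     (_ * _ * omega (_ ⊗ z ⊗ _)))); last by slin.
  rewrite (@sw_alpha_scal (fun z => omegaV (_ ⊗ _ ⊗ z) * _ * _)) //; by slin.
by rewrite -(omega_antipode_scal y); sweedler [:: y; x]; ring.
Qed.

(** Dual to [omega_galois]: the products S(c) d and d S(e) collapse, and the axiom on ω^-1(S(y_1),
    y_3, S(y_5)) is left. *)
Lemma omega_cleft x y :
  \sw_(c, a, d, b, e <- y) (qalpha a * qbeta b) *
    (\sw_(x1, x2 <- x) \sw_(z1, z2 <- antipode c) \sw_(d1, d2 <- d)
      omega (x1 ⊗ z1 ⊗ d1) * omegaV ((x2 *H z2) ⊗ d2 ⊗ antipode e)) =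
  counit x * counit y.
Proof.
transitivity (\sw_(c, a, d, b, e <- y) (qalpha a * qbeta b) *
  (\sw_(h1, h2 <- x) \sw_(g1, g2, g3 <- antipode c) \sw_(x1, x2, x3 <- d)
   \sw_(y1, y2, y3 <- antipode e)
    omegaV (h1 ⊗ (g1 *H x1) ⊗ y1) * omegaV (g2 ⊗ x2 ⊗ y2) * omega (h2 ⊗ g3 ⊗ (x3 *H y3)))).
  by do 4 (apply: eq_tsum => ? ?); rewrite omega_eb.
transitivity (\sw_(c, a, d, b, e <- y) \sw_(x1, x2 <- x) \sw_(c1, c2 <- c)
  \sw_(e1, e2 <- e) \sw_(b1, b2, b3 <- b) qbeta b2 * (\sw_(a1, a2, a3 <- a) qalpha a2 *
  (omegaV (x1 ⊗ (antipode a1 *H a3) ⊗ antipode e2) *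
   omegaV (antipode c2 ⊗ d ⊗ antipode e1) *
   omega (x2 ⊗ antipode c1 ⊗ (b1 *H antipode b3))))).
  by sweedler [:: y; x]; ring.
transitivity (\sw_(c, a, d, b, e <- y) \sw_(x1, x2 <- x) \sw_(c1, c2 <- c)
  \sw_(e1, e2 <- e) qbeta b * (qalpha a *
  (omegaV (x1 ⊗ hone ⊗ antipode e2) * omegaV (antipode c2 ⊗ d ⊗ antipode e1) *
   omega (x2 ⊗ antipode c1 ⊗ hone)))).
  do 7 (apply: eq_tsum => ? ?).
  rewrite (@sw_beta_scal (fun z => \sw_(a1, a2, a3 <- _) qalpha a2 *
     (_ * _ * omega (_ ⊗ _ ⊗ z)))); last by slin.
  rewrite (@sw_alpha_scal (fun z => omegaV (_ ⊗ z ⊗ _) * _ * _)) //; by slin.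
by rewrite -(omegaV_antipode_scal y); sweedler [:: y; x]; ring.
Qed.

(** The pentagon yields a factor ω(S(c) d, x, y), trivial once the law of α has turned S(c) d into
    1. *)
Lemma omegaV_eval h x y :
  \sw_(c, a, d <- h) qalpha a *
    (\sw_(d1, d2 <- d) \sw_(x1, x2 <- x) \sw_(y1, y2 <- y)
      omegaV (antipode c ⊗ d1 ⊗ (x1 *H y1)) * omega (d2 ⊗ x2 ⊗ y2)) =
  \sw_(h1, h2, h3, h4, h5 <- h) \sw_(x1, x2 <- x)
    qalpha h3 * omegaV (antipode h2 ⊗ h4 ⊗ x1) * omegaV (antipode h1 ⊗ (h5 *H x2) ⊗ y).
Proof.
transitivity (\sw_(c, a, d <- h) qalpha a *
  (\sw_(h1, h2, h3 <- antipode c) \sw_(g1, g2, g3 <- d) \sw_(x1, x2, x3 <- x) \sw_(y1, y2 <- y)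
    omega ((h1 *H g1) ⊗ x1 ⊗ y1) * omegaV (h2 ⊗ g2 ⊗ x2) * omegaV (h3 ⊗ (g3 *H x3) ⊗ y2))).
  by do 2 (apply: eq_tsum => ? ?); rewrite omega_ac.
transitivity (\sw_(c, a, d <- h) \sw_(c1, c2 <- c) \sw_(d1, d2 <- d)
  \sw_(x1, x2, x3 <- x) \sw_(y1, y2 <- y) \sw_(a1, a2, a3 <- a) qalpha a2 *
  (omega ((antipode a1 *H a3) ⊗ x1 ⊗ y1) *
   omegaV (antipode c2 ⊗ d1 ⊗ x2) * omegaV (antipode c1 ⊗ (d2 *H x3) ⊗ y2))).
  by sweedler [:: h; x; y]; ring.
transitivity (\sw_(c, a, d <- h) \sw_(c1, c2 <- c) \sw_(d1, d2 <- d)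
  \sw_(x1, x2, x3 <- x) \sw_(y1, y2 <- y) qalpha a *
  (omega (hone ⊗ x1 ⊗ y1) *
   omegaV (antipode c2 ⊗ d1 ⊗ x2) * omegaV (antipode c1 ⊗ (d2 *H x3) ⊗ y2))).
  do 7 (apply: eq_tsum => ? ?).
  rewrite (@sw_alpha_scal (fun z => omega (z ⊗ _ ⊗ _) * _ * _)) //; by slin.
by sweedler [:: h; x; y]; ring.
Qed.

End CoquasiHopfTheory.

(** * From a left inverse of gamma to the structure theorems *)

Lemma linf_tsum (k : fieldType) (U V W W' : lmodType k) (f : 'Lin(W, W')) (t : U ⊗ V)
    (F : U -> V -> W) : f (tsum t F) = tsum t (fun u v => f (F u v)).
Proof. by rewrite (lin_tsum _ _ (lin_app f (@lin_id _ _))). Qed.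

Section AdjunctionCounit.
Variables (k : fieldType) (H : coquasi_hopf k) (A : comodule_algebra H).

Lemma adj_counit_colinear (M : hopf_module A) :
  colinear (M := induced (coinv_rmod M)) (M' := M) (adj_counit M).
Proof.
move=> t; move: t; apply: btens_ext; [lin|lin|] => n a.
rewrite blinE coact_hactl ?(valP n) // coact_indE /ind_coact0 tsum_bil_pair; last by lin.
by apply: eq_tsum => a0 a1; rewrite tsum_pair ?blinE //; lin.
Qed.

Lemma adj_counit_act (M : hopf_module A) (t : induced (coinv_rmod M)) a :
  adj_counit M (t *M a) = adj_counit M t *M a.
Proof.
move: t; apply: btens_ext; [lin|lin|] => n c.
by rewrite ind_actE !blinE hactAl ?(valP n).
Qed.

Definition adj_counit_hom (M : hopf_module A) : hopf_hom (induced (coinv_rmod M)) M :=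
  HopfHom (@adj_counit_colinear M) (@adj_counit_act M).

Lemma adj_counit_natural (M M' : hopf_module A) (f : hopf_hom M M') t :
  adj_counit M' (ind_map (coinv_map f) t) = f (adj_counit M t).
Proof.
move: t; apply: btens_ext; [lin|lin|] => n a.
apply: etrans (congr1 (adj_counit M') (ind_mapE (coinv_map f) n a)) _.
apply: etrans (blinE _ _ _ _) (esym _).
by apply: etrans (congr1 f (blinE _ _ _ _)) _; exact: hhom_act.
Qed.

End AdjunctionCounit.

(** * The projection of a Hopf module onto its coinvariants *)

Section Projection.
Variables (k : fieldType) (H : coquasi_hopf k) (A : comodule_algebra H).
Variable delta : 'Lin(H, A).
Hypothesis delta_coact : forall h,
  coact (delta h) = \sw_(h1, h2 <- h) (delta h2 ⊗ antipode h1).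

Section HopfModule.
Variable M : hopf_module A.

Fact proj_subproof : lin (fun m : M =>
  \rho_(m0, m1 <- m) \sw_(h1, h2 <- m1) qbeta h1 *: (m0 *M delta h2)).
Proof. by slin. Qed.

Definition proj : 'Lin(M, M) := mklin proj_subproof.

Lemma projE m : proj m = \rho_(m0, m1 <- m) \sw_(h1, h2 <- m1) qbeta h1 *: (m0 *M delta h2).
Proof. by []. Qed.

(** The coalgebra part of the coaction is m_1 β(m_2) S(m_3), which the law of β collapses to 1. *)
Lemma coact_proj m : coact (proj m) = proj m ⊗ hone.
Proof.
rewrite projE.
transitivity (\rho_(m0, m1 <- m) \sw_(h1, h2 <- m1) qbeta h1 *: coact (m0 *M delta h2)).
  by sweedler (m, tt); pull_scalars.
transitivity (\rho_(m0, m1 <- m) \sw_(b, d <- m1) \sw_(b1, b2, b3 <- b)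
    qbeta b2 *: ((m0 *M delta d) ⊗ (b1 *H antipode b3))).
  transitivity (\rho_(m0, m1 <- m) \sw_(h1, h2 <- m1) qbeta h1 *:
    \rho_(m2, m3 <- m0) \rho_(d0, d1 <- delta h2) ((m2 *M d0) ⊗ (m3 *H d1))).
    by do 2 (apply: eq_tsum => ? ?); rewrite coact_hact.
  by sweedler (m, tt).
transitivity (\rho_(m0, m1 <- m) \sw_(b, d <- m1)
    qbeta b *: ((m0 *M delta d) ⊗ (hone : H))).
  by do 2 (apply: eq_tsum => ? ?); rewrite (@sw_beta _ _ _ (fun z => _ ⊗ z)) //; lin.
by sweedler (m, tt); pull_scalars.
Qed.

Lemma proj_coinv m : proj m \in coinv_pred M.
Proof. by apply/coinv_predP; exact: coact_proj. Qed.

Lemma projM_coinv m a : m \in coinv_pred M -> proj (m *M a) =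
  m *M \rho_(a0, a1 <- a) \sw_(h1, h2 <- a1) qbeta h1 *: (a0 *A delta h2).
Proof.
move=> mP; rewrite projE coact_hactl //.
by sweedler (a, tt); pull_scalars; rewrite hactAl.
Qed.

End HopfModule.

Variable gamma : 'Lin(H, A).
Hypothesis gamma_colinear : colinear (M := com_reg H) (M' := A) gamma.
Hypothesis delta_gamma : forall h,
  \sw_(h1, h2 <- h) (delta h1 *A gamma h2) = qalpha h *: caone.

Lemma proj_gamma (M : hopf_module A) (m : M) :
  \rho_(m0, m1 <- m) (proj M m0 *M gamma m1) = m.
Proof.
have gammaE h : coact (gamma h) = \sw_(h1, h2 <- h) (gamma h1 ⊗ h2).
  exact: gamma_colinear.
transitivity (\rho_(m0, m1 <- m) \sw_(b, d, c <- m1)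
   qbeta b *: ((m0 *M delta d) *M gamma c)).
  by under eq_tsum => m0 m1 do rewrite projE; sweedler (m, tt); pull_scalars.
(* Rebracketing yields β(m_2) ω(m_1, S(m_3), m_5), and the product of δ and γ supplies α(m_4): this
   is the sum in [omega_antipode]. *)
transitivity (\rho_(m0, m1 <- m) \sw_(u, b, c, d, e <- m1)
   (qbeta b * omega (u ⊗ antipode c ⊗ e)) *: (m0 *M (\sw_(d1, d2 <- d) delta d1 *A gamma d2))).
  transitivity (\rho_(m0, m1 <- m) \sw_(b, d, c <- m1) qbeta b *:
    \rho_(m2, m3 <- m0) \rho_(d0, d1 <- delta d) \rho_(c0, c1 <- gamma c)
      omega (m3 ⊗ d1 ⊗ c1) *: (m2 *M (d0 *A c0))).
    by do 3 (apply: eq_tsum => ? ?); rewrite hactA.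
  by sweedler (m, tt); rewrite scalerA.
transitivity (\rho_(m0, m1 <- m) (\sw_(h1, h2, h3, h4, h5 <- m1)
    (qbeta h2 * qalpha h4) * omega (h1 ⊗ antipode h3 ⊗ h5)) *: m0).
  transitivity (\rho_(m0, m1 <- m) \sw_(u, b, c, d, e <- m1)
   (qbeta b * omega (u ⊗ antipode c ⊗ e)) *: (m0 *M (qalpha d *: (caone : A)))).
    by do 5 (apply: eq_tsum => ? ?); rewrite delta_gamma.
  by sweedler (m, tt); pull_scalars; rewrite hact1; congr (_ *: _); ring.
by under eq_tsum => m0 m1 do rewrite omega_antipode_scal; exact: coact_counit.
Qed.

End Projection.

Section LeftInverse.
Variables (k : fieldType) (H : coquasi_hopf k) (A : comodule_algebra H).
Variables (gamma delta : 'Lin(H, A)).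
Hypothesis gamma_colinear : colinear (M := com_reg H) (M' := A) gamma.
Hypothesis delta_coact : forall h,
  coact (delta h) = \sw_(h1, h2 <- h) (delta h2 ⊗ antipode h1).
Hypothesis delta_gamma : forall h,
  \sw_(h1, h2 <- h) (delta h1 *A gamma h2) = qalpha h *: caone.

Let gammaE h : coact (gamma h) = \sw_(h1, h2 <- h) (gamma h1 ⊗ h2).
Proof. exact: gamma_colinear. Qed.

Fact projc_subproof (M : hopf_module A) : lin (fun m : M => Coinv (proj_coinv delta_coact m)).
Proof. by apply: lin_Coinv; lin. Qed.

Definition projc (M : hopf_module A) : 'Lin(M, coinv M) := mklin (projc_subproof M).

Definition projB : 'Lin(A, coinv_alg A) := mklin (projc_subproof (ca_hopf A)).

Lemma projB_gamma (a : A) : \rho_(a0, a1 <- a) (coinv_val (projB a0) *A gamma a1) = a.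
Proof. exact: (@proj_gamma _ _ _ _ delta_coact _ gamma_colinear delta_gamma (ca_hopf A)). Qed.

Lemma projc_act (M : hopf_module A) (n : coinv_rmod M) (a : A) :
  projc M (coinv_val n *M a) = ract (coinv_rmod M) (n ⊗ projB a).
Proof.
apply: coinv_inj; rewrite tlinE /=; exact: (projM_coinv delta a (valP n)).
Qed.

Lemma projB_mul (b : coinv_alg A) (a : A) :
  projB (coinv_val b *A a) = alg_mul (coinv_alg A) (b ⊗ projB a).
Proof.
apply: coinv_inj; rewrite tlinE /=; exact: (@projM_coinv _ _ _ delta (ca_hopf A) _ a (valP b)).
Qed.

Lemma left_inverse_weak_structure : weak_structure_theorem A.
Proof.
move=> M.
pose g (m : M) : btens (coinv_rmod M) (ca_left A) :=
  \rho_(m0, m1 <- m) bpair (projc M m0 : coinv_rmod M) (gamma m1 : ca_left A).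
have pgL : bil (fun m h => bpair (projc M m : coinv_rmod M) (gamma h : ca_left A)).
  by slin.
have gL : lin g by rewrite /g; lin.
exists g => [t|m].
  move: t; apply: btens_ext => [||n a]; [|exact: lin_id|].
    by split=> a x y; rewrite linearP (linE gL).
  rewrite /adj_counit blinE /g coact_hactl ?(valP n) //.
  rewrite tsum_bil_pair //.
  (* Since π(n a_0) = n π(a_0) with π(a_0) in [B], the factor π(a_0) crosses the balanced tensor
     sign and recombines with γ(a_1) to a. *)
  transitivity (\rho_(a0, a1 <- a) bpair n (coinv_val (projB a0) *A gamma a1 : ca_left A)).
    apply: eq_tsum => a0 a1; rewrite tsum_pair // projc_act.
    exact: bpair_move.
  by rewrite -(lin_tsum _ _ (bpairr_lin n)) projB_gamma.
rewrite /g linf_tsum.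
rewrite -[RHS](proj_gamma delta_coact gamma_colinear delta_gamma).
by apply: eq_tsum => m0 m1; rewrite /adj_counit blinE.
Qed.

Lemma gamma1_coinv : gamma hone \in coinv_pred A.
Proof. by apply/coinv_predP; rewrite gammaE sw2_1 //; lin. Qed.

Definition gamma1 : coinv_alg A := Coinv gamma1_coinv.

Section Unit.
Variable N : rmodule (coinv_alg A).

Fact theta_bil : @bil k N (ca_left A) _ (fun n a => ract N (n ⊗ projB a)).
Proof. by lin. Qed.

Fact theta_bal : @balanced k _ N (ca_left A) _ (fun n a => ract N (n ⊗ projB a)).
Proof. by move=> n b a; rewrite tlinE projB_mul ractA. Qed.

Definition theta : 'Lin(induced N, N) := blin theta_bil theta_bal.

Lemma thetaE n a : theta (bpair n a) = ract N (n ⊗ projB a).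
Proof. exact: blinE. Qed.

Lemma theta_gamma (t : induced N) :
  \rho_(t0, t1 <- t) bpair (theta t0) (gamma t1 : ca_left A) = t.
Proof.
have tB : bil (fun t h => bpair (theta t) (gamma h : ca_left A)) by slin.
move: t; apply: btens_ext; [|exact: lin_id|] => [|n a]; first by lin.
rewrite coact_indE /ind_coact0 tsum_bil_pair //.
transitivity (\rho_(a0, a1 <- a) bpair n (coinv_val (projB a0) *A gamma a1 : ca_left A)).
  by apply: eq_tsum => a0 a1; rewrite tsum_pair // thetaE; exact: bpair_move.
by rewrite -(lin_tsum _ _ (bpairr_lin n)) projB_gamma.
Qed.

Fact unit_coinv (n : N) : (bpair n (caone : ca_left A) : induced N) \in coinv_pred (induced N).
Proof.
apply/coinv_predP; rewrite coact_indE /ind_coact0 coact_caone tsum_pair //.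
by slin.
Qed.

Definition unit_fun (n : N) : coinv_rmod (induced N) := Coinv (unit_coinv n).

Lemma unit_lin : lin unit_fun.
Proof. by apply: lin_Coinv; exact: (bpair_bil N (ca_left A)).1. Qed.

Lemma unit_act n b : mklin unit_lin (ract N (n ⊗ b)) =
  ract (coinv_rmod (induced N)) (mklin unit_lin n ⊗ b).
Proof.
apply: coinv_inj; rewrite tlinE /= bpair_move.
by rewrite camul1r; apply: esym; apply: etrans (ind_actE _ _ _) _; rewrite camul1l.
Qed.

Definition unit_hom : rmod_hom N (coinv_rmod (induced N)) := RModHom unit_act.

(** [theta] alone does not invert the unit: θ(n ⊗ 1) = n δ(1), and δ(1) need not be 1. The
    coinvariant γ(1) corrects this because δ(1) γ(1) = α(1) 1 = 1. Conversely, for coinvariant t,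
    [theta_gamma] reads θ(t) ⊗ γ(1) = t. *)
Definition unit_inv (t : coinv_rmod (induced N)) : N :=
  ract N (theta (coinv_val t) ⊗ gamma1).

Lemma unit_inv_lin : lin unit_inv.
Proof. by rewrite /unit_inv; have vL := coinv_lin (induced N); lin. Qed.

Lemma delta_gamma1 : delta hone *A gamma hone = caone.
Proof. by have := delta_gamma hone; rewrite sw2_1 ?qalpha1 ?scale1r //; lin. Qed.

Lemma unitK n : unit_inv (unit_hom n) = n.
Proof.
rewrite /unit_inv (_ : theta _ = ract N (n ⊗ projB caone)); last exact: thetaE.
rewrite -ractA.
suff -> : alg_mul (coinv_alg A) (projB caone ⊗ gamma1) = alg_one (coinv_alg A) by exact: ract1.
apply: coinv_inj; rewrite tlinE /= -[RHS]delta_gamma1; congr (camul _ (_ ⊗ _)).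
rewrite coact_caone tsum_pair; last by slin.
by rewrite sw2_1 ?qbeta1 ?scale1r; [exact: camul1l | lin].
Qed.

Lemma unit_invK t : unit_hom (unit_inv t) = t.
Proof.
apply: coinv_inj; rewrite /= bpair_move camul1r.
have tB : bil (fun t h => bpair (theta t) (gamma h : ca_left A)) by slin.
by rewrite -[RHS]theta_gamma coinvP tsum_pair.
Qed.

Lemma unit_inv_act t b : mklin unit_inv_lin (ract (coinv_rmod (induced N)) (t ⊗ b)) =
  ract N (mklin unit_inv_lin t ⊗ b).
Proof.
rewrite /= -{1}[t]unit_invK.
exact: etrans (congr1 unit_inv (esym (rhom_act unit_hom _ _))) (unitK _).
Qed.

Definition unit_inv_hom : rmod_hom (coinv_rmod (induced N)) N := RModHom unit_inv_act.

End Unit.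

Lemma hopf_hom_bij_iso (M M' : hopf_module A) (f : hopf_hom M M') :
  bijective f -> @is_iso (cat_hopf A) M M' f.
Proof.
case=> g fK gK.
have gL : lin g by split=> a x y; apply: (can_inj fK); rewrite linearP !gK.
have gC : colinear (mklin gL).
  move=> m; rewrite /= -{2}[m]gK hhom_colinear tsum_bil_pair; last first.
    by have gL' := lin_app (mklin gL) (@lin_id _ _); split; slin.
  rewrite -[LHS]tsum_id; apply: eq_tsum => x0 x1; rewrite tsum_pair /= ?fK //.
  by have gL' := lin_app (mklin gL) (@lin_id _ _); split; slin.
have gA m a : mklin gL (m *M a) = mklin gL m *M a.
  by apply: (can_inj fK); rewrite /= hhom_act !gK.
exists (HopfHom gC gA); split; apply: hopf_hom_ext => x /=; [exact: fK|exact: gK].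
Qed.

Lemma left_inverse_strong_structure : strong_structure_theorem A.
Proof.
split.
  exists unit_inv_hom; split=> [N N' f|N].
    apply: rmod_hom_ext => t; rewrite /= /unit_inv rhom_act; congr (ract N' (_ ⊗ _)).
    have thetaN (u : induced N) :
        theta N' (ind_map (f : rmod_hom N N') u) = (f : rmod_hom N N') (theta N u).
      move: u; apply: btens_ext; [lin|lin|] => n a.
      by rewrite ind_mapE !thetaE rhom_act.
    exact: thetaN.
  by exists (unit_hom N); split; apply: rmod_hom_ext => x /=; [exact: unit_invK|exact: unitK].
exists (@adj_counit_hom k H A); split=> [M M' f|M].
  by apply: hopf_hom_ext => t; exact: adj_counit_natural.
by apply: hopf_hom_bij_iso; exact: left_inverse_weak_structure.
Qed.

End LeftInverse.

(** * Normal basis and Galois property of a cleft extension *)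

Section Cleft.
Variables (k : fieldType) (H : coquasi_hopf k) (A : comodule_algebra H).
Variables (gamma delta : 'Lin(H, A)).
Hypothesis gamma_colinear : colinear (M := com_reg H) (M' := A) gamma.
Hypothesis delta_coact : forall h,
  coact (delta h) = \sw_(h1, h2 <- h) (delta h2 ⊗ antipode h1).
Hypothesis delta_gamma : forall h,
  \sw_(h1, h2 <- h) (delta h1 *A gamma h2) = qalpha h *: caone.

Let gammaE h : coact (gamma h) = \sw_(h1, h2 <- h) (gamma h1 ⊗ h2).
Proof. exact: gamma_colinear. Qed.

Local Notation projB := (projB delta_coact).

(** The hypothesis says that π(γ(h)) = ε(h) 1, so a |-> π(a_0) ⊗ a_1 sends b γ(h) back to b ⊗ h; the
    other composite is [projB_gamma]. *)
Lemma cleft_normal_basis :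
  (forall h, \sw_(h1, h2, h3 <- h) qbeta h2 *: (gamma h1 *A delta h3) = counit h *: caone) ->
  normal_basis A.
Proof.
move=> gamma_delta.
have projB_gammaE h : projB (gamma h) = counit h *: alg_one (coinv_alg A).
  apply: coinv_inj; rewrite (linZ (coinv_lin A)) /= -gamma_delta.
  change (proj delta (ca_hopf A) (gamma h) = \sw_(h1, h2, h3 <- h) qbeta h2 *: (gamma h1 *A delta h3)).
  by rewrite projE; sweedler [:: h].
have vL := coinv_lin A.
have fL : lin (fun a : A => \rho_(a0, a1 <- a) (projB a0 ⊗ a1)).
  by lin.
have gB : bil (fun (b : coinv_alg A) h => coinv_val b *A gamma h) by lin.
have fE a : mklin fL a = \rho_(a0, a1 <- a) (projB a0 ⊗ a1) by [].
exists (mklin fL); split.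
- exists (tlin gB) => [a|t].
    rewrite fE linf_tsum.
    by under eq_tsum do rewrite tlinE; exact: projB_gamma.
  move: t; apply: tens_ext; [lin|lin|] => b h; rewrite tlinE fE.
  rewrite (@coact_hactl _ _ _ (ca_hopf A)) ?(valP b) //.
  transitivity (\sw_(h1, h2 <- h) (projB (coinv_val b *A gamma h1) ⊗ h2)).
    by sweedler [:: h].
  under eq_sw2 => h1 h2 do rewrite projB_mul projB_gammaE.
  by sweedler [:: h]; pull_scalars; rewrite alg_mul1r.
- move=> b; suff: forall a : A, mklin fL (lact (ca_left A) (b ⊗ a)) =
      lact (lmod_free (coinv_alg A) H) (b ⊗ mklin fL a) by [].
  move=> a; rewrite !fE !tlinE /lmod_free_act0 (@coact_hactl _ _ _ (ca_hopf A)) ?(valP b) //.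
  transitivity (\rho_(a0, a1 <- a) (projB (coinv_val b *A a0) ⊗ a1)); first by sweedler (a, tt).
  under eq_tsum => a0 a1 do rewrite projB_mul.
  by sweedler (a, tt).
move=> a; transitivity (\rho_(a0, a1 <- a) \sw_(h1, h2 <- a1) ((projB a0 ⊗ h1) ⊗ h2)).
  rewrite fE linf_tsum; apply: eq_tsum => a0 a1; exact: tlinE.
under [RHS]eq_tsum => a0 a1 do rewrite fE.
by sweedler (a, tt).
Qed.

Let can_inv0 (a : A) (h : H) : btens (ca_right A) (ca_left A) :=
  \sw_(h1, h2 <- h) bpair (a *A delta h1 : ca_right A) (gamma h2 : ca_left A).

Let can_inv_bil : bil can_inv0.
Proof. by rewrite /can_inv0; slin. Qed.

(** Rebracketing (a δ) γ adds an [omega] to the [omegaV] of [can]; with the α that δγ leaves, the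
    coefficient is the sum in [omega_cleft]. *)
Let can_can_inv (a : A) (h : H) : can A (can_inv0 a h) = a ⊗ h.
Proof.
rewrite linf_tsum.
transitivity (\sw_(h1, h2 <- h) can0 (a *A delta h1) (gamma h2)).
  by apply: eq_tsum => h1 h2; exact: blinE.
transitivity (\rho_(a0, a1 <- a) \sw_(c, d1, d2, t <- h)
  \sw_(e1, e2, e3, e4 <- t) omegaV ((a1 *H antipode c) ⊗ (qbeta e2 *: e1) ⊗ antipode e3) *:
    (((a0 *A delta d1) *A gamma d2) ⊗ e4)).
  by rewrite /can0; sweedler (a, [:: h]).
transitivity (\rho_(a0, a1 <- a) \sw_(c, d1, d2, t <- h)
  \sw_(e1, e2, e3, e4 <- t) omegaV ((a1 *H antipode c) ⊗ (qbeta e2 *: e1) ⊗ antipode e3) *: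
    ((\rho_(a2, a3 <- a0) \rho_(x0, x1 <- delta d1) \rho_(y0, y1 <- gamma d2)
        omega (a3 ⊗ x1 ⊗ y1) *: (a2 *A (x0 *A y0))) ⊗ e4)).
  by do 7 (apply: eq_tsum => ? ?); rewrite camulA.
transitivity (\rho_(a0, a1 <- a) \sw_(h', l <- h) \sw_(c, d, e, b, f <- h')
   (qbeta b * \sw_(x1, x2 <- a1) \sw_(z1, z2 <- antipode c)
       \sw_(e1, e2 <- e) omega (x1 ⊗ z1 ⊗ e1) * omegaV ((x2 *H z2) ⊗ e2 ⊗ antipode f)) *:
      ((a0 *A (\sw_(d1, d2 <- d) (delta d1 *A gamma d2))) ⊗ l)).
  by sweedler (a, [:: h]); pull_scalars; congr (_ *: _); ring.
transitivity (\rho_(a0, a1 <- a) \sw_(h', l <- h) (\sw_(c, d, e, b, f <- h')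
   (qalpha d * qbeta b) * (\sw_(x1, x2 <- a1) \sw_(z1, z2 <- antipode c)
       \sw_(e1, e2 <- e) omega (x1 ⊗ z1 ⊗ e1) * omegaV ((x2 *H z2) ⊗ e2 ⊗ antipode f))) *:
      (a0 ⊗ l)).
  transitivity (\rho_(a0, a1 <- a) \sw_(h', l <- h) \sw_(c, d, e, b, f <- h')
   (qbeta b * \sw_(x1, x2 <- a1) \sw_(z1, z2 <- antipode c)
       \sw_(e1, e2 <- e) omega (x1 ⊗ z1 ⊗ e1) * omegaV ((x2 *H z2) ⊗ e2 ⊗ antipode f)) *:
      ((a0 *A (qalpha d *: (caone : A))) ⊗ l)).
    by do 6 (apply: eq_tsum => ? ?); rewrite delta_gamma.
  by sweedler (a, [:: h]); pull_scalars; rewrite camul1r; congr (_ *: _); ring.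
transitivity (\rho_(a0, a1 <- a) \sw_(h', l <- h) (counit a1 * counit h') *: (a0 ⊗ l)).
  by do 2 (apply: eq_tsum => ? ?); rewrite omega_cleft.
by sweedler (a, [:: h]).
Qed.

(** Rebracketing (a b) δ to a (b δ) cancels the [omegaV] of [can]. What is left is a π(b_0) ⊗
    γ(b_1), and π(b_0) moves to the right factor. *)
Let can_invK (a b : A) : tlin can_inv_bil (can0 a b) = bpair (a : ca_right A) (b : ca_left A).
Proof.
transitivity (\rho_(a0, a1 <- a) \rho_(b0, b1 <- b) \sw_(p, q, c, l1, l2 <- b1)
  omegaV (a1 ⊗ (qbeta q *: p) ⊗ antipode c) *:
  bpair ((a0 *A b0) *A delta l1 : ca_right A) (gamma l2 : ca_left A)).
  rewrite /can0 !linf_tsum.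
  transitivity (\rho_(a0, a1 <- a) \rho_(b0, b' <- b) \sw_(b1, b2, b3, b4 <- b')
    omegaV (a1 ⊗ (qbeta b2 *: b1) ⊗ antipode b3) *: can_inv0 (a0 *A b0) b4).
    apply: eq_tsum => a0 a1; rewrite linf_tsum; apply: eq_tsum => b0 b1.
    do 3 (rewrite linf_tsum; apply: eq_tsum => ? ?); by rewrite linfZ tlinE.
  by rewrite /can_inv0; sweedler (a, (b, tt)).
transitivity (\rho_(a0, a1 <- a) \rho_(b0, b1 <- b) \sw_(p, q, c, l1, l2 <- b1)
  omegaV (a1 ⊗ (qbeta q *: p) ⊗ antipode c) *:
  bpair (\rho_(a2, a3 <- a0) \rho_(b2, b3 <- b0) \rho_(d0, d1 <- delta l1)
    omega (a3 ⊗ b3 ⊗ d1) *: (a2 *A (b2 *A d0)) : ca_right A) (gamma l2 : ca_left A)).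
  by do 6 (apply: eq_tsum => ? ?); rewrite camulA.
transitivity (\rho_(a0, a1 <- a) \rho_(b0, b1 <- b) \sw_(p, q, c, l1, l2 <- b1)
  (qbeta q * \sw_(x1, x2 <- a1) \sw_(p1, p2 <- p) \sw_(z1, z2 <- antipode c)
     omega (x1 ⊗ p1 ⊗ z1) * omegaV (x2 ⊗ p2 ⊗ z2)) *:
  bpair (a0 *A (b0 *A delta l1) : ca_right A) (gamma l2 : ca_left A)).
  by sweedler (a, (b, tt)); pull_scalars; congr (_ *: _); ring.
transitivity (\rho_(b0, b1 <- b) \sw_(q, l1, l2 <- b1) qbeta q *:
  bpair (a *A (b0 *A delta l1) : ca_right A) (gamma l2 : ca_left A)).
  transitivity (\rho_(a0, a1 <- a) \rho_(b0, b1 <- b) \sw_(p, q, c, l1, l2 <- b1)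
    (qbeta q * (counit a1 * counit p * counit (antipode c))) *:
    bpair (a0 *A (b0 *A delta l1) : ca_right A) (gamma l2 : ca_left A)).
    by do 6 (apply: eq_tsum => ? ?); rewrite omegaK.
  by sweedler (a, (b, tt)).
transitivity (\rho_(b0, b1 <- b)
  bpair (a *A proj delta (ca_hopf A) b0 : ca_right A) (gamma b1 : ca_left A)).
  under [RHS]eq_tsum => b0 b1 do rewrite projE.
  by sweedler (b, tt); pull_scalars.
transitivity (\rho_(b0, b1 <- b)
  bpair (a : ca_right A) (coinv_val (projB b0) *A gamma b1 : ca_left A)).
  apply: eq_tsum => b0 b1; rewrite -bpair_move; congr bpair; exact/esym/tlinE.
rewrite -(lin_tsum _ _ (@bpairr_lin _ _ _ (ca_right A) a)).
by congr bpair; exact: projB_gamma.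
Qed.

Lemma cleft_galois : galois A.
Proof.
exists (tlin can_inv_bil) => t; move: t.
  apply: btens_ext; [lin|exact: lin_id|] => a b.
  by rewrite /can blinE; exact: can_invK.
apply: tens_ext; [lin|exact: lin_id|] => a h.
by rewrite tlinE; exact: can_can_inv.
Qed.

End Cleft.

(** * From the Galois property to a left inverse *)

Section NormalBasis.
Variables (k : fieldType) (H : coquasi_hopf k) (A : comodule_algebra H).

Lemma normal_basis_split : normal_basis A ->
  exists (gamma : 'Lin(H, A)) (p : 'Lin(A, coinv_alg A)),
  [/\ colinear (M := com_reg H) (M' := A) gamma,
      forall b a, p (coinv_val b *A a) = alg_mul (coinv_alg A) (b ⊗ p a),
      forall h, p (gamma h) = counit h *: alg_one (coinv_alg A)
    & forall a, \rho_(a0, a1 <- a) (coinv_val (p a0) *A gamma a1) = a].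
Proof.
case=> f [[g fK gK] f_left f_col].
have vL := coinv_lin A.
have gL : lin g by split=> a x y; apply: (can_inj fK); rewrite linearP !gK.
have gammaL : lin (fun h : H => g (alg_one (coinv_alg A) ⊗ h)).
  by have gL' := lin_app (mklin gL); split=> c x y; rewrite (linE ((tpair_bil _ _).2 _)) (linE gL).
pose gamma := mklin gammaL.
have epsB : bil (fun (b : coinv_alg A) (h : H) => counit h *: b) by lin.
pose p : 'Lin(A, coinv_alg A) := lin_comp (tlin epsB) f.
have cfE b h : coact (b ⊗ h : com_free H (coinv_alg A)) =
    \sw_(h1, h2 <- h) ((b ⊗ h1) ⊗ h2) by exact: tlinE.
have f_gamma b h : f (coinv_val b *A gamma h) = b ⊗ h.
  have := f_left b (gamma h); rewrite !tlinE /= gK => ->.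
  by rewrite /lmod_free_act0 tsum_pair ?alg_mul1r //; lin.
(* A colinear map into the cofree comodule B ⊗ H is determined by its composite with id ⊗ ε. *)
have fE a : f a = \rho_(a0, a1 <- a) (p a0 ⊗ a1).
  have tE (t : coinv_alg A ⊗ H) :
      \tsum_(t0 ⊗ t1 <- coact (t : com_free H (coinv_alg A))) (tlin epsB t0 ⊗ t1) = t.
    move: t; apply: tens_ext; [lin|exact: lin_id|] => b h.
    rewrite cfE.
    transitivity (\sw_(h1, h2 <- h) (tlin epsB (b ⊗ h1) ⊗ h2)); first by sweedler [:: h].
    by under eq_sw2 => h1 h2 do rewrite tlinE; sweedler [:: h].
  by rewrite -[LHS]tE f_col tsum_bil_pair; [apply: eq_tsum => a0 a1; rewrite tsum_pair //; lin | lin].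
exists gamma, p; split.
- move=> h; have := f_col (gamma h).
  rewrite (_ : f (gamma h) = alg_one (coinv_alg A) ⊗ h) ?cfE; last exact: gK.
  move/(congr1 (fun t => \tsum_(t0 ⊗ t1 <- t) (mklin gL t0 ⊗ t1))).
  rewrite [in RHS]tsum_bil_pair; last by lin.
  move=> E; rewrite -[LHS]tsum_id; transitivity (\rho_(m0, m1 <- gamma h)
    \tsum_(t0 ⊗ t1 <- f m0 ⊗ m1) (mklin gL t0 ⊗ t1)).
    by apply: eq_tsum => m0 m1; rewrite tsum_pair /= ?fK //; lin.
  rewrite -E /sw2 tsum_bil_pair; last by lin.
  by apply: eq_tsum => h1 h2; rewrite tsum_pair //; lin.
- move=> b a; transitivity (tlin epsB (f (lact (ca_left A) (b ⊗ a)))).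
    by rewrite (_ : lact (ca_left A) (b ⊗ a) = coinv_val b *A a) //; exact: tlinE.
  change (p a) with (tlin epsB (f a)); rewrite f_left.
  move: (f a) => t; move: t; apply: tens_ext; [lin|lin|] => c h.
  rewrite (tlinE (lmod_free_bil _ _)) /lmod_free_act0 tsum_pair; last by lin.
  by rewrite !(tlinE epsB); pull_scalars.
- move=> h; rewrite /p /= gK tsum_pair //.
move=> a; apply: (can_inj fK); rewrite linf_tsum fE.
by apply: eq_tsum => a0 a1; rewrite f_gamma.
Qed.

Lemma left_inverse_cleft (gamma delta : 'Lin(H, A)) (p : 'Lin(A, coinv_alg A)) :
  colinear (M := com_reg H) (M' := A) gamma ->
  (forall b a, p (coinv_val b *A a) = alg_mul (coinv_alg A) (b ⊗ p a)) ->
  (forall h, p (gamma h) = counit h *: alg_one (coinv_alg A)) ->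
  (forall h, coact (delta h) = \sw_(h1, h2 <- h) (delta h2 ⊗ antipode h1)) ->
  (forall h, \sw_(h1, h2 <- h) (delta h1 *A gamma h2) = qalpha h *: caone) ->
  cleft A.
Proof.
move=> gC p_mul p_gamma dC dg; exists gamma, delta; split=> // h; split=> //.
have gE h' : coact (gamma h') = \sw_(h1, h2 <- h') (gamma h1 ⊗ h2) by exact: gC.
have projE' a : projB dC a = p a.
  (* Apply [p] to a = π(a_0) γ(a_1), where π(a_0) lies in [B]. *)
  rewrite -[in RHS](projB_gamma gC dC dg a) linf_tsum.
  under eq_tsum => a0 a1 do rewrite p_mul p_gamma.
  by sweedler (a, tt); pull_scalars; rewrite alg_mul1r.
transitivity (proj delta (ca_hopf A) (gamma h)); first by rewrite projE; sweedler [:: h].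
have := congr1 (@coinv_val _ _ _) (projE' (gamma h)).
by rewrite p_gamma (linZ (coinv_lin A)).
Qed.

End NormalBasis.

(** * The inverse Galois map on 1 ⊗ h *)

Section Galois.
Variables (k : fieldType) (H : coquasi_hopf k) (A : comodule_algebra H).
Variables (gamma : 'Lin(H, A)) (p : 'Lin(A, coinv_alg A)).
Hypothesis p_mul : forall b a, p (coinv_val b *A a) = alg_mul (coinv_alg A) (b ⊗ p a).
Hypothesis p_split : forall a, \rho_(a0, a1 <- a) (coinv_val (p a0) *A gamma a1) = a.

Local Notation AA := (btens (ca_right A) (ca_left A)).
Local Notation bp a b := (@bpair _ _ (ca_right A) (ca_left A) a b).
Let pL : lin (fun a : A => coinv_val (p a)).
Proof. by split=> c x y; rewrite linearP (linE (coinv_lin A)). Qed.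

Fact mulp_bil : @bil k (ca_right A) (ca_left A) _ (fun a b => (a : A) *A coinv_val (p b)).
Proof. by lin. Qed.

Fact mulp_bal : @balanced k _ (ca_right A) (ca_left A) _ (fun a b => (a : A) *A coinv_val (p b)).
Proof.
move=> a c b; rewrite !tlinE p_mul tlinE /=.
exact: (@hactAm _ _ _ (ca_hopf A) _ _ _ (valP c)).
Qed.

Definition mulp : 'Lin(AA, A) := blin mulp_bil mulp_bal.

Lemma mulpE a b : mulp (bp a b) = a *A coinv_val (p b).
Proof. exact: blinE. Qed.

(** A ⊗_B A carries two coactions: that of [induced] comes from the right factor, this one from the
    left factor. It is balanced because multiplication by a coinvariant is colinear. *)
Fact lcoact_bil : @bil k (ca_right A) (ca_left A) (AA ⊗ H)%type
  (fun a b => \rho_(a0, a1 <- (a : A)) (bp a0 b ⊗ a1)).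
Proof. by slin. Qed.

Fact lcoact_bal : @balanced k _ (ca_right A) (ca_left A) _
  (fun a b => \rho_(a0, a1 <- (a : A)) (bp a0 b ⊗ a1)).
Proof.
move=> a c b; rewrite tlinE (@coact_hactr _ _ _ (ca_hopf A)) ?(valP c) //.
rewrite tsum_bil_pair; last by slin.
apply: eq_tsum => a0 a1; rewrite tsum_pair; last by slin.
rewrite -bpair_balanced; congr (bp _ _ ⊗ _); exact/esym/tlinE.
Qed.

Definition lcoact : 'Lin(AA, AA ⊗ H) := blin lcoact_bil lcoact_bal.

Lemma lcoactE a b : lcoact (bp a b) = \rho_(a0, a1 <- (a : A)) (bp a0 b ⊗ a1).
Proof. exact: blinE. Qed.

Lemma coact_mulp (t : AA) : coact (mulp t) = \tsum_(t0 ⊗ t1 <- lcoact t) (mulp t0 ⊗ t1).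
Proof.
move: t; apply: btens_ext; [lin|lin|] => a b.
rewrite mulpE lcoactE (@coact_hactr _ _ _ (ca_hopf A)) ?(valP (p b)) //.
rewrite tsum_bil_pair; last by lin.
by apply: eq_tsum => a0 a1; rewrite tsum_pair ?mulpE //; lin.
Qed.

(** The coaction of the left factor as seen through [can]. On 1 ⊗ h it gives (1 ⊗ h_2) ⊗ S(h_1), the
    pattern required of δ. *)
Fact rotate_bil : bil (fun (a : A) (h : H) =>
  \rho_(a0, a1 <- a) \sw_(h1, h2 <- h) ((a0 ⊗ h2) ⊗ (a1 *H antipode h1))).
Proof. by slin. Qed.

(** On the right side, [hmulAV] moves the [omegaV] of [can] past the product while rebracketing (a
    b) S(b) to a (b S(b)); the law of β then removes b from it. *)
Lemma lcoact_can (t : AA) : \tsum_(t0 ⊗ t1 <- lcoact t) (can A t0 ⊗ t1) =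
  tlin rotate_bil (can A t).
Proof.
move: t; apply: btens_ext; [lin|lin|] => a b; change (A : Type) in a; change (A : Type) in b.
rewrite lcoactE tsum_bil_pair; last by lin.
transitivity (\rho_(a0, a1 <- a) (can0 a0 b ⊗ a1)).
  by apply: eq_tsum => a0 a1; rewrite tsum_pair; [rewrite /can blinE | lin].
rewrite /can blinE.
transitivity (\rho_(a0, a1 <- a) \rho_(b0, b' <- b) \sw_(b1, b2, b3, b4 <- b')
  omegaV (a1 ⊗ (qbeta b2 *: b1) ⊗ antipode b3) *:
  \rho_(x0, x1 <- a0 *A b0) \sw_(h1, h2 <- b4) ((x0 ⊗ h2) ⊗ (x1 *H antipode h1))); last first.
  rewrite /can0 linf_tsum; apply: eq_tsum => a0 a1; rewrite linf_tsum; apply: eq_tsum => b0 b1.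
  by do 3 (rewrite linf_tsum; apply: eq_tsum => ? ?); rewrite linfZ tlinE.
transitivity (\rho_(a0, a1 <- a) \rho_(b0, b' <- b) \sw_(p, q, c, l <- b')
  qbeta q *: (((a0 *A b0) ⊗ l) ⊗ (\sw_(x1, x2 <- a1) \sw_(p1, p2 <- p) \sw_(z1, z2 <- antipode c)
    omegaV (x2 ⊗ p2 ⊗ z2) *: ((x1 *H p1) *H z1)))); last first.
  by sweedler (a, (b, tt)); pull_scalars; congr (_ *: _); ring.
transitivity (\rho_(a0, a1 <- a) \rho_(b0, b' <- b) \sw_(p, q, c, l <- b')
  qbeta q *: (((a0 *A b0) ⊗ l) ⊗ (\sw_(x1, x2 <- a1) \sw_(p1, p2 <- p) \sw_(z1, z2 <- antipode c)
    omegaV (x1 ⊗ p1 ⊗ z1) *: (x2 *H (p2 *H z2))))); last first.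
  by do 5 (apply: eq_tsum => ? ?); rewrite hmulAV.
transitivity (\rho_(a0, a1 <- a) \rho_(b0, b' <- b) \sw_(p, q, c, l <- b')
  \sw_(x1, x2 <- a1) \sw_(q1, q2, q3 <- q) qbeta q2 *: (omegaV (x1 ⊗ p ⊗ antipode c) *:
   (((a0 *A b0) ⊗ l) ⊗ (x2 *H (q1 *H antipode q3))))); last first.
  by sweedler (a, (b, tt)); pull_scalars; congr (_ *: _); ring.
transitivity (\rho_(a0, a1 <- a) \rho_(b0, b' <- b) \sw_(p, q, c, l <- b')
  \sw_(x1, x2 <- a1) qbeta q *: (omegaV (x1 ⊗ p ⊗ antipode c) *:
   (((a0 *A b0) ⊗ l) ⊗ (x2 *H hone)))).
  by rewrite /can0; sweedler (a, (b, tt)); pull_scalars; congr (_ *: _); ring.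
do 6 (apply: eq_tsum => ? ?).
by rewrite (@sw_beta _ _ _ (fun z => _ *: (_ ⊗ (_ *H z)))) //; lin.
Qed.

Lemma can_colinear (t : AA) : \rho_(t0, t1 <- (t : induced (ca_right A))) (can A t0 ⊗ t1) =
  \tsum_(x ⊗ h <- can A t) \sw_(h1, h2 <- h) ((x ⊗ h1) ⊗ h2).
Proof.
move: t; apply: btens_ext; [lin|slin|] => a b; change (A : Type) in a; change (A : Type) in b.
rewrite coact_indE /ind_coact0 tsum_bil_pair; last by lin.
transitivity (\rho_(b0, b1 <- b) (can0 a b0 ⊗ b1)).
  by apply: eq_tsum => b0 b1; rewrite tsum_pair; [rewrite /can blinE | lin].
by rewrite /can blinE /can0; sweedler (a, (b, tt)); pull_scalars.
Qed.

(** What (a δ(h_1)) γ(h_2) must be after rebracketing, written without δ; for a = 1 it is α(h) 1. *)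
Fact evalp_bil : bil (fun (a : A) (h : H) => \rho_(a0, a1 <- a) \sw_(c, q, r <- h)
  (qalpha q * omega (a1 ⊗ antipode c ⊗ r)) *: a0).
Proof. by slin. Qed.

(** On a ⊗ b both sides are the product a b: the left one by [p_split], the right one by
    [omega_galois]. *)
Lemma mulp_gamma (t : AA) :
  \rho_(t0, t1 <- (t : induced (ca_right A))) (mulp t0 *A gamma t1) = tlin evalp_bil (can A t).
Proof.
move: t; apply: btens_ext; [lin|lin|] => a b; change (A : Type) in a; change (A : Type) in b.
rewrite coact_indE /ind_coact0 tsum_bil_pair; last by lin.
transitivity (a *A b).
  rewrite -[in RHS](p_split b) (@lin_tsum _ _ _ _ _ (fun x => a *A x)); last by lin.
  apply: eq_tsum => b0 b1; rewrite tsum_pair; last by lin.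
  by rewrite mulpE (@hactAm _ _ _ (ca_hopf A)) ?(valP (p b0)).
rewrite /can blinE.
transitivity (\rho_(a0, a1 <- a) \rho_(b0, b' <- b) \sw_(b1, b2, b3, b4 <- b')
  omegaV (a1 ⊗ (qbeta b2 *: b1) ⊗ antipode b3) *:
  \rho_(x0, x1 <- a0 *A b0) \sw_(c, q, r <- b4) (qalpha q * omega (x1 ⊗ antipode c ⊗ r)) *: x0); last first.
  rewrite /can0 linf_tsum; apply: eq_tsum => a0 a1; rewrite linf_tsum; apply: eq_tsum => b0 b1.
  by do 3 (rewrite linf_tsum; apply: eq_tsum => ? ?); rewrite linfZ tlinE.
transitivity (\rho_(a0, a1 <- a) \rho_(b0, b1 <- b) (counit a1 * counit b1) *: (a0 *A b0)).
  by sweedler (a, (b, tt)).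
transitivity (\rho_(a0, a1 <- a) \rho_(b0, b1 <- b)
  (\sw_(p, b, c, a, q <- b1) (qbeta b * qalpha a) *
    (\sw_(x1, x2 <- a1) \sw_(p1, p2 <- p) \sw_(z1, z2 <- antipode c)
      omega ((x1 *H p1) ⊗ z1 ⊗ q) * omegaV (x2 ⊗ p2 ⊗ z2))) *: (a0 *A b0)).
  by do 2 (apply: eq_tsum => ? ?); rewrite omega_galois.
by sweedler (a, (b, tt)); pull_scalars; congr (_ *: _); ring.
Qed.

Lemma galois_left_inverse : galois A -> exists delta : 'Lin(H, A),
  (forall h, coact (delta h) = \sw_(h1, h2 <- h) (delta h2 ⊗ antipode h1)) /\
  (forall h, \sw_(h1, h2 <- h) (delta h1 *A gamma h2) = qalpha h *: caone).
Proof.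
case=> ci canK ciK.
have ciL : lin ci by split=> a x y; apply: (can_inj canK); rewrite linearP !ciK.
pose cil : 'Lin(A ⊗ H, AA) := mklin ciL.
have tauL : lin (fun h : H => cil ((caone : A) ⊗ h)) by lin.
pose tau : 'Lin(H, AA) := mklin tauL.
have can_tau h : can A (tau h) = (caone : A) ⊗ h by exact: ciK.
(* Identities about both coactions of [tau] are checked after applying [can] to the first tensor
   factor, where [tau h] becomes 1 ⊗ h. *)
have ci_eq (U : lmodType k) (t u : AA ⊗ U) :
    \tsum_(x ⊗ y <- t) (can A x ⊗ y) = \tsum_(x ⊗ y <- u) (can A x ⊗ y) -> t = u.
  have E (s : AA ⊗ U) : s = \tsum_(x ⊗ y <- \tsum_(x ⊗ y <- s) (can A x ⊗ y)) (cil x ⊗ y).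
    rewrite tsum_bil_pair; last by lin.
    rewrite -[LHS]tsum_id; apply: eq_tsum => x y; rewrite tsum_pair; last by lin.
    by congr (_ ⊗ _); exact/esym/canK.
  by move=> tu; rewrite [t]E tu -E.
exists (lin_comp mulp tau); split=> h.
  have E : lcoact (tau h) = \sw_(h1, h2 <- h) (tau h2 ⊗ antipode h1).
    apply: ci_eq; rewrite lcoact_can can_tau tlinE coact_caone.
    transitivity (\sw_(h1, h2 <- h) (((caone : A) ⊗ h2) ⊗ antipode h1)); first by sweedler [:: h].
    transitivity (\sw_(h1, h2 <- h) (can A (tau h2) ⊗ antipode h1)); last by sweedler [:: h].
    by apply: eq_tsum => h1 h2; rewrite can_tau.
  rewrite [LHS](coact_mulp (tau h)) E.
  by transitivity (\sw_(h1, h2 <- h) (mulp (tau h2) ⊗ antipode h1)); first by sweedler [:: h].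
have E : coact (tau h : induced (ca_right A)) = \sw_(h1, h2 <- h) (tau h1 ⊗ h2).
  apply: ci_eq; rewrite can_colinear can_tau tsum_pair; last by slin.
  transitivity (\sw_(h1, h2 <- h) (can A (tau h1) ⊗ h2)); last by sweedler [:: h].
  by apply: eq_tsum => h1 h2; rewrite can_tau.
transitivity (tlin evalp_bil (can A (tau h))).
  by rewrite -mulp_gamma E; sweedler [:: h].
by rewrite can_tau tlinE coact_caone; sweedler [:: h].
Qed.

End Galois.

(** * From the weak structure theorem to a left inverse *)

Section FreeHopfModule.
Variables (k : fieldType) (H : coquasi_bialgebra k) (A : comodule_algebra H).
Section Construction.
Variable U : comodule H.

Fact free_coact_bil : bil (fun (u : U) (a : A) =>
  \rho_(u0, u1 <- u) \rho_(a0, a1 <- a) ((u0 ⊗ a0) ⊗ (u1 *H a1))).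
Proof. by slin. Qed.

Definition free_coact := tlin free_coact_bil.

Lemma free_coactE u a : free_coact (u ⊗ a) =
  \rho_(u0, u1 <- u) \rho_(a0, a1 <- a) ((u0 ⊗ a0) ⊗ (u1 *H a1)).
Proof. exact: tlinE. Qed.

Fact free_coactA t :
  \tsum_(t0 ⊗ t1 <- free_coact t) \tsum_(t00 ⊗ t01 <- free_coact t0) (t00 ⊗ (t01 ⊗ t1)) =
  \tsum_(t0 ⊗ t1 <- free_coact t) (t0 ⊗ comul t1).
Proof.
have E := free_coactE.
transitivity (\tsum_(t0 ⊗ t1 <- free_coact t) \sw_(h1, h2 <- t1) (t0 ⊗ (h1 ⊗ h2))).
  move: t; apply: tens_ext; [lin|slin|] => u a.
  by sweedler (u, (a, tt)).
apply: eq_tsum => t0 t1; rewrite -[in RHS](tsum_id (comul t1)).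
by rewrite (@lin_tsum _ _ _ _ _ (fun z => t0 ⊗ z)) //; lin.
Qed.

Fact free_counit t : \tsum_(t0 ⊗ t1 <- free_coact t) (counit t1 *: t0) = t.
Proof.
have E := free_coactE.
move: t; apply: tens_ext; [lin|exact: lin_id|] => u a.
by sweedler (u, (a, tt)).
Qed.

Definition free_comodule : comodule H := Comodule free_coactA free_counit.

Lemma coact_freeE u a : coact ((u ⊗ a) : free_comodule) =
  \rho_(u0, u1 <- u) \rho_(a0, a1 <- a) ((u0 ⊗ a0) ⊗ (u1 *H a1)).
Proof. exact: tlinE. Qed.

(** The product of [A] on the last two factors, after rebracketing (U ⊗ A) ⊗ A. *)
Definition free_act0 (t : U ⊗ A) (b : A) : U ⊗ A :=
  \tsum_(u ⊗ a <- t) \rho_(u0, u1 <- u) \rho_(a0, a1 <- a) \rho_(b0, b1 <- b)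
    omega (u1 ⊗ a1 ⊗ b1) *: (u0 ⊗ (a0 *A b0)).

Fact free_act_bil : bil free_act0.
Proof. by rewrite /free_act0; slin. Qed.

Definition free_act : 'Lin((U ⊗ A) ⊗ A, U ⊗ A) := tlin free_act_bil.

Lemma free_actE u a b : free_act ((u ⊗ a) ⊗ b) =
  \rho_(u0, u1 <- u) \rho_(a0, a1 <- a) \rho_(b0, b1 <- b)
    omega (u1 ⊗ a1 ⊗ b1) *: (u0 ⊗ (a0 *A b0)).
Proof. by rewrite /free_act tlinE /free_act0 tsum_pair //; slin. Qed.

Fact coact_free_act (t : free_comodule) (b : A) : coact (free_act (t ⊗ b) : free_comodule) =
  \rho_(t0, t1 <- t) \rho_(b0, b1 <- b) (free_act (t0 ⊗ b0) ⊗ (t1 *H b1)).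
Proof.
have E := free_coactE.
move: t; apply: tens_ext; [lin|lin|] => u a.
transitivity (\rho_(u0, u1 <- u) \rho_(a0, a1 <- a) \rho_(b0, b1 <- b)
  omega (u1 ⊗ a1 ⊗ b1) *: free_coact (u0 ⊗ (a0 *A b0))).
  by rewrite free_actE; sweedler (u, (a, (b, tt))); pull_scalars.
transitivity (\rho_(u0, u1 <- u) \rho_(a0, a1 <- a) \rho_(b0, b1 <- b)
  ((u0 ⊗ (a0 *A b0)) ⊗ (\sw_(h1, h2 <- u1) \sw_(g1, g2 <- a1) \sw_(x1, x2 <- b1)
    omega (h2 ⊗ g2 ⊗ x2) *: (h1 *H (g1 *H x1))))).
  under eq_tsum => u0 u1 do under eq_tsum => a0 a1 do under eq_tsum => b0 b1 do rewrite free_coactE.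
  by sweedler (u, (a, (b, tt))); pull_scalars.
transitivity (\rho_(u0, u1 <- u) \rho_(a0, a1 <- a) \rho_(b0, b1 <- b)
  ((u0 ⊗ (a0 *A b0)) ⊗ (\sw_(h1, h2 <- u1) \sw_(g1, g2 <- a1) \sw_(x1, x2 <- b1)
    omega (h1 ⊗ g1 ⊗ x1) *: ((h2 *H g2) *H x2)))).
  by do 3 (apply: eq_tsum => ? ?); rewrite hmulA.
transitivity (\rho_(u0, u1 <- u) \rho_(a0, a1 <- a) \rho_(b0, b1 <- b)
  (free_act ((u0 ⊗ a0) ⊗ b0) ⊗ ((u1 *H a1) *H b1))); last first.
  by rewrite coact_freeE; sweedler (u, (a, (b, tt))).
under [RHS]eq_tsum => u0 u1 do under eq_tsum => a0 a1 do under eq_tsum => b0 b1 do rewrite free_actE.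
by sweedler (u, (a, (b, tt))); pull_scalars.
Qed.

Fact free_act1 (t : free_comodule) : free_act (t ⊗ (caone : A)) = t.
Proof.
move: t; apply: tens_ext; [lin|exact: lin_id|] => u a.
by rewrite free_actE; sweedler (u, (a, tt)); rewrite camul1r.
Qed.

(** The pentagon: two successive actions and the associativity of [A] give the three factors of one
    side, the other bracketing gives the two factors of the other. *)
Fact free_actA (t : free_comodule) (a b : A) : free_act (free_act (t ⊗ a) ⊗ b) =
  \rho_(t0, t1 <- t) \rho_(a0, a1 <- a) \rho_(b0, b1 <- b)
    omega (t1 ⊗ a1 ⊗ b1) *: free_act (t0 ⊗ (a0 *A b0)).
Proof.
move: t; apply: tens_ext; [lin|lin|] => u c.
transitivity (\rho_(u0, u1 <- u) \rho_(c0, c1 <- c) \rho_(a0, a1 <- a) \rho_(b0, b1 <- b)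
  (\sw_(h1, h2 <- u1) \sw_(g1, g2 <- c1) \sw_(x1, x2 <- a1) \sw_(y1, y2 <- b1)
      omega (h1 ⊗ g1 ⊗ (x1 *H y1)) * omega ((h2 *H g2) ⊗ x2 ⊗ y2)) *:
    (u0 ⊗ (c0 *A (a0 *A b0)))); last first.
  transitivity (\rho_(u0, u1 <- u) \rho_(c0, c1 <- c) \rho_(a0, a1 <- a) \rho_(b0, b1 <- b)
    omega ((u1 *H c1) ⊗ a1 ⊗ b1) *: free_act ((u0 ⊗ c0) ⊗ (a0 *A b0))); last first.
    by rewrite coact_freeE; sweedler (u, (c, (a, (b, tt)))).
  under [RHS]eq_tsum => u0 u1 do under eq_tsum => c0 c1 do under eq_tsum => a0 a1 do
    under eq_tsum => b0 b1 do rewrite free_actE.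
  by sweedler (u, (c, (a, (b, tt)))); pull_scalars; congr (_ *: _); ring.
transitivity (\rho_(u0, u1 <- u) \rho_(c0, c1 <- c) \rho_(a0, a1 <- a)
    omega (u1 ⊗ c1 ⊗ a1) *: free_act ((u0 ⊗ (c0 *A a0)) ⊗ b)).
  by rewrite free_actE; sweedler (u, (c, (a, (b, tt)))); pull_scalars.
transitivity (\rho_(u0, u1 <- u) \rho_(c0, c1 <- c) \rho_(a0, a1 <- a) \rho_(b0, b1 <- b)
  \sw_(u2, u3 <- u1) \sw_(c2, c3 <- c1) \sw_(a2, a3 <- a1)
   (omega (u3 ⊗ c3 ⊗ a3) * omega (u2 ⊗ (c2 *H a2) ⊗ b1)) *: (u0 ⊗ ((c0 *A a0) *A b0))).
  under eq_tsum => u0 u1 do under eq_tsum => c0 c1 do under eq_tsum => a0 a1 do rewrite free_actE.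
  by sweedler (u, (c, (a, (b, tt)))); pull_scalars.
transitivity (\rho_(u0, u1 <- u) \rho_(c0, c1 <- c) \rho_(a0, a1 <- a) \rho_(b0, b1 <- b)
  \sw_(u2, u3 <- u1) \sw_(c2, c3 <- c1) \sw_(a2, a3 <- a1)
   (omega (u3 ⊗ c3 ⊗ a3) * omega (u2 ⊗ (c2 *H a2) ⊗ b1)) *: (u0 ⊗
    (\rho_(x0, x1 <- c0) \rho_(y0, y1 <- a0) \rho_(z0, z1 <- b0)
      omega (x1 ⊗ y1 ⊗ z1) *: (x0 *A (y0 *A z0))))).
  by do 7 (apply: eq_tsum => ? ?); rewrite camulA.
under [RHS]eq_tsum => u0 u1 do under eq_tsum => c0 c1 do under eq_tsum => a0 a1 do
    under eq_tsum => b0 b1 do rewrite omega_cocycle.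
by sweedler (u, (c, (a, (b, tt)))); pull_scalars; congr (_ *: _); ring.
Qed.

Definition free_hopf : hopf_module A :=
  @HopfModule k H A free_comodule free_act coact_free_act free_act1 free_actA.

End Construction.

Lemma free_act_coinv (U : comodule H) u a b : b \in coinv_pred A ->
  free_act U ((u ⊗ a) ⊗ b) = u ⊗ (a *A b).
Proof.
move=> /coinv_predP bP; rewrite free_actE.
transitivity (\rho_(u0, u1 <- u) \rho_(a0, a1 <- a)
  omega (u1 ⊗ a1 ⊗ hone) *: (u0 ⊗ (a0 *A b))); last by sweedler (u, (a, tt)).
by do 2 (apply: eq_tsum => ? ?); rewrite bP tsum_pair //; lin.
Qed.

Section Map.
Variables (U U' : comodule H) (f : 'Lin(U, U')).
Hypothesis f_colinear : colinear f.

Fact free_map_bil : bil (fun (u : U) (a : A) => f u ⊗ a).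
Proof. by lin. Qed.

Lemma free_map_colinear : colinear (M := free_hopf U) (M' := free_hopf U') (tlin free_map_bil).
Proof.
move=> t; move: t; apply: tens_ext; [lin|lin|] => u a.
have fE u' : coact (f u') = \rho_(u0, u1 <- u') (f u0 ⊗ u1) by exact: f_colinear.
rewrite tlinE (coact_freeE (f u)) (coact_freeE u).
transitivity (\rho_(u0, u1 <- u) \rho_(a0, a1 <- a) ((tlin free_map_bil (u0 ⊗ a0)) ⊗ (u1 *H a1))).
  under [RHS]eq_tsum => u0 u1 do under eq_tsum => a0 a1 do rewrite tlinE.
  by sweedler (u, (a, tt)).
by sweedler (u, (a, tt)).
Qed.

Lemma free_map_act (t : free_hopf U) (b : A) :
  (tlin free_map_bil (t *M b) : free_hopf U') = (tlin free_map_bil t : free_hopf U') *M b.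
Proof.
move: t; apply: tens_ext; [lin|lin|] => u a.
have fE u' : coact (f u') = \rho_(u0, u1 <- u') (f u0 ⊗ u1) by exact: f_colinear.
rewrite tlinE; apply: etrans (congr1 (tlin free_map_bil) (free_actE _ _ _)) (esym _).
apply: etrans (free_actE _ _ _) (esym _).
transitivity (\rho_(u0, u1 <- u) \rho_(a0, a1 <- a) \rho_(b0, b1 <- b)
  omega (u1 ⊗ a1 ⊗ b1) *: tlin free_map_bil (u0 ⊗ (a0 *A b0))).
  by sweedler (u, (a, (b, tt))); pull_scalars.
under eq_tsum => u0 u1 do under eq_tsum => a0 a1 do under eq_tsum => b0 b1 do rewrite tlinE.
by sweedler (u, (a, (b, tt))).
Qed.

Definition free_map : hopf_hom (free_hopf U) (free_hopf U') :=
  HopfHom free_map_colinear free_map_act.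

Lemma free_mapE u a : free_map (u ⊗ a) = f u ⊗ a.
Proof. exact: tlinE. Qed.

End Map.

End FreeHopfModule.

Section Coinvariants.
Variables (k : fieldType) (H : coquasi_bialgebra k) (A : comodule_algebra H).

(** Coinvariance means h_1 ⊗ c_0 ⊗ h_2 c_1 = h ⊗ c ⊗ 1, tested here on trilinear [G]. It serves to
    trade a product h_2 c_1 inside a formula for 1. *)
Lemma coinv_tens (W : lmodType k) (G : H -> A -> H -> W) (t : free_hopf A (com_reg H)) :
  (forall a z, lin (fun h => G h a z)) -> (forall h z, lin (fun a => G h a z)) ->
  (forall h a, lin (G h a)) ->
  t \in coinv_pred (free_hopf A (com_reg H)) ->
  \tsum_(h ⊗ c <- t) \sw_(h1, h2 <- h) \rho_(c0, c1 <- c) G h1 c0 (h2 *H c1) =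
  \tsum_(h ⊗ c <- t) G h c hone.
Proof.
move=> G1 G2 G3 /coinv_predP tP.
have G4 h a x : lin (fun y => G h a (y *H x)) by apply: (lin_app (mklin (G3 h a))); lin.
have G5 h a x : lin (fun y => G h a (x *H y)) by apply: (lin_app (mklin (G3 h a))); lin.
transitivity (\tsum_(t0 ⊗ z <- coact t) \tsum_(h ⊗ c <- t0) G h c z).
  move: t {tP}; apply: tens_ext; [slin|slin|] => h c.
  rewrite tsum_pair; last by slin.
  rewrite (@coact_freeE _ _ A (com_reg H)).
  rewrite tsum_bil_pair; last by slin.
  apply: eq_tsum => h1 h2; rewrite tsum_bil_pair; last by slin.
  apply: eq_tsum => c0 c1; rewrite tsum_pair; last by slin.
  by rewrite tsum_pair //; slin.
by rewrite tP tsum_pair //; slin.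
Qed.

End Coinvariants.

(** * Evaluation on the free Hopf module H ⊗ A *)

Section WeakStructure.
Variables (k : fieldType) (H : coquasi_hopf k) (A : comodule_algebra H).

Fact ev_bil : bil (fun (h : H) (c : A) => \sw_(s, q, r <- h) \rho_(c0, c1 <- c)
  (qalpha q * omegaV (antipode s ⊗ r ⊗ c1)) *: c0).
Proof. by slin. Qed.

Definition ev : 'Lin(H ⊗ A, A) := tlin ev_bil.

Lemma evE h c : ev (h ⊗ c) = \sw_(s, q, r <- h) \rho_(c0, c1 <- c)
  (qalpha q * omegaV (antipode s ⊗ r ⊗ c1)) *: c0.
Proof. exact: tlinE. Qed.

Local Notation M := (free_hopf A (com_reg H)).

Lemma ev_mul_coinv h c b : b \in coinv_pred A -> ev (h ⊗ (c *A b)) = ev (h ⊗ c) *A b.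
Proof.
move=> bP; rewrite !evE (@coact_hactr _ _ _ (ca_hopf A)) //.
by sweedler (c, [:: h]); pull_scalars.
Qed.

(** [omegaV_eval] produces ω^-1(S(h_1), h_5 c_2, r_1); coinvariance replaces its middle argument by
    1, which trivializes it. *)
Lemma ev_act (t : M) (r : A) : t \in coinv_pred M -> ev (t *M r) = ev t *A r.
Proof.
pose G h (c : A) z := \sw_(h1, h2, h3, h4 <- h) \rho_(c0, c1 <- c) \rho_(r0, r1 <- r)
  (qalpha h3 * omegaV (antipode h2 ⊗ h4 ⊗ c1) * omegaV (antipode h1 ⊗ z ⊗ r1)) *: (c0 *A r0).
move=> tP; transitivity (\tsum_(h ⊗ c <- t) G h c hone); last first.
  transitivity (\tsum_(h ⊗ c <- t) (ev (h ⊗ c) *A r)); last first.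
    rewrite -[in RHS](tsum_id t) linf_tsum (@lin_tsum _ _ _ _ _ (fun x => x *A r)) //; lin.
  apply: eq_tsum => h c; rewrite /G evE.
  by sweedler (c, (r, [:: h])); pull_scalars.
rewrite -(coinv_tens (G := G) _ _ _ tP); [|by move=> *; rewrite /G; slin..].
move: t {tP}; apply: tens_ext; [lin|rewrite /G; slin|] => h c.
rewrite tsum_pair; last by rewrite /G; slin.
rewrite [hact _ _]free_actE.
transitivity (\sw_(h1, h2 <- h) \rho_(c0, c1 <- c) \rho_(r0, r1 <- r)
  omega (h2 ⊗ c1 ⊗ r1) *: ev (h1 ⊗ (c0 *A r0))).
  by rewrite -[coact h]/(comul h); sweedler (c, (r, [:: h])); pull_scalars.
transitivity (\rho_(c0, c1 <- c) \rho_(r0, r1 <- r)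
  (\sw_(s, q, d <- h) qalpha q * (\sw_(d1, d2 <- d) \sw_(x1, x2 <- c1) \sw_(y1, y2 <- r1)
      omegaV (antipode s ⊗ d1 ⊗ (x1 *H y1)) * omega (d2 ⊗ x2 ⊗ y2))) *: (c0 *A r0)).
  under eq_sw2 => h1 h2 do under eq_tsum => c0 c1 do under eq_tsum => r0 r1 do rewrite evE.
  by sweedler (c, (r, [:: h])); pull_scalars; congr (_ *: _); ring.
under eq_tsum => c0 c1 do under eq_tsum => r0 r1 do rewrite omegaV_eval.
by rewrite /G; sweedler (c, (r, [:: h])); pull_scalars.
Qed.

(** Consider the terms S(h_1) z. With z = h c, rebracketing to (S(h) h) c and the law of α leave the
    coaction of c; coinvariance allows z = 1 instead, which leaves S(h_1). *)
Lemma ev_coact (t : M) : t \in coinv_pred M ->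
  coact (ev t) = \tsum_(h ⊗ c <- t) \sw_(h1, h2 <- h) (ev (h2 ⊗ c) ⊗ antipode h1).
Proof.
pose G h (c : A) z := \sw_(h1, s, q, r <- h) \rho_(c0, c1 <- c)
  (qalpha q * omegaV (antipode s ⊗ r ⊗ c1)) *: (c0 ⊗ (antipode h1 *H z)).
move=> tP; transitivity (\tsum_(h ⊗ c <- t) G h c hone); last first.
  apply: eq_tsum => h c; under [RHS]eq_sw2 => h1 h2 do rewrite evE.
  by rewrite /G; sweedler (c, [:: h]); pull_scalars.
rewrite -(coinv_tens (G := G) _ _ _ tP); [|by move=> *; rewrite /G; slin..].
move: t {tP}; apply: tens_ext; [lin|rewrite /G; slin|] => h c.
rewrite tsum_pair; last by rewrite /G; slin.
transitivity (\rho_(c0, c1 <- c) \sw_(s, q, d <- h) qalpha q *: (c0 ⊗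
  \sw_(z1, z2 <- antipode s) \sw_(d1, d2 <- d) \sw_(x1, x2 <- c1)
    omegaV (z1 ⊗ d1 ⊗ x1) *: (z2 *H (d2 *H x2)))); last first.
  by rewrite /G; sweedler (c, [:: h]); pull_scalars; congr (_ *: _); ring.
transitivity (\rho_(c0, c1 <- c) \sw_(s, q, d <- h) qalpha q *: (c0 ⊗
  \sw_(z1, z2 <- antipode s) \sw_(d1, d2 <- d) \sw_(x1, x2 <- c1)
    omegaV (z2 ⊗ d2 ⊗ x2) *: ((z1 *H d1) *H x1))); last first.
  by do 3 (apply: eq_tsum => ? ?); rewrite hmulAV.
transitivity (\rho_(c0, c1 <- c) \sw_(s, q, r <- h) \sw_(q1, q2, q3 <- q) qalpha q2 *:
  (\sw_(x1, x2 <- c1) omegaV (antipode s ⊗ r ⊗ x2) *: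
     (c0 ⊗ ((antipode q1 *H q3) *H x1)))); last first.
  by sweedler (c, [:: h]); pull_scalars; congr (_ *: _); ring.
transitivity (\rho_(c0, c1 <- c) \sw_(s, q, r <- h) qalpha q *:
  (\sw_(x1, x2 <- c1) omegaV (antipode s ⊗ r ⊗ x2) *: (c0 ⊗ (hone *H x1)))); last first.
  do 3 (apply: eq_tsum => ? ?).
  rewrite (@sw_alpha _ _ _ (fun z => \sw_(x1, x2 <- _) _ *: (_ ⊗ (z *H _)))) //; slin.
transitivity (\sw_(s, q, r <- h) \rho_(c0, c1 <- c)
    (qalpha q * omegaV (antipode s ⊗ r ⊗ c1)) *: \rho_(x, y <- c0) (x ⊗ y)).
  rewrite evE; transitivity (\sw_(s, q, r <- h) \rho_(c0, c1 <- c)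
    (qalpha q * omegaV (antipode s ⊗ r ⊗ c1)) *: coact c0).
    by sweedler (c, [:: h]); pull_scalars.
  by do 3 (apply: eq_tsum => ? ?); rewrite tsum_id.
by sweedler (c, [:: h]); pull_scalars.
Qed.

End WeakStructure.

(** * The left inverse obtained from the weak structure theorem *)

Section WeakStructureLeftInverse.
Variables (k : fieldType) (H : coquasi_hopf k) (A : comodule_algebra H).
Variables (gamma : 'Lin(H, A)) (p : 'Lin(A, coinv_alg A)).
Hypothesis p_mul : forall b a, p (coinv_val b *A a) = alg_mul (coinv_alg A) (b ⊗ p a).
Hypothesis p_split : forall a, \rho_(a0, a1 <- a) (coinv_val (p a0) *A gamma a1) = a.

Let pL : lin (fun a : A => coinv_val (p a)).
Proof. by split=> c x y; rewrite linearP (linE (coinv_lin A)). Qed.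

Local Notation M := (free_hopf A (com_reg H)).
Local Notation M' := (free_hopf A (com_free H H)).
Local Notation evH := (@ev k H A).

Fact evp_bil : @bil k (coinv_rmod M) (ca_left A) A
  (fun t r => evH (coinv_val t) *A coinv_val (p r)).
Proof. by have vL := coinv_lin M; lin. Qed.

Fact evp_bal : @balanced k _ (coinv_rmod M) (ca_left A) A
  (fun t r => evH (coinv_val t) *A coinv_val (p r)).
Proof.
have tP (t : coinv M) : (coinv_val t : M) \in coinv_pred M := valP t.
move=> t b r; rewrite !tlinE p_mul tlinE.
change (evH ((coinv_val t : M) *M coinv_val b) *A coinv_val (p r) =
  evH (coinv_val t) *A (coinv_val b *A coinv_val (p r))).
rewrite (ev_act _ (tP t)).
by rewrite (@hactAm _ _ _ (ca_hopf A)) ?(valP b).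
Qed.

Definition evp : 'Lin(btens (coinv_rmod M) (ca_left A), A) := blin evp_bil evp_bal.

Lemma evpE t r : evp (bpair t r) = evH (coinv_val t) *A coinv_val (p r).
Proof. exact: blinE. Qed.

(** On t ⊗ a this is ev(t) (p(a_0) γ(a_1)) = ev(t) a = ev(t a). For a preimage of h ⊗ 1 the right
    side is α(h) 1. *)
Lemma evp_gamma (t : induced (coinv_rmod M)) :
  \rho_(t0, t1 <- t) (evp t0 *A gamma t1) = evH (adj_counit M t).
Proof.
move: t; apply: btens_ext; [lin|lin|] => n a; change (A : Type) in a.
rewrite coact_indE /ind_coact0 tsum_bil_pair; last by lin.
have nP : (coinv_val n : M) \in coinv_pred M := valP n.
rewrite /adj_counit blinE (ev_act _ nP).
rewrite -[in RHS](p_split a) (@lin_tsum _ _ _ _ _ (fun x => evH (coinv_val n) *A x)); last by lin.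
apply: eq_tsum => a0 a1; rewrite tsum_pair; last by lin.
by rewrite evpE (@hactAm _ _ _ (ca_hopf A)) ?(valP (p a0)).
Qed.

(** The first factor of H ⊗ H is an inert label that survives the evaluation; it will hold the
    H-component of a coaction. *)
Fact evV_bil : @bil k (com_free H H) A _ (fun s c => \tsum_(v ⊗ h <- s) (evH (h ⊗ c) ⊗ v)).
Proof. by lin. Qed.

Definition evV : 'Lin(M', A ⊗ H) := tlin evV_bil.

Fact evVp_bil : @bil k (coinv_rmod M') (ca_left A) (A ⊗ H)%type
  (fun t r => \tsum_(x ⊗ v <- evV (coinv_val t)) ((x *A coinv_val (p r)) ⊗ v)).
Proof. by have vL := coinv_lin M'; lin. Qed.

Lemma evV_mul_coinv (t : M') (b : A) : b \in coinv_pred A ->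
  evV (t *M b) = \tsum_(x ⊗ v <- evV t) ((x *A b) ⊗ v).
Proof.
move=> bP; move: t; apply: tens_ext; [lin|lin|] => s c.
rewrite [hact _ _](free_act_coinv _ _ bP) /evV !tlinE tsum_bil_pair; last by lin.
apply: eq_tsum => v h; rewrite tsum_pair; last by lin.
by rewrite ev_mul_coinv.
Qed.

Fact evVp_bal : @balanced k _ (coinv_rmod M') (ca_left A) (A ⊗ H)%type
  (fun t r => \tsum_(x ⊗ v <- evV (coinv_val t)) ((x *A coinv_val (p r)) ⊗ v)).
Proof.
move=> t b r; rewrite !tlinE p_mul tlinE.
change (\tsum_(x ⊗ v <- evV ((coinv_val t : M') *M coinv_val b)) ((x *A coinv_val (p r)) ⊗ v) =
  \tsum_(x ⊗ v <- evV (coinv_val t)) ((x *A (coinv_val b *A coinv_val (p r))) ⊗ v)).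
rewrite (evV_mul_coinv _ (valP b)).
rewrite tsum_bil_pair; last by lin.
apply: eq_tsum => x v; rewrite tsum_pair; last by lin.
by rewrite (@hactAm _ _ _ (ca_hopf A)) ?(valP b).
Qed.

Definition evVp : 'Lin(btens (coinv_rmod M') (ca_left A), (A ⊗ H)) :=
  blin evVp_bil evVp_bal.

Lemma evVpE t r : evVp (bpair t r) =
  \tsum_(x ⊗ v <- evV (coinv_val t)) ((x *A coinv_val (p r)) ⊗ v).
Proof. exact: blinE. Qed.

Lemma coact_com_free (v h : H) : coact ((v ⊗ h) : com_free H H) =
  \sw_(h1, h2 <- h) ((v ⊗ h1) ⊗ h2).
Proof. exact: tlinE. Qed.

Section Inclusion.
Variable v : H.

Fact inclusion_lin : @lin k (com_reg H) (com_free H H) (fun h : H => v ⊗ h).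
Proof. by lin. Qed.

Lemma inclusion_colinear : colinear (M := com_reg H) (M' := com_free H H) (mklin inclusion_lin).
Proof. by move=> h; exact: coact_com_free. Qed.

Definition inclusion := free_map A inclusion_colinear.

Lemma evVp_inclusion t : evVp (ind_map (coinv_map inclusion) t) = evp t ⊗ v.
Proof.
move: t; apply: btens_ext; [lin|lin|] => n r; rewrite ind_mapE evVpE evpE.
have evVi (t : M) : evV (inclusion t) = evH t ⊗ v.
  move: t; apply: tens_ext; [lin|lin|] => h c.
  by rewrite free_mapE /evV tlinE tsum_pair //; lin.
by rewrite evVi tsum_pair //; lin.
Qed.

End Inclusion.

Fact twist_lin : @lin k (com_reg H) (com_free H H)
  (fun h : H => \sw_(h1, h2 <- h) (antipode h1 ⊗ h2)).
Proof. by slin. Qed.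

Lemma twist_colinear : colinear (M := com_reg H) (M' := com_free H H) (mklin twist_lin).
Proof.
move=> h; change (H : Type) in h; have E := coact_com_free.
transitivity (\sw_(h1, h2 <- h) coact ((antipode h1 ⊗ h2) : com_free H H)).
  exact: linf_tsum.
transitivity (\sw_(h1, h2, h3 <- h) ((antipode h1 ⊗ h2) ⊗ h3)).
  by under eq_sw2 => h1 h2 do rewrite E; sweedler [:: h].
by rewrite -[@coact _ _ (com_reg H) h]/(comul h) /=; sweedler [:: h].
Qed.

Definition twist := free_map A twist_colinear.

(** The labels S(h_1) put in by [twist] are the ones that [ev_coact] finds in the coaction. *)
Lemma evVp_twist t : evVp (ind_map (coinv_map twist) t) = coact (evp t).
Proof.
move: t; apply: btens_ext; [lin|lin|] => n r; rewrite ind_mapE evVpE evpE.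
rewrite (@coact_hactr _ _ _ (ca_hopf A)) ?(valP (p r)) //.
have nP : (coinv_val n : M) \in coinv_pred M := valP n.
have evVt (t : M) : evV (twist t) =
    \tsum_(h ⊗ c <- t) \sw_(h1, h2 <- h) (evH (h2 ⊗ c) ⊗ antipode h1).
  move: t; apply: tens_ext; [lin|slin|] => h c; change (H : Type) in h.
  rewrite free_mapE /evV tlinE tsum_pair; last by slin.
  transitivity (\tsum_(v ⊗ l <- \sw_(h1, h2 <- h) (antipode h1 ⊗ h2)) (evH (l ⊗ c) ⊗ v)).
    by [].
  by sweedler [:: h].
by rewrite (ev_coact nP) -evVt.
Qed.

Lemma weak_structure_left_inverse : weak_structure_theorem A -> exists delta : 'Lin(H, A),
  (forall h, coact (delta h) = \sw_(h1, h2 <- h) (delta h2 ⊗ antipode h1)) /\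
  (forall h, \sw_(h1, h2 <- h) (delta h1 *A gamma h2) = qalpha h *: caone).
Proof.
move=> WST; have [ci canK ciK] := WST M; have [ci' canK' _] := WST M'.
have ciL : lin ci by split=> a x y; apply: (can_inj canK); rewrite linearP !ciK.
pose T := btens (coinv_rmod M) (ca_left A).
pose cil : 'Lin(H ⊗ A, T) := mklin ciL.
have tauL : lin (fun h : H => cil (h ⊗ (caone : A))) by lin.
pose tau : 'Lin(H, T) := mklin tauL.
have cou_tau h : adj_counit M (tau h) = h ⊗ (caone : A) by exact: ciK.
exists (lin_comp evp tau); split=> h.
  (* By naturality both sides go to the sum of (S(h_1) ⊗ h_2) ⊗ 1 under the counit at [M'], which is
     injective. *)
  have E : ind_map (coinv_map twist) (tau h) =
      \sw_(h1, h2 <- h) ind_map (coinv_map (inclusion (antipode h1))) (tau h2).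
    apply: (can_inj canK'); rewrite adj_counit_natural cou_tau free_mapE linf_tsum.
    transitivity ((\sw_(h1, h2 <- h) (antipode h1 ⊗ h2)) ⊗ (caone : A)); first by [].
    transitivity (\sw_(h1, h2 <- h) ((antipode h1 ⊗ h2) ⊗ (caone : A))); first by sweedler [:: h].
    apply: eq_tsum => h1 h2; rewrite adj_counit_natural cou_tau; exact/esym/free_mapE.
  rewrite -[LHS]evVp_twist E linf_tsum.
  by apply: eq_tsum => h1 h2; exact: evVp_inclusion.
have E : coact (tau h : induced (coinv_rmod M)) = \sw_(h1, h2 <- h) (tau h1 ⊗ h2).
  (* The counit is colinear, so its inverse transports the coaction of h ⊗ 1 to [tau h]. *)
  have -> : coact (tau h : induced (coinv_rmod M)) =
    \tsum_(x ⊗ y <- coact (adj_counit M (tau h))) (cil x ⊗ y).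
    rewrite adj_counit_colinear tsum_bil_pair; last by lin.
    rewrite -[LHS]tsum_id; apply: eq_tsum => x y; rewrite tsum_pair; last by lin.
    by congr (_ ⊗ _); exact/esym/canK.
  rewrite cou_tau (@coact_freeE _ _ A (com_reg H)).
  by rewrite -[@coact _ _ (com_reg H) h]/(comul h) coact_caone; sweedler [:: h].
transitivity (evH (adj_counit M (tau h))).
  by rewrite -evp_gamma E; sweedler [:: h].
by rewrite cou_tau evE coact_caone; sweedler [:: h].
Qed.

End WeakStructureLeftInverse.

Theorem theorem27 (k : fieldType) (H : coquasi_hopf k)
    (A : comodule_algebra H) (S_bij : bijective (antipode (c := H))) :
  [/\ cleft A <-> (weak_structure_theorem A /\ normal_basis A),
      (weak_structure_theorem A /\ normal_basis A) <->
        (galois A /\ normal_basis A)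
    & cleft A -> strong_structure_theorem A].
Proof.
have cleftP : cleft A -> [/\ weak_structure_theorem A, normal_basis A, galois A
    & strong_structure_theorem A].
  case=> gamma [delta [gamma_colinear deltaP]].
  have delta_coact h : coact (delta h) = \sw_(h1, h2 <- h) (delta h2 ⊗ antipode h1).
    by case: (deltaP h).
  have delta_gamma h : \sw_(h1, h2 <- h) (delta h1 *A gamma h2) = qalpha h *: caone.
    by case: (deltaP h).
  split.
  - exact: left_inverse_weak_structure gamma_colinear delta_coact delta_gamma.
  - apply: cleft_normal_basis gamma_colinear delta_coact delta_gamma _ => h.
    by case: (deltaP h).
  - exact: cleft_galois gamma_colinear delta_coact delta_gamma.
  exact: left_inverse_strong_structure gamma_colinear delta_coact delta_gamma.
have weak_cleft : weak_structure_theorem A -> normal_basis A -> cleft A.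
  move=> weak /normal_basis_split[gamma [p [gamma_colinear p_mul p_gamma p_split]]].
  have [delta [dC dg]] := weak_structure_left_inverse p_mul p_split weak.
  exact: left_inverse_cleft gamma_colinear p_mul p_gamma dC dg.
have galois_cleft : galois A -> normal_basis A -> cleft A.
  move=> gal /normal_basis_split[gamma [p [gamma_colinear p_mul p_gamma p_split]]].
  have [delta [dC dg]] := galois_left_inverse p_mul p_split gal.
  exact: left_inverse_cleft gamma_colinear p_mul p_gamma dC dg.
split.
- by split=> [/cleftP[]|[]].
- by split=> -[? ?]; split=> //; [case: (cleftP _)|case: (cleftP _)]; auto.
by case/cleftP.
Qed.
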